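(* Let $m\ge2$ and $T>0$ be real. Then for any $u\in C([0,T],C^m_{\mathrm{ap}}(\mathbb{R}^n,\mathbb{R}^n))$ there exists a unique solution $\varphi\in C^1([0,T],\mathrm{Diff}^m_{\mathrm{ap}}(\mathbb{R}^n))$ of $$\dot\varphi=u\circ\varphi,\qquad\varphi|_{t=0}=\mathrm{id}.$$
   Context: For real $m\ge0$, $C^m_b(\mathbb{R}^n,\mathbb{R})$ is the standard Hölder space: for integer $m$, $C^m$ functions with bounded continuous derivatives of order $\le m$, norm $\max_{|\beta|\le m}\sup|\partial^\beta f|$; for $m=k+\gamma$ ($0<\gamma<1$), functions in $C^k_b$ with $\gamma$-Hölder order-$k$ derivatives, norm $|f|_k$ plus the $\gamma$-Hölder seminorm of the order-$k$ derivatives. $C^m_{\mathrm{ap}}=\{f\in C^m_b:\{f(\cdot+c)\}_{c\in\mathbb{R}^n}\text{ precompact in }C^m_b\}$; vector-valued versions componentwise. $\mathrm{Diff}^m_{\mathrm{ap}}(\mathbb{R}^n)$ ($m\ge1$) is the set of maps $\varphi=\mathrm{id}+f$ with $f\in C^m_{\mathrm{ap}}(\mathbb{R}^n,\mathbb{R}^n)$ and $\det(I+[d_xf])>\varepsilon$ for all $x$ and some $\varepsilon>0$, a Banach manifold via $\varphi\mapsto\varphi-\mathrm{id}$ (open subset of $C^m_{\mathrm{ap}}(\mathbb{R}^n,\mathbb{R}^n)$). *)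

(* Defs.v *)
From HB Require Import structures.
From mathcomp Require Import all_boot all_order all_algebra.
From mathcomp Require Import all_classical all_reals all_analysis.
Set Implicit Arguments. Unset Strict Implicit. Unset Printing Implicit Defensive.
Import Order.TTheory GRing.Theory Num.Theory.
Import numFieldNormedType.Exports.
Local Open Scope classical_set_scope.
Local Open Scope ring_scope.

Section Defs.
Variables (R : realType) (n : nat).
Local Notation V := 'rV[R]_n.

Definition edir (i : 'I_n) : V := delta_mx 0 i.

Definition pd (s : seq 'I_n) (f : V -> R) : V -> R :=
  foldr (fun i g => fun x => 'D_(edir i) g x) f s.

Definition ipart (m : R) : nat := Num.truncn m.
Definition fpart (m : R) : R := m - (ipart m)%:R.

Definition Ckb (k : nat) (f : V -> R) : Prop :=
  (forall s : seq 'I_n, (size s < k)%N -> forall i x, derivable (pd s f) x (edir i)) /\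
  (forall s : seq 'I_n, (size s <= k)%N ->
     continuous (pd s f) /\ exists M : R, forall x, `|pd s f x| <= M).

Definition Cmb (m : R) (f : V -> R) : Prop :=
  Ckb (ipart m) f /\
  (fpart m != 0 -> forall s : seq 'I_n, size s = ipart m ->
     exists C : R, forall x y, `|pd s f x - pd s f y| <= C * `|x - y| `^ fpart m).

Definition hnorm (m : R) (f : V -> R) : R :=
  sup [set r | exists s : seq 'I_n, exists x,
               (size s <= ipart m)%N /\ r = `|pd s f x|] +
  (if fpart m == 0 then 0 else
   sup [set r | exists s : seq 'I_n, exists x y, size s = ipart m /\ x != y /\
               r = `|pd s f x - pd s f y| / `|x - y| `^ fpart m]).

(* C^m_ap: translates {f(. + c)} precompact (= totally bounded) in C^m_b *)
Definition Cmap (m : R) (f : V -> R) : Prop :=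
  Cmb m f /\
  forall eps : R, 0 < eps -> exists cs : seq V, forall c : V,
    exists2 d, d \in cs & hnorm m (fun x => f (x + c) - f (x + d)) < eps.

Definition comp (i : 'I_n) (f : V -> V) : V -> R := fun x => f x 0 i.
Definition Cmap_vec (m : R) (f : V -> V) : Prop := forall i, Cmap m (comp i f).
Definition vnorm (m : R) (f : V -> V) : R := \sum_i hnorm m (comp i f).

Definition jac (f : V -> V) (x : V) : 'M[R]_n :=
  \matrix_(i, j) 'D_(edir j) (comp i f) x.

Definition Diffap (m : R) (phi : V -> V) : Prop :=
  let f := fun x => phi x - x in
  Cmap_vec m f /\ exists eps : R, 0 < eps /\ forall x, \det (1%:M + jac f x) > eps.

Definition inI (T t : R) := 0 <= t <= T.

Definition Cm_curve (m T : R) (v : R -> V -> V) : Prop :=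
  (forall t, inI T t -> Cmap_vec m (v t)) /\
  forall t, inI T t -> forall eps : R, 0 < eps -> exists2 delta : R, 0 < delta &
    forall s, inI T s -> `|s - t| < delta -> vnorm m (fun x => v s x - v t x) < eps.

Definition Cm_deriv (m T : R) (f g : R -> V -> V) : Prop :=
  forall t, inI T t -> forall eps : R, 0 < eps -> exists2 delta : R, 0 < delta &
    forall s, inI T s -> 0 < `|s - t| < delta ->
      vnorm m (fun x => (s - t)^-1 *: (f s x - f t x) - g t x) < eps.

(* phi in C^1([0,T], Diff^m_ap) (via the chart phi |-> phi - id) with
   derivative dphi, solving dphi = u o phi, phi(0) = id *)
Definition is_solution (m T : R) (u phi : R -> V -> V) : Prop :=
  (forall t, inI T t -> Diffap m (phi t)) /\
  exists dphi : R -> V -> V,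
    Cm_deriv m T (fun t x => phi t x - x) dphi /\ Cm_curve m T dphi /\
    (forall t, inI T t -> forall x, dphi t x = u t (phi t x)) /\
    (forall x, phi 0 x = x).

End Defs.

(* Main.v *)
(** The flow [P] of [u] exists pointwise by Picard iteration; all its other properties come from
    Gronwall estimates. The translate [P(t, x + c) - c] is the flow of the translate [u(t, x + c)],
    so continuous dependence on the field carries total boundedness of the translates from [u] to
    [P]. The spatial derivatives of [P - id] solve a linear equation with coefficients [Du o P], and
    a linear equation with coefficients in C([0,T], C^r_ap) has its solution in that space; hence
    [P - id] in C^r_ap gives [Du o P], and then [DP], in C^r_ap as long as [r <= m - 1], and the
    regularity climbs to order [m]. Continuity in time of [u o P] in a Hoelder norm would fail in
    general: it holds because a Hoelder function with totally bounded translates has small Hoelder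
    quotients at small scales. The Jacobian matrix has a bounded inverse, which solves the adjoint
    linear equation, so its determinant stays away from [0] and positive.

    Write [m = k + g] with [k] an integer and [0 <= g < 1]. All orders of derivatives are measured
    in the [g]-Hoelder norm; for [g = 0] this costs only a factor [2], since [x `^ 0 = 1] for all
    [x]. *)
Require Import Defs.
From HB Require Import structures.
From mathcomp Require Import all_boot all_order all_algebra.
From mathcomp Require Import all_classical all_reals all_analysis.
From mathcomp Require Import perm ring lra.
Set Implicit Arguments. Unset Strict Implicit. Unset Printing Implicit Defensive.
Import Order.TTheory GRing.Theory Num.Theory.
Import numFieldNormedType.Exports.
Local Open Scope classical_set_scope.
Local Open Scope ring_scope.

(** * Gronwall and Picard *)

(** Every equation is solved pointwise in [x], in finite dimension; the function spaces enter only
    through estimates whose constants do not depend on [x]. The bootstrap must start without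
    circularity. Gronwall compares translates of [P] in the sup norm only, and this is enough:
    composing a field having small Hoelder quotients at small scales with the Lipschitz map [P]
    needs no Hoelder closeness of the translates of [P]. So [Du o P] is controlled at order [0]
    before anything is known about [P - id] in a Hoelder norm; that control then comes from the
    derivatives of [P - id]. Since [g < 1], a Lipschitz function itself has small Hoelder quotients
    at small scales, so that one derivative pays for everything needed one order below. *)

Lemma fin_unif (J : finType) (X : Type) (P : J -> X -> Prop) (x0 : X) :
  (forall x y, exists z, forall j, P j x \/ P j y -> P j z) ->
  (forall j, exists x, P j x) -> exists x, forall j, P j x.
Proof.
move=> join H; suff [x Hx] : exists x, forall j, j \in enum J -> P j x.
  by exists x => j; apply: Hx; rewrite mem_enum.
elim: (enum J) => [|j r [x Hx]]; first by exists x0.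
have [y Hy] := H j; have [z Hz] := join x y; exists z => k.
by rewrite inE => /predU1P[->|/Hx kx]; apply: Hz; [right|left].
Qed.

Lemma fin_unif_le (R : realType) (J : finType) (P : J -> R -> Prop) :
  (forall j x y, x <= y -> P j x -> P j y) ->
  (forall j, exists2 x, 0 <= x & P j x) -> exists2 x, 0 <= x & forall j, P j x.
Proof.
move=> mono H.
have [x y|j|x Hx] := @fin_unif J R (fun j x => 0 <= x /\ P j x) 0.
- exists (Num.max x y) => j [[x0 Px]|[y0 Py]]; split.
  + by rewrite le_max x0.
  + by apply: mono Px; rewrite le_max lexx.
  + by rewrite le_max y0 orbT.
  + by apply: mono Py; rewrite le_max lexx orbT.
- by have [x x0 Px] := H j; exists x.
exists (Num.max x 0) => [|j]; first by rewrite le_max lexx orbT.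
by apply: mono (Hx j).2; rewrite le_max lexx.
Qed.

Lemma fin_unif_ge (R : realType) (J : finType) (P : J -> R -> Prop) :
  (forall j x y, x <= y -> P j y -> P j x) ->
  (forall j, exists2 x, 0 < x & P j x) -> exists2 x, 0 < x & forall j, P j x.
Proof.
move=> mono H.
have [x y|j|x Hx] := @fin_unif J R (fun j x => 0 < x /\ forall z, z <= x -> P j z) 0.
(* A candidate that serves no index may be nonpositive; then it cannot enter the minimum and the
   other candidate is taken. *)
- have [xy|yx] := leP x y; [exists (if 0 < x then x else y)|exists (if 0 < y then y else x)].
    move=> j [[x0 Px]|[y0 Py]]; [by rewrite x0|case: ifP => // x0; split=> // z zx].
    by apply: Py; apply: le_trans xy.
  move=> j [[x0 Px]|[y0 Py]]; [case: ifP => // y0; split=> // z zy|by rewrite y0].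
  by apply: Px; apply: le_trans (ltW yx).
- by have [x x0 Px] := H j; exists x; split => // z zx; apply: mono Px.
have [x0|x0] := ltP 0 x.
  by exists x => // j; apply: (Hx j).2.
exists 1 => // j; have [+ _] := Hx j; by rewrite ltNge x0.
Qed.

(** The geometric tail from [k] on is [2 * C * 2^-1 ^+ k]: subtracting it makes the sequence
    nondecreasing, adding it makes it nonincreasing. The supremum of the lower sequence lies between
    both, which gives the limit together with its rate. *)
Lemma geometric_limit (R : realType) (a : nat -> R) (C : R) :
  (forall k, `|a k.+1 - a k| <= C * 2^-1 ^+ k) ->
  exists l, forall k, `|a k - l| <= 2 * C * 2^-1 ^+ k.
Proof.
move=> H; pose b k := a k - 2 * C * 2^-1 ^+ k; pose c k := a k + 2 * C * 2^-1 ^+ k.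
have bm : {homo b : x y / (x <= y)%N >-> x <= y}.
  apply: homo_leq => [x //|y x z|k]; first exact: le_trans.
  have := H k; rewrite /b exprS ler_norml.
  set q := _ ^+ k; lra.
have cm : {homo c : x y / (x <= y)%N >-> y <= x}.
  apply: (@homo_leq _ _ (fun x y => y <= x)) => [x //|y x z xy yz|k]; first exact: le_trans yz xy.
  have := H k; rewrite /c exprS ler_norml.
  set q := _ ^+ k; lra.
have C0 : 0 <= C by have := H 0; rewrite expr0 mulr1; apply: le_trans.
have bc j k : b j <= c k.
  have h1 := bm _ _ (leq_maxl j k); have h2 := cm _ _ (leq_maxr j k).
  apply: (le_trans h1); apply: le_trans h2.
  rewrite /b /c; have : 0 <= C * 2^-1 ^+ maxn j k by rewrite mulr_ge0 // exprn_ge0 // invr_ge0.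
  set q := _ ^+ _; lra.
have ub k : ubound (range b) (c k) by move=> _ [j _ <-].
exists (sup (range b)) => k.
have h1 : b k <= sup (range b).
  by apply: ub_le_sup; [exists (c 0) | exists k].
have h2 : sup (range b) <= c k by apply: ge_sup => //; exists (b 0), 0.
rewrite ler_norml; move: h1 h2; rewrite /b /c; lra.
Qed.

Lemma le_geometric_eq0 (R : realType) (x C : R) :
  (forall k, `|x| <= C * 2^-1 ^+ k) -> x = 0.
Proof.
move=> H; apply/eqP; apply: contraT; rewrite -normr_gt0 => x0.
have C0 : 0 <= C by have := H 0; rewrite expr0 mulr1; apply: le_trans.
have [k Hk] : exists k : nat, C / `|x| < k%:R.
  by exists (Num.truncn (C / `|x|)).+1; apply: truncnS_gt.
have := H k; rewrite exprVn ler_pdivlMr ?exprn_gt0 // => h.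
move: Hk; rewrite ltr_pdivrMr // => h2.
have : k%:R <= 2 ^+ k :> R by rewrite -natrX ler_nat ltnW // ltn_expl.
have k0 : 0 <= k%:R :> R by [].
nra.
Qed.

(** * Calculus in the time variable on a compact interval *)

Section TimeCalculus.
Variables (R : realType) (T : R).
Local Notation I := (inI T).
Implicit Types (w v : R -> R) (s t e d : R).

Definition contI w := {within `[0, T], continuous w}.

Lemma contIP w : contI w <-> forall t, I t -> forall e, 0 < e ->
  exists2 d, 0 < d & forall s, I s -> `|s - t| < d -> `|w s - w t| <= e.
Proof.
have E t : I t = [set` `[0, T]] t :> Prop by rewrite /= in_itv.
rewrite /contI subspace_continuousP; split=> H t.
  move=> It e e0; have /cvgrPdist_le/(_ e e0) : w @ within [set` `[0, T]] (nbhs t) --> w t.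
    by apply: H; rewrite -E.
  rewrite near_withinE => /nbhs_ballP[d /= d0 Hd].
  exists d => // s Is std; rewrite distrC; apply: Hd; last by rewrite in_itv.
  by rewrite -ball_normE /= distrC.
rewrite -E => It; apply/cvgrPdist_le => e e0; have [d d0 Hd] := H t It e e0.
rewrite near_withinE; apply/nbhs_ballP; exists d => //= s.
rewrite -ball_normE /= => st; rewrite in_itv /= => Is.
by rewrite distrC; apply: Hd => //; rewrite distrC.
Qed.

(* One-sided derivatives at the ends of [[0, T]] are never needed: the mean value theorem
   uses continuity there. *)
Definition ddt w v := contI w /\ forall t, 0 < t < T -> is_derive t 1 w (v t).

Lemma ddt_ext w w' v v' : (forall t, I t -> w t = w' t) ->
  (forall t, I t -> v t = v' t) -> ddt w v -> ddt w' v'.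
Proof.
move=> E E' [/contIP c d]; split.
  apply/contIP => t It e e0; have [r r0 H] := c t It e e0.
  by exists r => // s Is st; rewrite -!E //; apply: H.
move=> t /andP[t0 tT]; rewrite -E' ?/inI ?ltW //.
apply: near_eq_is_derive (d t _); last by rewrite t0 tT.
have : \forall s \near t, s \in `]0, T[ by apply: near_in_itvoo; rewrite in_itv /= t0.
apply: filterS => s; rewrite in_itv /= => /andP[s0 sT].
by apply: E; rewrite /inI !ltW.
Qed.

Lemma ddt_mono w v a b : ddt w v -> 0 <= a -> a <= b -> b <= T ->
  (forall t, a < t < b -> v t <= 0) -> w b <= w a.
Proof.
move=> [c d] a0 ab bT H; move: ab; rewrite le_eqVlt => /predU1P[->//|ab].
have [||x] := @MVT _ w v a b ab.
- move=> x; rewrite in_itv /= => /andP[ax xb]; apply: d.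
  by rewrite (le_lt_trans a0 ax) (lt_le_trans xb bT).
- apply: continuous_subspaceW c; apply: subset_itv; rewrite bnd_simp //.
rewrite in_itv /= => xab E; rewrite -subr_le0 E.
by rewrite mulr_le0_ge0 ?H ?subr_ge0 // ltW.
Qed.

Lemma ddt_cst (k : R) : ddt (fun=> k) (fun=> 0).
Proof. by split; [move=> x; apply: cvg_cst|move=> t _; apply: is_derive_cst]. Qed.

Lemma ddtD w v w' v' : ddt w v -> ddt w' v' ->
  ddt (fun t => w t + w' t) (fun t => v t + v' t).
Proof.
move=> [c d] [c' d']; split; first by move=> x; apply: cvgD; [exact: c|exact: c'].
by move=> t It; apply: is_deriveD; [exact: d|exact: d'].
Qed.

Lemma ddtN w v : ddt w v -> ddt (fun t => - w t) (fun t => - v t).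
Proof.
move=> [c d]; split; first by move=> x; apply: cvgN; exact: c.
by move=> t It; apply: is_deriveN; exact: d.
Qed.

Lemma ddtM w v w' v' : ddt w v -> ddt w' v' ->
  ddt (fun t => w t * w' t) (fun t => w t * v' t + w' t * v t).
Proof.
move=> [c d] [c' d']; split; first by move=> x; apply: cvgM; [exact: c|exact: c'].
by move=> t It; apply: is_deriveM; [exact: d|exact: d'].
Qed.

Lemma ddtB w v w' v' : ddt w v -> ddt w' v' ->
  ddt (fun t => w t - w' t) (fun t => v t - v' t).
Proof. by move=> h /ddtN; apply: ddtD. Qed.

Lemma ddtZ k w v : ddt w v -> ddt (fun t => k * w t) (fun t => k * v t).
Proof.
move=> h; have [c d] := ddtM (ddt_cst k) h; split => // t It.
by apply: is_derive_eq (d t It) _; rewrite mulr0 addr0.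
Qed.

Lemma ddt_sum (J : Type) (r : seq J) (w v : J -> R -> R) :
  (forall j, ddt (w j) (v j)) ->
  ddt (fun t => \sum_(j <- r) w j t) (fun t => \sum_(j <- r) v j t).
Proof.
move=> H; elim: r => [|j r IH].
  by apply: (ddt_ext _ _ (ddt_cst 0)) => t _; rewrite big_nil.
by apply: (ddt_ext _ _ (ddtD (H j) IH)) => t _; rewrite big_cons.
Qed.

Lemma ddt_id : ddt id (fun=> 1).
Proof. by split; [move=> x; apply: continuous_subspaceT => y; exact: cvg_id|move=> t _; apply: is_derive_id]. Qed.

Lemma ddt_expR k : ddt (fun t => expR (k * t)) (fun t => k * expR (k * t)).
Proof.
split.
  apply: continuous_subspaceT => x.
  apply: (@continuous_comp _ _ _ (fun y : R => k * y) (@expR R)).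
    by apply: cvgM; [exact: cvg_cst|exact: cvg_id].
  exact: continuous_expR.
move=> t _.
have h : is_derive t 1 (fun y : R => k * y) k.
  have := @is_deriveM _ _ (cst k) id t 1 0 1 _ _.
  by move=> h; apply: is_derive_eq (h _ _) _; rewrite scaler0 addr0 /GRing.scale /= mulr1.
have := @is_derive1_comp _ (@expR R) (fun y : R => k * y) t _ _ (is_derive_expR _) h.
by move=> h2; apply: is_derive_eq h2 _; rewrite mulrC.
Qed.

(** The function [(E + D / C) * exp (- C t)] has nonpositive derivative. *)
Lemma gronwall_scalar (E E' : R -> R) (C D : R) : 0 < C -> 0 <= D -> ddt E E' ->
  0 <= E 0 ->
  (forall t, 0 < t < T -> E' t <= C * E t + D) ->
  forall t, I t -> E t <= (E 0 + D / C) * expR (C * T).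
Proof.
move=> C0 D0 dE E0 H t /andP[t0 tT].
have d1 := ddtM (ddtD dE (ddt_cst (D / C))) (ddt_expR (- C)).
have := ddt_mono d1 (lexx 0) t0 tT.
move=> /(_ _)/wrap[x /andP[x0 xt]|].
  have := H x; rewrite x0 (lt_le_trans xt tT) => /(_ isT) Hx.
  have DE : D = C * (D / C) by rewrite mulrC divfK // gt_eqF.
  rewrite (_ : _ + _ = (E' x - (C * E x + C * (D / C))) * expR (- C * x)); last by ring.
  by rewrite mulr_le0_ge0 ?expR_ge0 // subr_le0 -DE.
rewrite mulr0 expR0 mulr1 => h.
have DC : 0 <= D / C by rewrite divr_ge0 // ltW.
have h2 : E t + D / C <= (E 0 + D / C) * expR (C * t).
  rewrite -ler_pdivrMr ?expR_gt0 // -expRN -mulNr //.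
apply: (@le_trans _ _ (E t + D / C)); first by rewrite lerDl.
apply: (le_trans h2); rewrite ler_wpM2l ?addr_ge0 // ler_expR ler_wpM2l // ltW //.
Qed.

(** Both [w - g] and [- w - g] are nonincreasing. A varying majorant is needed for the exponential
    weight of the Picard iteration. *)
Lemma ddt_dom w v g h a b : ddt w v -> ddt g h -> 0 <= a -> a <= b -> b <= T ->
  (forall t, a < t < b -> `|v t| <= h t) -> `|w b - w a| <= g b - g a.
Proof.
move=> dw dg a0 ab bT H.
have d1 := ddtB dw dg; have d2 := ddtB (ddtN dw) dg.
have := ddt_mono d1 a0 ab bT; have := ddt_mono d2 a0 ab bT.
move=> /(_ _)/wrap[x xab|h2]; first by have := H x xab; rewrite ler_norml; lra.
move=> /(_ _)/wrap[x xab|h1]; first by have := H x xab; rewrite ler_norml; lra.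
rewrite ler_norml; lra.
Qed.

Lemma ddt_bound w v a b C : ddt w v -> 0 <= a -> a <= b -> b <= T ->
  (forall t, a < t < b -> `|v t| <= C) -> `|w b - w a| <= C * (b - a).
Proof.
move=> dw a0 ab bT H; have := ddt_dom dw (ddtZ C ddt_id) a0 ab bT.
by rewrite mulr1 mulrBr; exact.
Qed.

Lemma contI_bounded w : 0 < T -> contI w -> exists2 M, 0 <= M & forall t, I t -> `|w t| <= M.
Proof.
move=> T0 cw; have [c _ Hc] := EVT_max (ltW T0) cw.
have cw' : contI (fun t => - w t) by move=> x; apply: cvgN; exact: cw.
have [d _ Hd] := EVT_max (ltW T0) cw'.
exists (`|w c| + `|w d|) => [|t It]; first by rewrite addr_ge0.
have := Hc t; have := Hd t; rewrite in_itv /= => /(_ It) h1 /(_ It) h2.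
have := ler_norm (w c); have := ler_norm (- w d); rewrite normrN.
have := normr_ge0 (w c); have := normr_ge0 (w d); rewrite ler_norml; lra.
Qed.

(** The only use of integration; all estimates rest on the mean value theorem instead. *)
Lemma antiderivative w : 0 < T -> contI w -> exists2 W, W 0 = 0 & ddt W w.
Proof.
move=> T0 cw; pose mu := @lebesgue_measure R.
have ci : mu.-integrable `[0, T] (EFin \o w).
  by apply: continuous_compact_integrable => //; exact: segment_compact.
exists (fun x => parameterized_integral mu 0 x w).
  by rewrite /parameterized_integral set_itv1 Rintegral_set1.
split; first exact: (parameterized_integral_continuous (ltW T0) ci).
move=> t /andP[t0 tT].
have [|] := @continuous_FTC1_closed R w 0 t T tT ci t0.
  have : {for t, continuous (w : subspace `[0, T] -> R)} by exact: cw.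
  rewrite /prop_for /continuous_at; rewrite /= -nbhs_subspace_interior //.
  by rewrite interior_itv /= in_itv /= t0.
by move=> dF F'; apply: DeriveDef => //; rewrite -derive1E.
Qed.

End TimeCalculus.

Section VectorCalculus.
Variables (R : realType) (T : R) (n : nat).
Local Notation I := (inI T).
Local Notation V := 'rV[R]_n.

Lemma rVBE (x y : V) i : (x - y) 0 i = x 0 i - y 0 i.
Proof. by rewrite !mxE. Qed.

Lemma le_coord (x : V) i : `|x 0 i| <= `|x|.
Proof.
by rewrite [leRHS]mx_normrE; apply: (@le_bigmax _ _ _ 0 (fun ij => `|x ij.1 ij.2|) (0, i)).
Qed.

Lemma le_rV (x : V) (c : R) : 0 <= c -> (forall i, `|x 0 i| <= c) -> `|x| <= c.
Proof.
move=> c0 H; rewrite [leLHS]mx_normrE; apply: bigmax_le => // -[i j] _ /=.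
by rewrite ord1.
Qed.

Lemma le_sum_ord (F : 'I_n -> R) (c : R) : (forall i, F i <= c) -> \sum_i F i <= n%:R * c.
Proof.
move=> H; apply: (le_trans (ler_sum _ (fun i _ => H i))).
by rewrite sumr_const card_ord mulr_natl.
Qed.

Lemma norm_sum_ord (F : 'I_n -> R) (c : R) : (forall i, `|F i| <= c) -> `|\sum_i F i| <= n%:R * c.
Proof. by move=> H; apply: (le_trans (ler_norm_sum _ _ _)); exact: le_sum_ord. Qed.

Definition vddt (W W' : R -> V) := forall i, ddt T (fun t => W t 0 i) (fun t => W' t 0 i).

(* Scalar Gronwall for the sum of the squares of the coordinates, the sup norm not being
   differentiable. *)
Lemma gronwall (K : R) : 0 <= K -> exists2 G : R, 0 <= G &
  forall W W' (e : R), vddt W W' -> 0 <= e ->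
  (forall t, 0 < t < T -> `|W' t| <= K * `|W t| + e) ->
  forall t, I t -> `|W t| <= G * (`|W 0| + e).
Proof.
(* The sum of squares [S] satisfies [S' <= 2 n |W| |W'| <= n ((2 K + 1) |W|^2 + e^2) <= C S + n
   e^2], using [2 |W| e <= |W|^2 + e^2] and [|W|^2 <= S]. The added [1] gives [C >= 1], so that
   [n e^2 / C <= n e^2]. *)
move=> K0; pose C := n%:R * (2 * K + 1) + 1.
have n0 : 0 <= n%:R :> R by [].
have C1 : 1 <= C by rewrite lerDr mulr_ge0 //; lra.
pose q := n%:R * expR (C * T); have q0 : 0 <= q by rewrite mulr_ge0 ?expR_ge0.
(* Squares are bounded with the factor [q]; [q <= (q + 1)^2] avoids a square root. *)
exists (q + 1) => [|W W' e dW e0 H t It]; first by lra.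
have dS := @ddt_sum _ _ _ (index_enum _) _ _ (fun i => ddtM (dW i) (dW i)).
have := @gronwall_scalar _ T _ _ C (n%:R * (e * e)) _ _ dS.
move=> /(_ _ _ _ _)/wrap[||||h]; first by lra.
- by rewrite !mulr_ge0.
- by apply: sumr_ge0 => i _; rewrite -expr2 sqr_ge0.
- move=> s Is; have hs := H s Is.
  have E1 : `|W s| * `|W s| <= \sum_i W s 0 i * W s 0 i.
    have [/eqP ->|W0] := boolP (`|W s| == 0).
      by rewrite mul0r; apply: sumr_ge0 => i _; rewrite -expr2 sqr_ge0.
    have [i Hi] : exists i, `|W s| = `|W s 0 i|.
      by have [[j i] Hi] := @mx_norm_neq0 _ _ _ (W s) W0; exists i; rewrite [LHS]Hi /= ord1.
    rewrite (bigD1 i) //= Hi -normrM ger0_norm -?expr2 ?sqr_ge0 // lerDl.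
    by apply: sumr_ge0 => j _; rewrite sqr_ge0.
  have E2 : \sum_i (W s 0 i * W' s 0 i + W s 0 i * W' s 0 i) <=
      n%:R * (2 * (`|W s| * `|W' s|)).
    apply: le_sum_ord => i; apply: (le_trans (ler_norm _)).
    rewrite -mulr2n normrMn normrM mulr_natl lerMn2r /=.
    by apply: ler_pM => //; exact: le_coord.
  apply: (le_trans E2).
  have E3 : 2 * (`|W s| * `|W' s|) <= (2 * K + 1) * (`|W s| * `|W s|) + e * e.
    have w0 := normr_ge0 (W s).
    apply: (@le_trans _ _ (2 * (`|W s| * (K * `|W s| + e)))).
      by rewrite ler_wpM2l // ler_wpM2l.
    have := sqr_ge0 (`|W s| - e); rewrite expr2; nra.
  have E4 := ler_wpM2l n0 E3.
  have E5 := ler_wpM2l (mulr_ge0 n0 (_ : 0 <= 2 * K + 1)) E1.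
  have S0 : 0 <= \sum_i W s 0 i * W s 0 i.
    by apply: sumr_ge0 => i _; rewrite -expr2 sqr_ge0.
  have {}E5 : _ := E5 (_ : is_true (0 <= 2 * K + 1)).
  apply: (le_trans E4); rewrite [leLHS]mulrDr lerD2r mulrA.
  by apply: (le_trans (E5 _)); [lra|rewrite ler_wpM2r // lerDl].
have {}h := h t It.
set E := _ + _ in h.
have E6 : E <= n%:R * ((`|W 0| + e) * (`|W 0| + e)).
  apply: (@le_trans _ _ (n%:R * (`|W 0| * `|W 0|) + n%:R * (e * e))).
    rewrite /E lerD //; first apply: le_sum_ord => i.
      by apply: (le_trans (ler_norm _)); rewrite normrM ler_pM //; exact: le_coord.
    by rewrite ler_pdivrMr ?ler_peMr ?mulr_ge0 //; lra.
  rewrite -mulrDr ler_wpM2l //; have := normr_ge0 (W 0); nra.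
apply: le_rV => [|i]; first by rewrite mulr_ge0 ?addr_ge0.
have E7 : `|W t 0 i| * `|W t 0 i| <= q * ((`|W 0| + e) * (`|W 0| + e)).
  rewrite -normrM ger0_norm -?expr2 ?sqr_ge0 //.
  apply: (@le_trans _ _ (\sum_i W t 0 i * W t 0 i)).
    by rewrite (bigD1 i) //= expr2 lerDl; apply: sumr_ge0 => j _; rewrite -expr2 sqr_ge0.
  apply: (le_trans h); rewrite /q mulrAC ler_wpM2r ?expR_ge0 //.
have a0 : 0 <= `|W 0| + e by rewrite addr_ge0.
rewrite -(@ler_pXn2r _ 2) ?nnegrE ?mulr_ge0 //; last by lra.
rewrite expr2; apply: (le_trans E7); rewrite expr2 [leRHS]mulrACA ler_wpM2r ?mulr_ge0 //; nra.
Qed.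

Definition contV (Y : R -> V) := forall i, contI T (fun t => Y t 0 i).

Lemma contVP Y : contV Y -> forall t, I t -> forall e : R, 0 < e ->
  exists2 d : R, 0 < d & forall s, I s -> `|s - t| < d -> `|Y s - Y t| <= e.
Proof.
move=> cY t It e e0.
have [|i|d d0 Hd] := @fin_unif_ge R 'I_n (fun i d =>
   forall s, I s -> `|s - t| < d -> `|Y s 0 i - Y t 0 i| <= e).
- by move=> j x y xy H s Is st; apply: H => //; apply: lt_le_trans xy.
- by have /contIP/(_ t It e e0) := cY i.
exists d => // s Is st; apply: le_rV => [|i]; first exact: ltW.
by have := Hd i s Is st; rewrite !mxE.
Qed.

(** * Picard iteration for a globally Lipschitz field *)

Section Picard.
Variables (F : R -> V -> V) (K : R).
Hypotheses (T0 : 0 < T) (K0 : 0 <= K)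
  (Fcont : forall y, contV (F ^~ y))
  (Flip : forall t x y, I t -> `|F t x - F t y| <= K * `|x - y|).

Lemma contV_comp Y : contV Y -> contV (fun t => F t (Y t)).
Proof.
move=> cY i; apply/contIP => t It e e0.
have e1 : 0 < e / 2 by rewrite divr_gt0.
have e2 : 0 < e / 2 / (K + 1) by rewrite divr_gt0 //; have := K0; lra.
have [d1 d10 H1] := contVP cY It e2.
have [d2 d20 H2] := contVP (@Fcont (Y t)) It e1.
exists (Num.min d1 d2) => [|s Is]; first by rewrite lt_min d10.
rewrite lt_min => /andP[/(H1 s Is) h1 /(H2 s Is) h2].
have -> : F s (Y s) 0 i - F t (Y t) 0 i = (F s (Y s) - F s (Y t)) 0 i + (F s (Y t) - F t (Y t)) 0 i.
  by rewrite !mxE; ring.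
apply: (le_trans (ler_normD _ _)).
have h3 : `|(F s (Y t) - F t (Y t)) 0 i| <= e / 2 by apply: le_trans h2; exact: le_coord.
have h4 : `|(F s (Y s) - F s (Y t)) 0 i| <= e / 2.
  apply: (le_trans (le_coord _ _)); apply: (le_trans (Flip _ _ Is)).
  apply: (@le_trans _ _ ((K + 1) * (e / 2 / (K + 1)))).
    by apply: ler_pM => //; lra.
  by rewrite mulrC divfK // gt_eqF //; have := K0; lra.
lra.
Qed.

(* The increments of the Picard iteration decay geometrically in the norm weighted by
   [exp(- 2 K t)]. *)
Lemma picard y0 : exists Y, Y 0 = y0 /\ vddt Y (fun t => F t (Y t)).
Proof.
(* Antiderivatives are chosen once as a total operator, with a junk value on discontinuous
   integrands. *)
have /choice[Int HInt] : forall w, exists W, contI T w -> W 0 = 0 /\ ddt T W w.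
  move=> w.
  have [cw|ncw] := pselect (contI T w); last by exists (fun=> 0).
  by have [W W0 dW] := antiderivative T0 cw; exists W.
pose N (Y : R -> V) t : V := y0 + \row_i Int (fun s => F s (Y s) 0 i) t.
have N0 Y : contV Y -> N Y 0 = y0.
  move=> cY; apply/rowP => i; rewrite !mxE.
  by have [-> _] := HInt _ (@contV_comp Y cY i); rewrite addr0.
have dN Y : contV Y -> vddt (N Y) (fun t => F t (Y t)).
  move=> cY i; have [_ h] := HInt _ (@contV_comp Y cY i).
  by apply: ddt_ext (ddtD (ddt_cst T (y0 0 i)) h) => t _; rewrite ?mxE ?add0r.
have cN Y : contV Y -> contV (N Y) by move=> cY i; have [] := dN Y cY i.
pose Z k := iter k N (fun=> y0).
have cZ k : contV (Z k) by elim: k => [i|k IH]; [exact: (ddt_cst T (y0 0 i)).1|exact: cN].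
have [M M0 HM] : exists2 M, 0 <= M & forall i t, I t -> `|Z 1%N t 0 i - Z 0%N t 0 i| <= M.
  apply: fin_unif_le => [i x y xy h t It|i]; first by apply: le_trans xy; exact: h.
  apply: contI_bounded => //; have [h _] := ddtB (dN _ (cZ 0%N) i) (ddt_cst T (y0 0 i)).
  exact: h.
have step k t : I t -> `|Z k.+1 t - Z k t| <= M * 2^-1 ^+ k * expR (2 * K * t).
  elim: k t => [|k IH] t It.
    apply: (@le_trans _ _ M).
      by apply: le_rV => // i; rewrite rVBE; exact: HM.
    rewrite expr0 mulr1 ler_peMr // -expR0 ler_expR mulr_ge0 ?mulr_ge0 //.
    by case/andP: It.
  have [t0 tT] := andP It.
  apply: le_rV => [|i]; first by rewrite !mulr_ge0 ?exprn_ge0 ?invr_ge0 ?expR_ge0.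
  (* The derivative of this majorant is [K] times the majorant of the previous increment: the
     exponent [2 * K] is what produces the ratio [1 / 2]. *)
  have dg := ddtZ (M * 2^-1 ^+ k.+1) (ddt_expR T (2 * K)).
  have := ddt_dom (ddtB (dN _ (cZ k.+1) i) (dN _ (cZ k) i)) dg (lexx 0) t0 tT.
  move=> /(_ _)/wrap[s /andP[s0 st]|].
    have Is : I s by rewrite /inI !ltW //= (lt_le_trans st).
    have -> : F s (Z k.+1 s) 0 i - F s (Z k s) 0 i = (F s (Z k.+1 s) - F s (Z k s)) 0 i by rewrite !mxE.
    apply: (le_trans (le_coord _ _)); apply: (le_trans (Flip _ _ Is)).
    apply: (le_trans (ler_wpM2l K0 (IH _ Is))); rewrite exprS.
    by rewrite le_eqVlt; apply/orP; left; apply/eqP; field.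
  rewrite !N0 // subrr subr0 mulr0 expR0 => h; rewrite rVBE; apply: (le_trans h).
  by rewrite lerBlDr lerDl mulr1 mulr_ge0 ?exprn_ge0 ?invr_ge0.
pose B := M * expR (2 * K * T).
have B0 : 0 <= B by rewrite mulr_ge0 ?expR_ge0.
have stepB t i k : I t -> `|Z k.+1 t 0 i - Z k t 0 i| <= B * 2^-1 ^+ k.
  move=> It; have -> : Z k.+1 t 0 i - Z k t 0 i = (Z k.+1 t - Z k t) 0 i by rewrite !mxE.
  apply: (le_trans (le_coord _ _)); apply: (le_trans (step k t It)).
  rewrite /B mulrAC ler_wpM2r ?exprn_ge0 ?invr_ge0 // ler_wpM2l // ler_expR ler_wpM2l ?mulr_ge0 //.
  by case/andP: It.
have /choice[Y HY] : forall t, exists y : V, I t -> forall k, `|Z k t - y| <= 2 * B * 2^-1 ^+ k.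
  move=> t.
  have [It|nIt] := boolP (I t); last by exists 0.
  have /choice[y Hy] := fun i => geometric_limit (fun k => stepB t i k It).
  exists (\row_i y i) => _ k; apply: le_rV => [|i]; last by rewrite !mxE.
  by rewrite !mulr_ge0 ?exprn_ge0 ?invr_ge0.
have cY : contV Y.
  move=> i; apply/contIP => t It e e0.
  have [k Hk] : exists k, 2 * B * 2^-1 ^+ k <= e / 3.
    have [//|h] := pselect (exists k, 2 * B * 2^-1 ^+ k <= e / 3).
    have : e / 3 = 0.
      apply: (@le_geometric_eq0 R _ (2 * B)) => k.
      have [h2|/ltW h2] := leP (2 * B * 2^-1 ^+ k) (e / 3); first by case: h; exists k.
      by rewrite ger0_norm // divr_ge0 // ltW.
    lra.
  have e3 : 0 < e / 3 by lra.
  have [d d0 Hd] := contVP (cZ k) It e3.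
  exists d => // s Is st; have h1 := Hd s Is st; have h2 := HY s Is k; have h3 := HY t It k.
  have -> : Y s 0 i - Y t 0 i = - (Z k s - Y s) 0 i + (Z k s - Z k t) 0 i + (Z k t - Y t) 0 i.
    by rewrite !mxE; ring.
  apply: (le_trans (ler_normD _ _)); apply: (le_trans (lerD (ler_normD _ _) (lexx _))).
  rewrite normrN.
  have := le_coord (Z k s - Y s) i; have := le_coord (Z k s - Z k t) i.
  have := le_coord (Z k t - Y t) i; lra.
(* The limit is a fixed point without exchanging limit and integral: [N Y] and [Z k.+1] start at
   [y0], and their derivatives differ by at most [K * |Y - Z k|]. *)
have NY t : I t -> N Y t = Y t.
  move=> It; apply/rowP => i; apply/eqP; rewrite -subr_eq0; apply/eqP.
  apply: (@le_geometric_eq0 R _ (2 * B * (K * T + 1))) => k.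
  have -> : N Y t 0 i - Y t 0 i = (N Y t 0 i - Z k.+1 t 0 i) + (Z k.+1 t - Y t) 0 i by rewrite !mxE; ring.
  have q0 : 0 <= B * 2^-1 ^+ k by rewrite !mulr_ge0 ?exprn_ge0 ?invr_ge0.
  have [t0 tT] := andP It.
  have h1 : `|(Z k.+1 t - Y t) 0 i| <= 2 * (B * 2^-1 ^+ k).
    apply: (le_trans (le_coord _ _)); apply: (le_trans (HY t It k.+1)).
    rewrite exprS; lra.
  have := ddt_bound (ddtB (dN _ cY i) (dN _ (cZ k) i)) (lexx 0) t0 tT.
  move=> /(_ (K * (2 * (B * 2^-1 ^+ k))) _)/wrap[s /andP[s0 st]|].
    have Is : I s by rewrite /inI !ltW //= (lt_le_trans st).
    have -> : F s (Y s) 0 i - F s (Z k s) 0 i = (F s (Y s) - F s (Z k s)) 0 i by rewrite !mxE.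
    apply: (le_trans (le_coord _ _)); apply: (le_trans (Flip _ _ Is)).
    by rewrite ler_wpM2l // distrC [leRHS]mulrA; exact: HY.
  rewrite !N0 // subrr !subr0 => h2.
  apply: (le_trans (ler_normD _ _)); apply: (le_trans (lerD h2 h1)).
  have : K * (2 * (B * 2^-1 ^+ k)) * t <= K * (2 * (B * 2^-1 ^+ k)) * T.
    by rewrite ler_wpM2l // !mulr_ge0 // exprn_ge0 // invr_ge0.
  set q := B * _ in q0 *; rewrite (_ : _ * _ * 2^-1 ^+ k = 2 * q * (K * T + 1)); last by rewrite /q; ring.
  lra.
exists (N Y); split; first exact: N0.
by move=> i; apply: ddt_ext (dN Y cY i) => // t It; rewrite NY.
Qed.

End Picard.

End VectorCalculus.

(** * Hoelder functions *)

(** The quotient is cleared, so that [h = 0] is no exception and remainders can be estimated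
    directly by Gronwall. *)
Lemma is_derive_epsP (R : realType) (U : normedModType R) (f : U -> R) (x v : U) (l : R) :
  is_derive x v f l <-> forall e : R, 0 < e -> exists2 d : R, 0 < d &
    forall h : R, `|h| < d -> `|f (x + h *: v) - f x - h * l| <= e * `|h|.
Proof.
split=> [[cf <-] e e0|H].
  have /cvgrPdist_le/(_ e e0) : (fun h => h^-1 *: ((f \o shift x) (h *: v) - f x)) @ 0^' --> 'D_v f x.
    exact: cf.
  rewrite near_withinE => /nbhs_ballP[d /= d0 Hd]; exists d => // h hd.
  have [->|h0] := eqVneq h 0; first by rewrite scale0r addr0 mul0r subrr subr0 normr0 mulr0.
  have := Hd h; rewrite -ball_normE /= sub0r normrN => /(_ hd h0).
  rewrite distrC -(ler_pM2r (_ : 0 < `|h|)) ?normr_gt0 //.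
  rewrite -normrM mulrBl [h *: v + x]addrC [_ *: (_ - _)]mulrC mulfVK //.
  by rewrite [_ * h]mulrC.
have c : (fun h => h^-1 *: ((f \o shift x) (h *: v) - f x)) @ 0^' --> l.
  apply/cvgrPdist_le => e e0; have [d d0 Hd] := H e e0.
  rewrite near_withinE; apply/nbhs_ballP; exists d => //= h.
  rewrite -ball_normE /= sub0r normrN => hd h0.
  rewrite distrC -(ler_pM2r (_ : 0 < `|h|)) ?normr_gt0 //.
  rewrite -normrM mulrBl [h *: v + x]addrC [_ *: (_ - _)]mulrC mulfVK //.
  by rewrite [l * h]mulrC; exact: Hd.
by apply: DeriveDef; [apply/cvg_ex; exists l|apply/cvg_lim].
Qed.

Section SpaceCalculus.
Variables (R : realType) (n : nat).
Local Notation V := 'rV[R]_n.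

Lemma is_derive_line (U : normedModType R) (f : U -> R) (x v : U) (s l : R) :
  is_derive (x + s *: v) v f l -> is_derive s 1 (fun r : R => f (x + r *: v)) l.
Proof.
move=> /is_derive_epsP H; apply/is_derive_epsP => e e0.
have [d d0 Hd] := H e e0; exists d => // h hd.
by rewrite (_ : h *: 1 = h) ?scalerDl ?addrA; [exact: Hd|rewrite /GRing.scale /= mulr1].
Qed.

Lemma line_expansion (U : normedModType R) (f g : U -> R) (v x : U) (a e s : R) :
  (forall y, is_derive y v f (g y)) ->
  (forall r, `|r| <= `|s| -> `|g (x + r *: v) - a| <= e) ->
  `|f (x + s *: v) - f x - a * s| <= e * `|s|.
Proof.
move=> df H; pose F r := f (x + r *: v).
have dF (r : R) : is_derive r 1 F (g (x + r *: v)) by apply: is_derive_line.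
have cF : continuous F.
  by move=> r; apply: differentiable_continuous; apply/derivable1_diffP; have [] := dF r.
have F0 : F 0 = f x by rewrite /F scale0r addr0.
suff [c cs E] : exists2 c, `|c| <= `|s| & F s - F 0 = g (x + c *: v) * s.
  by rewrite -/(F s) -F0 E -mulrBl normrM ler_wpM2r //; exact: H.
have [s0|s0] := leP 0 s.
  have [|c] := @MVT_segment R F (fun r => g (x + r *: v)) 0 s s0 (fun r _ => dF r).
    exact: continuous_subspaceT.
  rewrite in_itv /= => /andP[c0 cs] E; exists c; first by rewrite !ger0_norm.
  by rewrite E subr0.
have [|c] := @MVT_segment R F (fun r => g (x + r *: v)) s 0 (ltW s0) (fun r _ => dF r).
  exact: continuous_subspaceT.
rewrite in_itv /= => /andP[cs c0] E; exists c.
  by rewrite !ler0_norm ?lerN2 // ltW.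
by rewrite -opprB E sub0r mulrN opprK.
Qed.

(** The coordinates of [x] are replaced by those of [y] one at a time. In the sup norm all points
    met on the way stay within [|y - x|] of [x], so partial derivatives suffice. The slopes [a] are
    free: the derivatives at [x] give a Taylor remainder, and [0] gives a Lipschitz bound. *)
Lemma C1_expansion (f : V -> R) (g : 'I_n -> V -> R) (x y : V) (a : 'I_n -> R) (e : R) :
  (forall i z, is_derive z (edir R i) f (g i z)) ->
  (forall z, `|z - x| <= `|y - x| -> forall i, `|g i z - a i| <= e) ->
  `|f y - f x - \sum_i a i * (y 0 i - x 0 i)| <= n%:R * (e * `|y - x|).
Proof.
move=> df H.
pose p (k : nat) : V := \row_j (if (j < k)%N then y 0 j else x 0 j).
have p0 : p 0%N = x by apply/rowP => j; rewrite mxE.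
have pn : p n = y by apply/rowP => j; rewrite mxE ltn_ord.
have pS (k : 'I_n) : p k.+1 = p k + (y 0 k - x 0 k) *: edir R k.
  apply/rowP => j; rewrite !mxE eqxx /= ltnS leq_eqVlt.
  have [/val_inj ->|jk] := eqVneq (val j) (val k).
    by rewrite eqxx ltnn /= mulr1; ring.
  by rewrite /= (_ : (j == k) = false) ?mulr0 ?addr0 //; apply/negbTE.
have -> : f y - f x = \sum_(k < n) (f (p k.+1) - f (p k)).
  by rewrite -(big_mkord xpredT (fun k => f (p k.+1) - f (p k))) telescope_sumr // p0 pn.
rewrite -sumrB; apply: norm_sum_ord => k.
have e0 : 0 <= e.
  by have := H x _ k; rewrite subrr normr0 => /(_ (normr_ge0 _)); apply: le_trans.
apply: (@le_trans _ _ (e * `|y 0 k - x 0 k|)); last first.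
  by rewrite ler_wpM2l // -rVBE le_coord.
rewrite pS; apply: (line_expansion (g := g k)) => r hr.
apply: H; apply: le_rV => // j; rewrite !mxE eqxx /=.
have [->|jk] := eqVneq j k.
  by rewrite ltnn mulr1 addrC addKr (le_trans hr) // -rVBE le_coord.
rewrite mulr0 addr0; case: ifP => _; first by rewrite -rVBE le_coord.
by rewrite subrr normr0.
Qed.

Lemma C1_lipschitz (f : V -> R) (g : 'I_n -> V -> R) (e : R) :
  (forall i z, is_derive z (edir R i) f (g i z)) -> (forall i z, `|g i z| <= e) ->
  forall x y, `|f x - f y| <= n%:R * (e * `|x - y|).
Proof.
move=> df H x y; have := @C1_expansion f g y x (fun=> 0) e df.
rewrite big1 ?subr0 => [|i _]; last by rewrite mul0r.
by apply => z _ i; rewrite subr0.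
Qed.

End SpaceCalculus.

(** * Hoelder estimates, with one constant for the sup norm and the seminorm *)

Section Holder.
Variables (R : realType) (n : nat) (g : R).
Hypotheses (g0 : 0 <= g) (g1 : g < 1).
Local Notation V := 'rV[R]_n.
Local Notation pw h := (h `^ g).

Lemma pw_le (a b : R) : 0 <= a -> a <= b -> pw a <= pw b.
Proof. by move=> a0 ab; apply: ge0_ler_powR; rewrite ?nnegrE // (le_trans a0). Qed.

Lemma pw_le1 (a : R) : 0 <= a -> a <= 1 -> pw a <= 1.
Proof. by move=> a0 a1; have := pw_le a0 a1; rewrite powR1. Qed.

Lemma pw_ge1 (a : R) : 1 <= a -> 1 <= pw a.
Proof. by move=> a1; have := pw_le ler01 a1; rewrite powR1. Qed.

Lemma le_pw (a : R) : 0 <= a -> a <= 1 -> a <= pw a.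
Proof.
move=> a0 a1; have [->|an] := eqVneq a 0; first exact: powR_ge0.
by apply: ger1_powR; [rewrite lt_neqAle eq_sym an a0|exact: ltW].
Qed.

Lemma pwM_le (L a : R) : 1 <= L -> 0 <= a -> pw (L * a) <= L * pw a.
Proof.
move=> L1 a0; have L0 := le_trans ler01 L1; rewrite powRM //.
by rewrite ler_wpM2r ?powR_ge0 //; apply: ler1_powR => //; exact: ltW.
Qed.

(** Write [K h = (K h^(1 - g)) h^g]; as [g < 1], the first factor tends to [0] with [h]. *)
Lemma pw_small (e K : R) : 0 < e -> 0 <= K -> exists2 r : R, 0 < r <= 1 &
  forall h, 0 <= h -> h <= r -> K * h <= e * pw h.
Proof.
move=> e0 K0; have q0 : 0 < 1 - g by rewrite subr_gt0.
pose a := e / (K + 1); have a0 : 0 < a by rewrite divr_gt0 //; lra.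
exists (Num.min 1 (a `^ (1 - g)^-1)) => [|h h0 hr].
  by rewrite lt_min ltr01 powR_gt0 //= ge_min lexx.
have [->|hn] := eqVneq h 0; first by rewrite mulr0 mulr_ge0 ?powR_ge0 // ltW.
have hp : 0 < h by rewrite lt_neqAle eq_sym hn.
have E : h = h `^ (1 - g) * pw h by rewrite -powRD ?subrK ?powRr1 // hn implybT.
rewrite {1}E mulrA ler_wpM2r ?powR_ge0 //.
have h1 : h `^ (1 - g) <= a.
  rewrite [leRHS](_ : a = (a `^ (1 - g)^-1) `^ (1 - g)); last by rewrite -powRrM mulVf ?lt0r_neq0 // powRr1 // ltW.
  apply: ge0_ler_powR; rewrite ?nnegrE ?powR_ge0 // ?(ltW q0) //.
  by move: hr; rewrite le_min => /andP[].
apply: (le_trans (ler_wpM2l K0 h1)); rewrite /a mulrCA ler_piMr ?(ltW e0) //.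
rewrite ler_pdivrMr; lra.
Qed.

Definition holder_le (e : R) (F : V -> R) :=
  (forall x, `|F x| <= e) /\ forall x y, `|F x - F y| <= e * pw `|x - y|.

Lemma holder_le_ge0 e F : holder_le e F -> 0 <= e.
Proof. by case=> /(_ 0) h _; apply: le_trans h. Qed.

Lemma holder_leW e e' F : e <= e' -> holder_le e F -> holder_le e' F.
Proof.
move=> ee [h h']; split=> [x|x y]; first exact: le_trans (h x) ee.
by apply: (le_trans (h' x y)); rewrite ler_wpM2r ?powR_ge0.
Qed.

Lemma holder_le_ext e F G : F =1 G -> holder_le e F -> holder_le e G.
Proof. by move=> /funext ->. Qed.

Lemma holder_le_cst c : holder_le `|c| (fun=> c).
Proof. by split=> // x y; rewrite subrr normr0 mulr_ge0 ?powR_ge0. Qed.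

Lemma holder_leD a b F G : holder_le a F -> holder_le b G -> holder_le (a + b) (fun x => F x + G x).
Proof.
move=> [h h'] [k k']; split=> [x|x y].
  by apply: (le_trans (ler_normD _ _)); apply: lerD.
rewrite (_ : _ - _ = (F x - F y) + (G x - G y)); last by ring.
by rewrite mulrDl; apply: (le_trans (ler_normD _ _)); apply: lerD.
Qed.

Lemma holder_leN a F : holder_le a F -> holder_le a (fun x => - F x).
Proof.
by move=> [h h']; split=> [x|x y]; rewrite ?normrN // -opprD normrN.
Qed.

Lemma holder_leM a b F G : holder_le a F -> holder_le b G -> holder_le (2 * (a * b)) (fun x => F x * G x).
Proof.
move=> hF hG; have a0 := holder_le_ge0 hF; have b0 := holder_le_ge0 hG.
have ab0 : 0 <= a * b by rewrite mulr_ge0.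
case: hF hG => [h h'] [k k']; split=> [x|x y].
  have : `|F x * G x| <= a * b by rewrite normrM ler_pM.
  lra.
rewrite (_ : _ - _ = (F x - F y) * G x + F y * (G x - G y)); last by ring.
apply: (le_trans (ler_normD _ _)); rewrite !normrM.
have h1 : `|F x - F y| * `|G x| <= a * pw `|x - y| * b by apply: ler_pM.
have h2 : `|F y| * `|G x - G y| <= a * (b * pw `|x - y|) by apply: ler_pM.
lra.
Qed.

Lemma holder_leZ a c F : holder_le a F -> holder_le (`|c| * a) (fun x => c * F x).
Proof.
move=> [h h']; split=> [x|x y]; first by rewrite normrM ler_wpM2l.
by rewrite -mulrBr normrM -mulrA ler_wpM2l.
Qed.

Lemma holder_le_shift a c F : holder_le a F -> holder_le a (fun x => F (x + c)).
Proof.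
move=> [h h']; split=> [x|x y]; first exact: h.
by have := h' (x + c) (y + c); rewrite opprD addrACA subrr addr0.
Qed.

Lemma holder_le_sum a (F : 'I_n -> V -> R) : (forall i, holder_le a (F i)) ->
  holder_le (n%:R * a) (fun x => \sum_i F i x).
Proof.
move=> H; split=> [x|x y].
  by apply: norm_sum_ord => i; case: (H i).
by rewrite -sumrB -mulrA; apply: norm_sum_ord => i; case: (H i).
Qed.

Lemma holder_le_comp a L F (P : V -> V) : 1 <= L -> (forall x y, `|P x - P y| <= L * `|x - y|) ->
  holder_le a F -> holder_le (a * L) (fun x => F (P x)).
Proof.
move=> L1 lP hF; have a0 := holder_le_ge0 hF; case: hF => [h h']; split=> [x|x y].
  by apply: (le_trans (h _)); rewrite ler_peMr.
apply: (le_trans (h' _ _)); rewrite -mulrA ler_wpM2l //.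
by apply: le_trans (pwM_le L1 _) => //; apply: pw_le.
Qed.

(** At distances up to [1] the Lipschitz bound applies, as [h <= h^g], and contributes [n]; at
    larger distances the sup bound contributes [2]. *)
Lemma holder_le_of_lip e F : (forall x, `|F x| <= e) ->
  (forall x y, `|F x - F y| <= n%:R * (e * `|x - y|)) -> holder_le ((n%:R + 2) * e) F.
Proof.
move=> h h'; have e0 : 0 <= e by apply: le_trans (h 0).
have n0 : 0 <= n%:R :> R by [].
split=> [x|x y]; first by apply: (le_trans (h x)); rewrite ler_peMl //; lra.
have [xy|/ltW xy] := leP `|x - y| 1.
  apply: (le_trans (h' x y)); have := le_pw (normr_ge0 (x - y)) xy.
  set u := pw _; set v := `|_| => vu; have u0 : 0 <= u by exact: powR_ge0.
  have : e * v <= e * u by rewrite ler_wpM2l.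
  have : 0 <= e * u by rewrite mulr_ge0.
  nra.
have h1 := pw_ge1 xy; have := ler_normB (F x) (F y); have := h x; have := h y.
have : e <= e * pw `|x - y| by rewrite ler_peMr.
have : 0 <= n%:R * e * pw `|x - y| by rewrite !mulr_ge0 ?powR_ge0.
lra.
Qed.

(** Required for every [e] with a suitable [r], this is the little Hoelder condition; for [g = 0] it
    is uniform continuity. *)
Definition holder_small (r e : R) (F : V -> R) :=
  forall x y, `|x - y| <= r -> `|F x - F y| <= e * pw `|x - y|.

(** Two regimes. At distances up to [r / L] both compositions separately have small Hoelder
    quotients, whether or not [P] and [Q] are close. Beyond [r / L] the quotient is controlled by
    the sup norm of the difference, for which the factor [pw (r / L)] was reserved. *)
Lemma holder_le_near_comp (F : V -> R) (P Q : V -> V) (L e r : R) : 1 <= L -> 0 <= e -> 0 < r <= 1 ->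
  (forall x y, `|P x - P y| <= L * `|x - y|) ->
  (forall x y, `|Q x - Q y| <= L * `|x - y|) ->
  holder_small r e F -> (forall x, `|F (P x) - F (Q x)| <= e * pw (r / L)) ->
  holder_le (2 * L * e) (fun x => F (P x) - F (Q x)).
Proof.
move=> L1 e0 /andP[r0 r1] lP lQ sF sup.
have L0 : 0 < L by lra.
have rL0 : 0 <= r / L by rewrite divr_ge0 // ltW.
have rL1 : r / L <= 1 by rewrite ler_pdivrMr //; lra.
have Le : e <= L * e by rewrite ler_peMl.
split=> [x|x y].
  have : e * pw (r / L) <= e by rewrite ler_piMr // pw_le1.
  by have := sup x; lra.
have [xy|/ltW xy] := leP `|x - y| (r / L).
  have xyr : L * `|x - y| <= r by rewrite mulrC -ler_pdivlMr.
  have pL : e * pw (L * `|x - y|) <= e * (L * pw `|x - y|) by rewrite ler_wpM2l // pwM_le.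
  have h1 : `|F (P x) - F (P y)| <= e * pw (L * `|x - y|).
    apply: (le_trans (sF _ _ (le_trans (lP x y) xyr))).
    by rewrite ler_wpM2l // pw_le.
  have h2 : `|F (Q x) - F (Q y)| <= e * pw (L * `|x - y|).
    apply: (le_trans (sF _ _ (le_trans (lQ x y) xyr))).
    by rewrite ler_wpM2l // pw_le.
  rewrite (_ : _ - _ = (F (P x) - F (P y)) - (F (Q x) - F (Q y))); last by ring.
  apply: (le_trans (ler_normB _ _)); lra.
have h3 : e * pw (r / L) <= e * pw `|x - y| by rewrite ler_wpM2l // pw_le.
have h4 : e * pw `|x - y| <= L * (e * pw `|x - y|) by rewrite ler_peMl // mulr_ge0 ?powR_ge0.
have := sup x; have := sup y.
have := ler_normB (F (P x) - F (Q x)) (F (P y) - F (Q y)); lra.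
Qed.

End Holder.

Section DeriveMore.
Variables (R : realType) (n : nat).
Local Notation V := 'rV[R]_n.

Lemma is_derive_shift_arg (f : V -> R) (x c v : V) (l : R) :
  is_derive (x + c) v f l -> is_derive x v (fun y => f (y + c)) l.
Proof.
move=> /is_derive_epsP H; apply/is_derive_epsP => e e0; have [d d0 Hd] := H e e0.
by exists d => // h hd; rewrite [x + _ + c]addrAC; exact: Hd.
Qed.

Lemma is_derive_coord (i j : 'I_n) (x : V) :
  is_derive x (edir R j) (fun y : V => y 0 i) (i == j)%:R.
Proof.
apply/is_derive_epsP => e e0; exists 1 => // h _.
by rewrite !mxE eqxx /= [x 0 i + _]addrC addrK subrr normr0 mulr_ge0 // ltW.
Qed.

(** The outer function is expanded at [P x] by [C1_expansion], with error
    [o(|P (x + h v) - P x|) = o(h)] because [P] grows at most linearly along [v]; the inner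
    increments are then replaced by their linear parts. Each half of [e] pays for one of these
    errors. *)
Lemma chain_rule (f : V -> R) (df : 'I_n -> V -> R) (P : V -> V) (x v dP : V) (L : R) :
  (forall i z, is_derive z (edir R i) f (df i z)) ->
  (forall e : R, 0 < e -> exists2 r : R, 0 < r &
     forall z, `|z - P x| <= r -> forall i, `|df i z - df i (P x)| <= e) ->
  0 <= L -> (forall h : R, `|P (x + h *: v) - P x| <= L * `|h|) ->
  (forall i, is_derive x v (fun y => P y 0 i) (dP 0 i)) ->
  is_derive x v (fun y => f (P y)) (\sum_i df i (P x) * dP 0 i).
Proof.
move=> Df cdf L0 lP DP; apply/is_derive_epsP => e e0.
pose N := n%:R * L + 1; have N0 : 0 < N.
  by have := mulr_ge0 (ler0n R n) L0; rewrite /N; lra.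
pose q := \sum_i `|df i (P x)|; pose S := q + 1; have S0 : 0 < S by rewrite ltr_wpDl // sumr_ge0.
have e1 : 0 < e / 2 / N by rewrite !divr_gt0.
have e2 : 0 < e / 2 / S by rewrite !divr_gt0.
have [r r0 Hr] := cdf _ e1.
have [d1 d10 H1] : exists2 d : R, 0 < d & forall i (h : R), `|h| < d ->
    `|P (x + h *: v) 0 i - P x 0 i - h * dP 0 i| <= e / 2 / S * `|h|.
  apply: fin_unif_ge => [i a b ab H h ha|i]; first by apply: H; exact: lt_le_trans ab.
  by have /is_derive_epsP/(_ _ e2) := DP i.
exists (Num.min d1 (r / (L + 1))) => [|h].
  by rewrite lt_min d10 divr_gt0 //; lra.
rewrite lt_min => /andP[hd1 hr].
have Lh : `|P (x + h *: v) - P x| <= r.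
  apply: (le_trans (lP h)); move: hr; rewrite ltr_pdivlMr; last by lra.
  have := normr_ge0 h; nra.
have := C1_expansion Df (fun z hz => Hr z (le_trans hz Lh)).
set D := _ - _ - \sum_i _ => hD.
have -> : f (P (x + h *: v)) - f (P x) - h * (\sum_i df i (P x) * dP 0 i) =
   D + \sum_i df i (P x) * (P (x + h *: v) 0 i - P x 0 i - h * dP 0 i).
  rewrite /D -[RHS]addrA; congr (_ + _).
  by rewrite mulr_sumr -!sumrN -big_split; apply: eq_bigr => i _ /=; ring.
apply: (le_trans (ler_normD _ _)).
have h1 : `|D| <= e / 2 * `|h|.
  apply: (le_trans hD); apply: (@le_trans _ _ (n%:R * (e / 2 / N * (L * `|h|)))).
    by rewrite ler_wpM2l // ler_wpM2l // ltW.
  rewrite (_ : _ * _ = (n%:R * L) / N * (e / 2 * `|h|)); last by ring.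
  rewrite ler_piMl //; first by rewrite mulr_ge0 // ltW // divr_gt0.
  by rewrite ler_pdivrMr // mul1r lerDl.
have h2 : `|\sum_i df i (P x) * (P (x + h *: v) 0 i - P x 0 i - h * dP 0 i)| <= e / 2 * `|h|.
  apply: (le_trans (ler_norm_sum _ _ _)).
  apply: (@le_trans _ _ (\sum_i `|df i (P x)| * (e / 2 / S * `|h|))).
    by apply: ler_sum => i _; rewrite normrM ler_wpM2l //; exact: H1.
  rewrite -mulr_suml -/q.
  rewrite (_ : q * _ = (e / 2 * `|h|) * (q / S)); last by ring.
  rewrite ler_piMr //; first by rewrite mulr_ge0 // ltW // divr_gt0.
  by rewrite ler_pdivrMr // mul1r lerDl.
lra.
Qed.

End DeriveMore.

(** * Curves of almost periodic functions *)

Section Labels.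
Variables (R : realType) (n : nat) (T : R).
Local Notation V := 'rV[R]_n.
Local Notation I := (inI T).
Implicit Types Q : R -> V -> R -> V -> Prop.

(* Uniform continuity in time together with total boundedness of the translates: [Q] holds for
   nearby times and for translation vectors with the same label, the labels being finitely many.
   Labels, unlike nets, are combined by products. *)
Definition near_labels Q := exists (d : R) (K : finType) (L : V -> K),
  0 < d /\ forall s t c c', I s -> I t -> `|s - t| < d -> L c = L c' -> Q s c t c'.

Lemma near_labels_imp Q Q' : (forall s c t c', I s -> I t -> Q s c t c' -> Q' s c t c') ->
  near_labels Q -> near_labels Q'.
Proof.
move=> H [d [K [L [d0 Hd]]]]; exists d, K, L; split=> // s t c c' Is It st Lc.
by apply: H => //; exact: Hd.
Qed.

Lemma near_labels_and Q Q' : near_labels Q -> near_labels Q' ->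
  near_labels (fun s c t c' => Q s c t c' /\ Q' s c t c').
Proof.
move=> [d [K [L [d0 Hd]]]] [d' [K' [L' [d0' Hd']]]].
exists (Num.min d d'), (K * K')%type, (fun c => (L c, L' c)); split.
  by rewrite lt_min d0.
move=> s t c c' Is It; rewrite lt_min => /andP[sd sd'] [Lc Lc'].
by split; [exact: Hd|exact: Hd'].
Qed.

Lemma near_labels_fin (J : finType) (Q : J -> R -> V -> R -> V -> Prop) :
  (forall j, near_labels (Q j)) -> near_labels (fun s c t c' => forall j, Q j s c t c').
Proof.
move=> H; suff : near_labels (fun s c t c' => forall j, j \in enum J -> Q j s c t c').
  by apply: near_labels_imp => s c t c' _ _ h j; apply: h; rewrite mem_enum.
elim: (enum J) => [|j r IH]; first by exists 1, unit, (fun=> tt).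
apply: near_labels_imp (near_labels_and (H j) IH) => s c t c' _ _ [h1 h2] k.
by rewrite inE => /predU1P[->|/h2].
Qed.

End Labels.

Section Curves.
Variables (R : realType) (n : nat) (g T : R).
Hypotheses (g0 : 0 <= g) (g1 : g < 1).
Local Notation V := 'rV[R]_n.
Local Notation I := (inI T).
Local Notation pw h := (h `^ g).
Local Notation holder_le := (@holder_le R n g).
Local Notation holder_small := (@holder_small R n g).
Local Notation np := (@near_labels R n T).
Implicit Types f h : R -> V -> R.

Definition holder_close (e : R) f s (c : V) t (c' : V) := holder_le e (fun x => f s (x + c) - f t (x + c')).

(* [f] is a continuous curve in the space of bounded [g]-Hoelder functions with precompact
   translates. For continuous [f t] the last clause follows from the others (see [small_scale]). *)
Definition apc f := [/\ exists2 M : R, 0 <= M & forall t, I t -> holder_le M (f t),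
  forall e : R, 0 < e -> np (holder_close e f) &
  forall e : R, 0 < e -> exists2 r : R, 0 < r <= 1 & forall t, I t -> holder_small r e (f t)].

Lemma holder_small_le r r' e e' F : r' <= r -> e <= e' -> holder_small r e F -> holder_small r' e' F.
Proof.
move=> rr ee H x y xy; apply: (le_trans (H x y (le_trans xy rr))).
by rewrite ler_wpM2r ?powR_ge0.
Qed.

Lemma apc_ext f h : (forall t x, I t -> f t x = h t x) -> apc f -> apc h.
Proof.
move=> E; have {}E t : I t -> f t = h t by move=> It; apply/funext => x; exact: E.
move=> [[M M0 HM] H2 H3]; split.
- by exists M => // t It; rewrite -E //; exact: HM.
- move=> e /H2; apply: near_labels_imp => s c t c' Is It; rewrite /holder_close.
  by rewrite !E.
- by move=> e /H3[r r0 Hr]; exists r => // t It; rewrite -E //; exact: Hr.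
Qed.

Lemma apc_cst k : apc (fun _ _ => k).
Proof.
split.
- by exists `|k| => // t _; exact: holder_le_cst.
- move=> e e0; exists 1, unit, (fun=> tt); split=> // s t c c' _ _ _ _.
  apply: (holder_leW (ltW e0)); apply: (holder_le_ext (fun x => esym (subrr k))).
  by have := holder_le_cst n g (0 : R); rewrite normr0.
- move=> e e0; exists 1; rewrite ?ltr01 ?lexx // => t _ x y _.
  by rewrite subrr normr0 mulr_ge0 ?powR_ge0 // ltW.
Qed.

Lemma apcD f h : apc f -> apc h -> apc (fun t x => f t x + h t x).
Proof.
move=> [[M M0 HM] H2 H3] [[N N0 HN] K2 K3]; split.
- exists (M + N); rewrite ?addr_ge0 // => t It; exact: holder_leD (HM t It) (HN t It).
- move=> e e0; have e2 : 0 < e / 2 by rewrite divr_gt0.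
  apply: near_labels_imp (near_labels_and (H2 _ e2) (K2 _ e2)) => s c t c' _ _ [a b].
  apply: (@holder_leW _ _ _ (e / 2 + e / 2)); first by lra.
  by apply: holder_le_ext (holder_leD a b) => x /=; ring.
- move=> e e0; have e2 : 0 < e / 2 by rewrite divr_gt0.
  have [r /andP[r0 r1] Hr] := H3 _ e2; have [r' /andP[r0' r1'] Hr'] := K3 _ e2.
  exists (Num.min r r'); first by rewrite lt_min r0 r0' ge_min r1.
  move=> t It x y; rewrite le_min => /andP[a b].
  have := Hr t It x y a; have := Hr' t It x y b.
  rewrite (_ : f t x + h t x - (f t y + h t y) = (f t x - f t y) + (h t x - h t y)); last by ring.
  move=> u v; apply: (le_trans (ler_normD _ _)); lra.
Qed.

Lemma apcM f h : apc f -> apc h -> apc (fun t x => f t x * h t x).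
Proof.
move=> [[M M0 HM] H2 H3] [[N N0 HN] K2 K3].
have small (e : R) : 0 < e -> exists2 e', 0 < e' & 2 * (M + N) * e' <= e.
  move=> e0; exists (e / (2 * (M + N) + 1)); first by rewrite divr_gt0 //; lra.
  rewrite mulrCA ler_piMr ?(ltW e0) // ler_pdivrMr; lra.
split.
- exists (2 * (M * N)); rewrite ?mulr_ge0 // => t It; exact: holder_leM (HM t It) (HN t It).
- move=> e /small[e' e0' He'].
  apply: near_labels_imp (near_labels_and (H2 _ e0') (K2 _ e0')) => s c t c' Is It [a b].
  apply: (@holder_leW _ _ _ (2 * (e' * N) + 2 * (M * e'))); first by lra.
  have u := holder_leM a (holder_le_shift c (HN s Is)); have v := holder_leM (holder_le_shift c' (HM t It)) b.
  by apply: holder_le_ext (holder_leD u v) => x /=; ring.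
- move=> e /small[e' e0' He'].
  have [r /andP[r0 r1] Hr] := H3 _ e0'; have [r' /andP[r0' r1'] Hr'] := K3 _ e0'.
  exists (Num.min r r'); first by rewrite lt_min r0 r0' ge_min r1.
  move=> t It x y; rewrite le_min => /andP[a b].
  have u := Hr t It x y a; have v := Hr' t It x y b.
  have [mf _] := HM t It; have [nh _] := HN t It.
  rewrite (_ : f t x * h t x - f t y * h t y = (f t x - f t y) * h t x + f t y * (h t x - h t y)); last by ring.
  apply: (le_trans (ler_normD _ _)); rewrite !normrM.
  have p0 : 0 <= pw `|x - y| by exact: powR_ge0.
  have h1 : `|f t x - f t y| * `|h t x| <= e' * pw `|x - y| * N by apply: ler_pM.
  have h2 : `|f t y| * `|h t x - h t y| <= M * (e' * pw `|x - y|) by apply: ler_pM.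
  have h3 : 2 * (M + N) * e' * pw `|x - y| <= e * pw `|x - y| by rewrite ler_wpM2r.
  have : 0 <= (M + N) * (e' * pw `|x - y|) by rewrite mulr_ge0 ?addr_ge0 ?mulr_ge0 // ltW.
  lra.
Qed.

(** The bound [r <= 1] in [apc] gives [|x - y|^g <= 1], so the small-scale clause yields a modulus
    of continuity common to all times. *)
Lemma apc_uniformly_continuous (J : finType) (F : J -> R -> V -> R) : (forall j, apc (F j)) ->
  forall e : R, 0 < e -> exists2 r : R, 0 < r &
    forall j t x y, I t -> `|x - y| <= r -> `|F j t x - F j t y| <= e.
Proof.
move=> H e e0; apply: fin_unif_ge => [j a b ab K t x y It xy|j].
  by apply: K => //; apply: le_trans ab.
have [_ _ /(_ e e0)[r /andP[r0 r1] Hr]] := H j; exists r => // t x y It xy.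
apply: (le_trans (Hr t It x y xy)); rewrite ler_piMr ?(ltW e0) // pw_le1 //.
exact: le_trans r1.
Qed.

Lemma apc_uniform_bound (J : finType) (F : J -> R -> V -> R) : (forall j, apc (F j)) ->
  exists2 M, 0 <= M & forall j t, I t -> holder_le M (F j t).
Proof.
move=> H; apply: fin_unif_le => [j a b ab K t It|j].
  by apply: holder_leW ab _; exact: K.
by have [[M M0 HM] _ _] := H j; exists M.
Qed.

Lemma apc_contI f x : apc f -> contI T (fun t => f t x).
Proof.
move=> [_ H _]; apply/contIP => t It e e0.
have [d [K [L [d0 Hd]]]] := H e e0; exists d => // s Is st.
by have [+ _] := Hd s t 0 0 Is It st erefl => /(_ x); rewrite !addr0.
Qed.

Section Composition.
Variables (P : R -> V -> V) (L : R).
Hypotheses (L1 : 1 <= L)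
  (lipP : forall t x y, I t -> `|P t x - P t y| <= L * `|x - y|)
  (closeP : forall e : R, 0 < e ->
     np (fun s c t c' => forall x, `|(P s (x + c) - c) - (P t (x + c') - c')| <= e)).

(* With [p, q] standing for (time, translation) pairs,
   [f_p o P_p - f_q o P_q = (f_p - f_q) o P_p + (f_q o P_p - f_q o P_q)], and the second term is
   Hoelder small by the small-scale property of [f_q] and closeness of [P_p] and [P_q]. *)
Lemma apc_comp f : apc f -> apc (fun t x => f t (P t x)).
Proof.
move=> [[M M0 HM] H2 H3]; have L0 : 0 < L by exact: lt_le_trans L1.
split.
- exists (M * L); first by rewrite mulr_ge0 // ltW.
  by move=> t It; apply: (holder_le_comp g0 g1 L1 _ (HM t It)) => x y; exact: lipP.
- move=> e e0; pose e1 := e / (3 * L); have e10 : 0 < e1 by rewrite divr_gt0 //; lra.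
  have [r /andP[r0 r1] Hr] := H3 _ e10.
  have p0 : 0 < pw (r / L) by rewrite powR_gt0 // divr_gt0.
  have e30 : 0 < e1 * pw (r / L) by rewrite mulr_gt0.
  (* The small-scale clause is used a second time: [r'] is how close the two maps must be for the
     values of [f t] to differ by at most [e1 * pw (r / L)], as the large-distance regime
     demands. *)
  have [r' /andP[r0' r1'] Hr'] := H3 _ e30.
  apply: near_labels_imp (near_labels_and (H2 _ e10) (closeP r0')) => s c t c' Is It [a b].
  have lp u d x y : I u -> `|P u (x + d) - d - (P u (y + d) - d)| <= L * `|x - y|.
    move=> Iu; rewrite opprB addrA addrNK; apply: (le_trans (lipP _ _ Iu)).
    by rewrite opprD addrACA subrr addr0.
  have u := holder_le_comp g0 g1 L1 (fun x y => lp s c x y Is) a.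
  have v : holder_le (2 * L * e1) (fun x => f t (P s (x + c) - c + c') - f t (P t (x + c') - c' + c')).
    apply: (@holder_le_near_comp _ _ _ g0 g1 (fun y => f t (y + c'))
      (fun x => P s (x + c) - c) (fun x => P t (x + c') - c') L e1 r) => //.
    + exact: ltW.
    + by rewrite r0.
    + by move=> x y; exact: lp.
    + by move=> x y; exact: lp.
    + move=> x y xy; have := Hr t It (x + c') (y + c').
      by rewrite opprD addrACA subrr addr0; exact.
    + move=> x; have hb' := b x.
      have := Hr' t It (P s (x + c) - c + c') (P t (x + c') - c' + c').
      rewrite opprD [_ + (_ + - c')]addrACA subrr addr0 => /(_ hb') h.
      apply: (le_trans h); rewrite ler_piMr ?(ltW e30) // pw_le1 //.
      exact: le_trans r1'.
  apply: (@holder_leW _ _ _ (e1 * L + 2 * L * e1)).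
    by rewrite (_ : _ + _ = e) // /e1; field; rewrite lt0r_neq0.
  by apply: holder_le_ext (holder_leD u v) => x /=; rewrite !subrK; ring.
- move=> e e0; have e1 : 0 < e / L by rewrite divr_gt0.
  have [r /andP[r0 r1] Hr] := H3 _ e1.
  exists (r / L) => [|t It x y xy].
    by rewrite divr_gt0 // ler_pdivrMr // mul1r (le_trans r1).
  have h := lipP x y It.
  have h2 : L * `|x - y| <= r by rewrite mulrC -ler_pdivlMr.
  apply: (le_trans (Hr t It _ _ (le_trans h h2))).
  apply: (@le_trans _ _ (e / L * (L * pw `|x - y|))); last by rewrite mulrA divfK // lt0r_neq0.
  rewrite ler_wpM2l ?(ltW e1) //; apply: (@le_trans _ _ (pw (L * `|x - y|))).
    exact: pw_le.
  exact: pwM_le.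
Qed.

End Composition.

(** Sup-norm information on [f] becomes Hoelder information through the derivatives: a difference of
    translates is small and has small partial derivatives, hence a small Lipschitz constant. The
    small-scale clause is [pw_small] for a Lipschitz function. *)
Lemma apc_of_C1 f (df : 'I_n -> R -> V -> R) (M : R) :
  (forall t x, I t -> `|f t x| <= M) ->
  (forall e : R, 0 < e -> np (fun s c t c' => forall x, `|f s (x + c) - f t (x + c')| <= e)) ->
  (forall i, apc (df i)) ->
  (forall i t x, I t -> is_derive x (edir R i) (f t) (df i t x)) ->
  apc f.
Proof.
move=> fM fnp Adf Df; have n0 : 0 <= n%:R :> R by [].
have [N N0 HN] := apc_uniform_bound Adf.
have lipf t x y : I t -> `|f t x - f t y| <= n%:R * (N * `|x - y|).
  move=> It; apply: (@C1_lipschitz _ _ (f t) (fun i => df i t) N) => [i z|i z].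
    exact: Df.
  by have [+ _] := HN i t It; apply.
split.
- exists ((n%:R + 2) * (`|M| + N)); first by rewrite mulr_ge0 ?addr_ge0.
  move=> t It; apply: holder_le_of_lip => // [x|x y].
    by apply: (le_trans (fM t x It)); apply: (le_trans (ler_norm _)); rewrite lerDl.
  apply: (le_trans (lipf t x y It)); rewrite ler_wpM2l // ler_wpM2r // lerDr //.
- move=> e e0; pose e1 := e / (n%:R + 2); have e10 : 0 < e1 by rewrite divr_gt0 //; lra.
  have a : np (fun s c t c' => forall i, holder_close e1 (df i) s c t c').
    by apply: near_labels_fin => i; have [_ h _] := Adf i; exact: h.
  apply: near_labels_imp (near_labels_and (fnp _ e10) a) => s c t c' Is It [u v].
  apply: (@holder_leW _ _ _ ((n%:R + 2) * e1)).
    by rewrite mulrC divfK // lt0r_neq0 //; lra.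
  apply: holder_le_of_lip => //.
  apply: (@C1_lipschitz _ _ _ (fun i x => df i s (x + c) - df i t (x + c'))) => [i z|i z].
    by apply: is_deriveB; apply: is_derive_shift_arg; exact: Df.
  by have [+ _] := v i; apply.
- move=> e e0; have nN : 0 <= n%:R * N by rewrite mulr_ge0.
  have [r r01 Hr] := pw_small g1 e0 nN; exists r => // t It x y xy.
  by apply: (le_trans (lipf t x y It)); rewrite mulrA; exact: Hr.
Qed.

(** This is C([0,T], C^(k + g)_ap). The derivatives are existential, so that closure properties can
    supply formulas for them; [apCk_derive] returns to ['D]. *)
Fixpoint apCk k f : Prop := apc f /\
  if k is k'.+1 then forall i, exists2 h, apCk k' h &
    forall t x, I t -> is_derive x (edir R i) (f t) (h t x)
  else True.

Lemma apCk_apc k f : apCk k f -> apc f.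
Proof. by case: k => [|k] []. Qed.

Lemma apCk_pred k f : apCk k.+1 f -> apCk k f.
Proof.
elim: k f => [|k IH] f [Af H]; first by split.
by split=> // i; have [h /IH Ch Dh] := H i; exists h.
Qed.

Lemma apCk_ext k f h : (forall t x, I t -> f t x = h t x) -> apCk k f -> apCk k h.
Proof.
move=> E; have E' t : I t -> f t = h t by move=> It; apply/funext => x; exact: E.
case: k => [|k] [Af H]; split=> //; try exact: apc_ext Af.
by move=> i; have [q Cq Dq] := H i; exists q => // t x It; rewrite -E' //; exact: Dq.
Qed.

Lemma apCk_derive k f i : apCk k.+1 f ->
  apCk k (fun t x => 'D_(edir R i) (f t) x) /\
  forall t x, I t -> is_derive x (edir R i) (f t) ('D_(edir R i) (f t) x).
Proof.
move=> [_ /(_ i)[h Ch Dh]].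
have E t x : I t -> h t x = 'D_(edir R i) (f t) x by move=> It; have [_ ->] := Dh t x It.
split; first exact: apCk_ext Ch.
by move=> t x It; rewrite -E //; exact: Dh.
Qed.

Lemma apCk_cst k c : apCk k (fun _ _ => c).
Proof.
elim: k c => [|k IH] c; split=> //; try exact: apc_cst.
by move=> i; exists (fun _ _ => 0) => // t x _; exact: is_derive_cst.
Qed.

Lemma apCkD k f h : apCk k f -> apCk k h -> apCk k (fun t x => f t x + h t x).
Proof.
elim: k f h => [|k IH] f h [Af Hf] [Ah Hh]; split=> //; try exact: apcD.
move=> i; have [df Cf Df] := Hf i; have [dh Ch Dh] := Hh i.
exists (fun t x => df t x + dh t x); first exact: IH.
by move=> t x It; apply: is_deriveD; [exact: Df|exact: Dh].
Qed.

Lemma apCkM k f h : apCk k f -> apCk k h -> apCk k (fun t x => f t x * h t x).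
Proof.
elim: k f h => [|k IH] f h Cf Ch; split=> //; try exact: apcM (apCk_apc Cf) (apCk_apc Ch).
move=> i; have [_ /(_ i)[df Cdf Df]] := Cf; have [_ /(_ i)[dh Cdh Dh]] := Ch.
exists (fun t x => f t x * dh t x + h t x * df t x).
  by apply: apCkD; apply: IH => //; exact: apCk_pred.
by move=> t x It; apply: is_deriveM; [exact: Df|exact: Dh].
Qed.

Lemma apCk_sum k (J : Type) (r : seq J) (F : J -> R -> V -> R) : (forall j, apCk k (F j)) ->
  apCk k (fun t x => \sum_(j <- r) F j t x).
Proof.
move=> H; elim: r => [|j r IH].
  by apply: apCk_ext (apCk_cst k 0) => t x _; rewrite big_nil.
by apply: apCk_ext (apCkD (H j) IH) => t x _; rewrite big_cons.
Qed.

Section CompositionCk.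
Variables (P : R -> V -> V) (L : R).
Hypotheses (L1 : 1 <= L)
  (lipP : forall t x y, I t -> `|P t x - P t y| <= L * `|x - y|)
  (closeP : forall e : R, 0 < e ->
     np (fun s c t c' => forall x, `|(P s (x + c) - c) - (P t (x + c') - c')| <= e)).

Lemma derive_comp f (df : 'I_n -> R -> V -> R) (t : R) (x v dP : V) :
  I t -> (forall i, apc (df i)) ->
  (forall i t x, I t -> is_derive x (edir R i) (f t) (df i t x)) ->
  (forall i, is_derive x v (fun y => P t y 0 i) (dP 0 i)) ->
  is_derive x v (fun y => f t (P t y)) (\sum_i df i t (P t x) * dP 0 i).
Proof.
move=> It Adf Df DP.
apply: (@chain_rule _ _ (f t) (fun i => df i t) (P t) x v dP (L * `|v|)) => //.
- by move=> i z; exact: Df.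
- move=> e e0; have [r r0 Hr] := apc_uniformly_continuous Adf e0.
  by exists r => // z zr i; exact: Hr.
- by rewrite mulr_ge0 //; exact: le_trans L1.
- move=> h; apply: (le_trans (lipP _ _ It)); rewrite addrAC subrr add0r normrZ.
  by rewrite [`|h| * _]mulrC mulrA.
Qed.

(** Induction through the chain rule: the derivatives are sums of products of [df o P], treated by
    induction, and of the derivatives of [P]. The hypothesis concerns [P - id], because [P] is
    unbounded, and is void for [k = 0], where the Lipschitz bound and closeness suffice. *)
Lemma apCk_comp k f : apCk k f ->
  (forall i, (0 < k)%N -> apCk k (fun t x => P t x 0 i - x 0 i)) ->
  apCk k (fun t x => f t (P t x)).
Proof.
elim: k f => [|k IH] f Cf CP; (split; first exact: (apc_comp L1 lipP closeP (apCk_apc Cf))) => // l.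
pose df i t x := 'D_(edir R i) (f t) x.
have Cdf i : apCk k (df i) by have [] := apCk_derive i Cf.
have Df i t x : I t -> is_derive x (edir R i) (f t) (df i t x).
  by have [_] := apCk_derive i Cf; apply.
have CPk i : apCk k.+1 (fun t x => P t x 0 i - x 0 i) by exact: CP.
have /choice[q Hq] : forall i, exists q, apCk k q /\ forall t x, I t ->
    is_derive x (edir R l) (fun y => P t y 0 i - y 0 i) (q t x).
  by move=> i; have [_ /(_ l)[q Cq Dq]] := CPk i; exists q.
have DPi i t x : I t -> is_derive x (edir R l) (fun y => P t y 0 i) (q i t x + (i == l)%:R).
  move=> It; have [_ /(_ t x It) h] := Hq i.
  have := is_deriveD h (is_derive_coord i l x).
  by congr is_derive; apply/funext => y /=; rewrite fctE /= subrK.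
exists (fun t x => \sum_i df i t (P t x) * (q i t x + (i == l)%:R)).
  apply: apCk_sum => i; apply: apCkM.
    by apply: IH => // j _; exact: apCk_pred.
  by apply: apCkD; [have [] := Hq i|exact: apCk_cst].
move=> t x It; have := @derive_comp f df t x (edir R l) (\row_i (q i t x + (i == l)%:R)) It.
move=> /(_ (fun i => apCk_apc (Cdf i)) Df) h.
apply: is_derive_eq; first by apply: h => i; rewrite mxE; exact: DPi.
by apply: eq_bigr => i _; rewrite mxE.
Qed.

End CompositionCk.

End Curves.

(** * Linear equations *)

Section LinearODE.
Variables (R : realType) (n : nat) (g T : R).
Hypotheses (g0 : 0 <= g) (g1 : g < 1) (T0 : 0 < T).
Local Notation V := 'rV[R]_n.
Local Notation I := (inI T).
Local Notation pw h := (h `^ g).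
Local Notation holder_le := (@holder_le R n g).
Local Notation holder_small := (@holder_small R n g).
Local Notation np := (@near_labels R n T).
Local Notation apc := (@apc R n g T).
Local Notation apCk := (@apCk R n g T).
Implicit Types (f h : R -> V -> R) (a : 'I_n -> 'I_n -> R -> V -> R)
  (b : 'I_n -> R -> V -> R) (y : R -> V -> V).

Lemma edir_le (l : 'I_n) (r : R) : `|r *: edir R l| <= `|r|.
Proof.
apply: le_rV => // i; rewrite !mxE eqxx /=.
by case: (_ == _); rewrite ?mulr1 ?mulr0 ?normr0.
Qed.

Lemma is_derive_sum_fun (J : Type) (r : seq J) (F : J -> V -> R) (dF : J -> R) (x v : V) :
  (forall j, is_derive x v (F j) (dF j)) ->
  is_derive x v (fun z => \sum_(j <- r) F j z) (\sum_(j <- r) dF j).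
Proof.
move=> H; elim: r => [|j r IH].
  rewrite big_nil (_ : (fun z => _) = cst 0); first exact: is_derive_cst.
  by apply/funext => z; rewrite big_nil.
rewrite big_cons (_ : (fun z => _) = F j + (fun z => \sum_(j <- r) F j z)).
  exact: is_deriveD.
by apply/funext => z; rewrite big_cons.
Qed.

Lemma holder_le_time f h (C : R) : (forall x, ddt T (f^~ x) (h^~ x)) -> (forall t, I t -> holder_le C (h t)) ->
  forall s t, I s -> I t -> holder_le (C * `|s - t|) (fun x => f s x - f t x).
Proof.
move=> df hC s t; wlog ts : s t / t <= s => [H Is It|/andP[s0 sT] /andP[t0 tT]].
  have [ts|/ltW st] := leP t s; first exact: H.
  by rewrite distrC; apply: holder_le_ext (holder_leN (H t s st It Is)) => x /=; rewrite opprB.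
have Ir r : t < r < s -> I r.
  by move=> /andP[a c]; rewrite /inI !ltW //; [exact: lt_le_trans sT|exact: le_lt_trans a].
rewrite ger0_norm ?subr_ge0 //; split=> [x|x z].
  by apply: (ddt_bound (df x)) => // r /Ir Ir'; have [+ _] := hC r Ir'; apply.
have := ddt_bound (ddtB (df x) (df z)) t0 ts sT.
move=> /(_ (C * pw `|x - z|) _)/wrap[r /Ir Ir'|].
  by have [_] := hC r Ir'; apply.
by rewrite mulrAC (_ : f s x - f t x - _ = f s x - f s z - (f t x - f t z)) //; ring.
Qed.

(** Time and translation separate: a curve whose time derivative is Hoelder bounded is Lipschitz in
    time in the Hoelder norm, so labels need only be compared at equal times. *)
Lemma near_labels_of_ddt f h (C : R) : (forall x, ddt T (f^~ x) (h^~ x)) ->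
  (forall t, I t -> holder_le C (h t)) ->
  (forall e : R, 0 < e -> exists (K : finType) (L : V -> K), forall c c', L c = L c' ->
     forall t, I t -> holder_le e (fun x => f t (x + c) - f t (x + c'))) ->
  forall e : R, 0 < e -> np (holder_close g e f).
Proof.
move=> df hC H e e0; have e2 : 0 < e / 2 by rewrite divr_gt0.
have [K [L HL]] := H _ e2.
have C0 : 0 <= C by apply: (holder_le_ge0 (hC 0 _)); rewrite /inI lexx ltW.
exists (e / 2 / (C + 1)), K, L; split; first by rewrite divr_gt0 //; lra.
move=> s t c c' Is It st Lc.
have u := holder_le_shift c (holder_le_time df hC Is It); have v := HL c c' Lc t It.
apply: (@holder_leW _ _ _ (C * `|s - t| + e / 2)).
  move: st; rewrite ltr_pdivlMr; last by lra.
  have := normr_ge0 (s - t); lra.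
by apply: holder_le_ext (holder_leD u v) => x /=; ring.
Qed.

Definition linrhs a b y i : R -> V -> R := fun t x => \sum_j a i j t x * y t x 0 j + b i t x.

(** The zero initial value fits all uses: derivatives of [P - id], differences of translates of
    solutions, and deviations of matrices from the identity. *)
Definition linsol a b y := (forall x, y 0 x = 0) /\
  forall x, vddt T (y^~ x) (fun t => \row_i linrhs a b y i t x).

Lemma linsol_ddt a b y i x : linsol a b y -> ddt T (fun t => y t x 0 i) (fun t => linrhs a b y i t x).
Proof. by move=> [_ /(_ x i)]; apply: ddt_ext => // t _; rewrite mxE. Qed.

Lemma linsum_le (c : 'I_n -> R) (v : V) (M : R) : (forall j, `|c j| <= M) ->
  `|\sum_j c j * v 0 j| <= n%:R * M * `|v|.
Proof.
move=> H; rewrite -mulrA; apply: norm_sum_ord => j.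
by rewrite normrM ler_pM // le_coord.
Qed.

Lemma linsol_exists a b : (forall i j, apc (a i j)) -> (forall i, apc (b i)) ->
  exists y, linsol a b y.
Proof.
move=> Aa Ab.
have [M M0 HM] := apc_uniform_bound (fun ij : 'I_n * 'I_n => Aa ij.1 ij.2).
have {}HM i j t x : I t -> `|a i j t x| <= M.
  by move=> It; have [+ _] := HM (i, j) t It; apply.
have K0 : 0 <= n%:R * M by rewrite mulr_ge0.
have /choice[y Hy] : forall x, exists y : R -> V, y 0 = 0 /\
    vddt T y (fun t => \row_i (\sum_j a i j t x * y t 0 j + b i t x)).
  move=> x; pose F t (v : V) : V := \row_i (\sum_j a i j t x * v 0 j + b i t x).
  apply: (@picard R T n F _ T0 K0) => [v i|t v w It].
    have : apc (fun t x => \sum_j a i j t x * v 0 j + b i t x).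
      apply: (@apCk_apc _ _ _ _ 0); apply: apCkD => //.
      by apply: apCk_sum => // j; apply: apCkM => //; exact: apCk_cst.
    move=> Ap; have /contIP h := apc_contI (x := x) Ap; apply/contIP => t It e e0.
    by have [d d0 Hd] := h t It e e0; exists d => // s; rewrite !mxE; exact: Hd.
  apply: le_rV => [|i]; first by rewrite mulr_ge0.
  rewrite rVBE !mxE opprD addrACA subrr addr0 -sumrB.
  rewrite (eq_bigr (fun j => a i j t x * (v - w) 0 j)).
    by apply: linsum_le => j; exact: HM.
  by move=> j _; rewrite rVBE mulrBr.
exists (fun t x => y x t); split=> x; first by case: (Hy x).
by move=> i; have [_ /(_ i)] := Hy x; apply: ddt_ext => // t _; rewrite !mxE.
Qed.

(** The difference of the values at [x] and [z] solves a linear equation with coefficients at [x]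
    and source [(a x - a z) * y z + (b x - b z)]. The statement is pointwise in [x] and [z], so that
    [mu] and [eta] may depend on [|x - z|]; it then serves both Hoelder bounds and small scales. The
    constant [G] depends on the coefficients only through [M]. *)
Lemma linsol_growth (M : R) : 0 <= M -> exists2 G : R, 0 <= G & forall a b y (eta : R),
  (forall i j t x, I t -> `|a i j t x| <= M) -> linsol a b y -> 0 <= eta ->
  (forall x, (forall i t, I t -> `|b i t x| <= eta) -> forall t, I t -> `|y t x| <= G * eta) /\
  (forall x z (mu B : R), 0 <= mu -> 0 <= B ->
     (forall i j t, I t -> `|a i j t x - a i j t z| <= mu) ->
     (forall t, I t -> `|y t z| <= B) ->
     (forall i t, I t -> `|b i t x - b i t z| <= eta) ->
     forall t, I t -> `|y t x - y t z| <= G * (n%:R * mu * B + eta)).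
Proof.
move=> M0; have [G G0 HG] := @gronwall R T n (n%:R * M) (mulr_ge0 (ler0n _ _) M0).
exists G => // a b y eta aM [y0 dy] eta0; have II t : 0 < t < T -> I t by move=> /andP[? ?]; rewrite /inI !ltW.
split=> [x bx t It|x z mu B mu0 B0 ax yB bx t It].
  have := HG _ _ eta (dy x) eta0; rewrite y0 normr0 add0r; apply=> // s /II Is.
  apply: le_rV => [|i]; first by rewrite addr_ge0 // !mulr_ge0.
  rewrite mxE; apply: (le_trans (ler_normD _ _)); apply: lerD; last exact: bx.
  by apply: linsum_le => j; exact: aM.
have d1 : vddt T (fun t => y t x - y t z)
   (fun t => (\row_i linrhs a b y i t x) - \row_i linrhs a b y i t z).
  by move=> i; apply: ddt_ext (ddtB (dy x i) (dy z i)) => s _; rewrite !mxE.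
have e0 : 0 <= n%:R * mu * B + eta by rewrite addr_ge0 // !mulr_ge0.
have := HG _ _ _ d1 e0; rewrite !y0 subrr normr0 add0r; apply=> // s /II Is.
apply: le_rV => [|i]; first by rewrite !addr_ge0 // !mulr_ge0.
rewrite rVBE !mxE /linrhs.
rewrite (_ : _ - _ = \sum_j a i j s x * (y s x - y s z) 0 j +
   (\sum_j (a i j s x - a i j s z) * y s z 0 j + (b i s x - b i s z))); last first.
  rewrite addrA -big_split /= opprD addrACA -sumrB; congr (_ + _).
  by apply: eq_bigr => j _; rewrite rVBE; ring.
apply: (le_trans (ler_normD _ _)); apply: lerD.
  by apply: linsum_le => j; exact: aM.
apply: (le_trans (ler_normD _ _)); apply: lerD; last exact: bx.
have h : `|\sum_j (a i j s x - a i j s z) * y s z 0 j| <= n%:R * mu * `|y s z|.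
  by apply: linsum_le => j; exact: ax.
apply: (le_trans h); rewrite ler_wpM2l ?mulr_ge0 //; exact: yB.
Qed.

(** Since the bound is proportional to the source, a small source gives a small solution; this is
    what the comparison of translates uses. *)
Lemma linsol_holder_le (M : R) : 0 <= M -> exists2 C : R, 0 <= C & forall a b y (eta : R),
  (forall i j t, I t -> holder_le M (a i j t)) -> (forall i t, I t -> holder_le eta (b i t)) -> 0 <= eta ->
  linsol a b y -> forall i t, I t -> holder_le (C * eta) (fun x => y t x 0 i).
Proof.
move=> M0; have [G G0 HG] := linsol_growth M0.
have C0 : 0 <= G * (n%:R * M * G + 1) by rewrite !(mulr_ge0, addr_ge0).
exists (G + G * (n%:R * M * G + 1)) => [|a b y eta ha hbb eta0 sy i t It].
  by rewrite addr_ge0.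
have aM i' j t' x : I t' -> `|a i' j t' x| <= M by move=> It'; have [+ _] := ha i' j t' It'; apply.
have [H1 _] := HG a b y eta aM sy eta0.
have yB x t' : I t' -> `|y t' x| <= G * eta.
  by apply: H1 => i' s Is; have [+ _] := hbb i' s Is; apply.
split=> [x|x z].
  apply: (le_trans (le_coord _ _)); apply: (le_trans (yB x t It)).
  by rewrite ler_wpM2r // lerDl.
rewrite -rVBE; apply: (le_trans (le_coord _ _)).
have p0 : 0 <= pw `|x - z| by exact: powR_ge0.
have [_ H2] := HG a b y (eta * pw `|x - z|) aM sy (mulr_ge0 eta0 p0).
have := H2 x z (M * pw `|x - z|) (G * eta) (mulr_ge0 M0 p0) (mulr_ge0 G0 eta0).
move=> /(_ _ _ _ t It)/wrap[|||h].
- by move=> i' j s Is; have [_] := ha i' j s Is; apply.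
- by move=> s Is; exact: yB.
- by move=> i' s Is; have [_] := hbb i' s Is; apply.
apply: (le_trans h).
rewrite (_ : G * _ = G * (n%:R * M * G + 1) * eta * pw `|x - z|); last by ring.
by rewrite ler_wpM2r // ler_wpM2r // lerDr.
Qed.

Lemma apc_linrhs a b y i : (forall i j, apc (a i j)) -> (forall i, apc (b i)) ->
  (forall i, apc (fun t x => y t x 0 i)) -> apc (linrhs a b y i).
Proof.
move=> Aa Ab Ay; apply: (@apCk_apc _ _ _ _ 0); apply: apCkD => //.
by apply: apCk_sum => // j; apply: apCkM.
Qed.

(* The difference of two translates of [y] solves again a linear equation, with small right-hand
   side and zero initial value. *)
Lemma apc_linsol a b y : (forall i j, apc (a i j)) -> (forall i, apc (b i)) ->
  linsol a b y -> forall i, apc (fun t x => y t x 0 i).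
Proof.
move=> Aa Ab sy i0.
have [M1 M10 HM1] := apc_uniform_bound (fun ij : 'I_n * 'I_n => Aa ij.1 ij.2).
have [M2 M20 HM2] := apc_uniform_bound Ab.
pose M := M1 + M2; have M0 : 0 <= M by rewrite addr_ge0.
have ha i j t : I t -> holder_le M (a i j t).
  by move=> It; apply: holder_leW (HM1 (i, j) t It); rewrite lerDl.
have hbb i t : I t -> holder_le M (b i t).
  by move=> It; apply: holder_leW (HM2 i t It); rewrite lerDr.
have [C C0 HC] := linsol_holder_le M0.
pose B := C * M; have B0 : 0 <= B by rewrite mulr_ge0.
have yB i t : I t -> holder_le B (fun x => y t x 0 i) by move=> It; exact: (HC a b).
have N0 : 0 <= n%:R :> R by [].
split.
- by exists B => // t It; exact: yB.
- apply: (@near_labels_of_ddt _ (linrhs a b y i0) (n%:R * (2 * (M * B)) + M)).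
  + by move=> x; exact: linsol_ddt.
  + move=> t It; apply: holder_leD; last exact: hbb.
    by apply: holder_le_sum => j; apply: holder_leM; [exact: ha|exact: yB].
  + move=> e e0; pose q := C * (n%:R * (2 * B) + 1) + 1.
    have q0 : 0 < q by rewrite ltr_wpDl // !(mulr_ge0, addr_ge0).
    have [e1 e10 Ee] : exists2 e1 : R, 0 < e1 & e = q * e1.
      by exists (e / q); rewrite ?divr_gt0 // mulrC divfK // lt0r_neq0.
    have na : np (fun s c t c' => forall ij : 'I_n * 'I_n, holder_close g e1 (a ij.1 ij.2) s c t c').
      by apply: near_labels_fin => ij; have [_ + _] := Aa ij.1 ij.2; apply.
    have nb : np (fun s c t c' => forall i, holder_close g e1 (b i) s c t c').
      by apply: near_labels_fin => i; have [_ + _] := Ab i; apply.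
    have [d [K [L [d0 Hd]]]] := near_labels_and na nb; exists K, L => c c' Lc t It.
    have close s : I s -> (forall i j, holder_le e1 (fun x => a i j s (x + c) - a i j s (x + c'))) /\
        forall i, holder_le e1 (fun x => b i s (x + c) - b i s (x + c')).
      move=> Is; have [|u v] := Hd s s c c' Is Is _ Lc; first by rewrite subrr normr0.
      by split=> [i j|i]; [exact: u (i, j)|exact: v].
    pose b' i s x := \sum_j (a i j s (x + c) - a i j s (x + c')) * y s (x + c') 0 j +
       (b i s (x + c) - b i s (x + c')).
    have sz : linsol (fun i j s x => a i j s (x + c)) b' (fun s x => y s (x + c) - y s (x + c')).
      split=> [x|x i]; first by case: sy => y0 _; rewrite !y0 subrr.
      apply: ddt_ext (ddtB (linsol_ddt i (x + c) sy) (linsol_ddt i (x + c') sy)) => s _.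
        by rewrite rVBE.
      rewrite mxE /linrhs /b' addrA -big_split /= opprD addrACA -sumrB; congr (_ + _).
      by apply: eq_bigr => j _; rewrite rVBE; ring.
    have e2 : 0 <= n%:R * (2 * (e1 * B)) + e1.
      by rewrite !(mulr_ge0, addr_ge0) // ltW.
    have := HC _ b' _ (n%:R * (2 * (e1 * B)) + e1) _ _ e2 sz i0 t It.
    move=> /(_ _ _)/wrap[i j s Is||h].
    * exact: holder_le_shift (ha i j s Is).
    * move=> i s Is; apply: holder_leD; last by case: (close s Is) => _; apply.
      apply: holder_le_sum => j; apply: holder_leM; first by case: (close s Is) => + _; apply.
      exact: (holder_le_shift c' (yB j s Is)).
    apply: (holder_le_ext (fun x => rVBE _ _ _)); apply: holder_leW h.
    rewrite (_ : _ * _ = C * (n%:R * (2 * B) + 1) * e1); last by ring.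
    by rewrite Ee ler_wpM2r ?(ltW e10) // lerDl.
(* Small scales: [linsol_growth] with [mu] and [eta] both equal to [e1 * pw |x - z|], the
   small-scale bound common to the coefficients and the source. *)
- move=> e e0; have [G G0 HG] := linsol_growth M0.
  pose q := G * (n%:R * B + 1) + 1.
  have q0 : 0 < q by rewrite ltr_wpDl // !(mulr_ge0, addr_ge0).
  have [e1 e10 Ee] : exists2 e1 : R, 0 < e1 & e = q * e1.
      by exists (e / q); rewrite ?divr_gt0 // mulrC divfK // lt0r_neq0.
  have [r1 r10 Hr1] : exists2 r : R, 0 < r & forall (ij : 'I_n * 'I_n) t, r <= 1 /\ (I t -> holder_small r e1 (a ij.1 ij.2 t)).
    apply: fin_unif_ge => [ij r s rs H t|ij].
      have [s1 Hs] := H t; split; first exact: le_trans s1.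
      by move=> It; apply: holder_small_le (Hs It).
    have [_ _ /(_ _ e10)[r /andP[r0 r1] Hr]] := Aa ij.1 ij.2; exists r => // t.
    by split=> // It; exact: Hr.
  have [r2 r20 Hr2] : exists2 r : R, 0 < r & forall i t, I t -> holder_small r e1 (b i t).
    apply: fin_unif_ge => [i r s rs H t It|i].
      by apply: holder_small_le (H t It).
    by have [_ _ /(_ _ e10)[r /andP[r0 _] Hr]] := Ab i; exists r.
  exists (Num.min 1 (Num.min r1 r2)).
    by rewrite !lt_min ltr01 r10 r20 ge_min lexx.
  move=> t It x z; rewrite !le_min => /andP[_ /andP[xz1 xz2]].
  rewrite -rVBE; apply: (le_trans (le_coord _ _)).
  have p0 : 0 <= pw `|x - z| by exact: powR_ge0.
  have ep0 : 0 <= e1 * pw `|x - z| by rewrite mulr_ge0 // ltW.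
  have aM i j s w : I s -> `|a i j s w| <= M by move=> Is; have [+ _] := ha i j s Is; apply.
  have [_ H2] := HG a b y _ aM sy ep0.
  have := H2 x z _ B ep0 B0.
  move=> /(_ _ _ _ t It)/wrap[|||h].
  - by move=> i j s Is; have [_ +] := Hr1 (i, j) s; move=> /(_ Is); exact.
  - by move=> s Is; apply: le_rV => // i; have [+ _] := yB i s Is; apply.
  - by move=> i s Is; exact: Hr2.
  apply: (le_trans h).
  rewrite (_ : _ * _ = G * (n%:R * B + 1) * e1 * pw `|x - z|); last by ring.
  rewrite ler_wpM2r // Ee.
  by rewrite ler_wpM2r ?(ltW e10) // lerDl.
Qed.

End LinearODE.

(** * Linear equations with coefficients of higher order *)

Section CkLinear.
Variables (R : realType) (n : nat) (g T : R).
Hypotheses (g0 : 0 <= g) (g1 : g < 1) (T0 : 0 < T).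
Local Notation V := 'rV[R]_n.
Local Notation I := (inI T).
Local Notation apc := (@apc R n g T).
Local Notation apCk := (@apCk R n g T).
Local Notation linsol := (@linsol R n T).
Implicit Types (f h : R -> V -> R) (a : 'I_n -> 'I_n -> R -> V -> R)
  (b : 'I_n -> R -> V -> R) (y : R -> V -> V).

(* [f] is a C^1 curve in C^(k + g)_ap with derivative [f']. *)
Fixpoint C1apCk k f f' : Prop := [/\ forall x, ddt T (f^~ x) (f'^~ x), apc f, apc f' &
  if k is k'.+1 then forall i, exists h h', C1apCk k' h h' /\
    forall t x, I t -> is_derive x (edir R i) (f t) (h t x) /\ is_derive x (edir R i) (f' t) (h' t x)
  else True].

Lemma C1apCk_apCk k f f' : C1apCk k f f' -> apCk k f /\ apCk k f'.
Proof.
elim: k f f' => [|k IH] f f' [_ Af Af' H]; first by [].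
split; split=> // i; have [h [h' [/IH[Ch Ch'] D]]] := H i; [exists h|exists h'] => // t x It;
by case: (D t x It).
Qed.

(** The candidate [z] solves the formally differentiated equation. The remainder
    [y x' - y x - r z x] starts at [0] and solves a linear equation with source [o(r)], uniformly in
    time, so Gronwall makes it [o(r)]. *)
Lemma linsol_derive a b y (da : 'I_n -> 'I_n -> R -> V -> R) (db : 'I_n -> R -> V -> R) z l :
  (forall i j, apc (a i j)) -> (forall i, apc (b i)) ->
  (forall i j, apc (da i j)) -> (forall i, apc (db i)) ->
  (forall i j t x, I t -> is_derive x (edir R l) (a i j t) (da i j t x)) ->
  (forall i t x, I t -> is_derive x (edir R l) (b i t) (db i t x)) ->
  linsol a b y -> linsol a (linrhs da db y) z ->
  forall i t x, I t -> is_derive x (edir R l) (fun w => y t w 0 i) (z t x 0 i).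
Proof.
move=> Aa Ab Ada Adb Da Db sy sz i0 t0 x It0; apply/is_derive_epsP => e e0.
have Ay := apc_linsol T0 Aa Ab sy.
have [M1 M10 HM1] := apc_uniform_bound (fun ij : 'I_n * 'I_n => Aa ij.1 ij.2).
have [M2 M20 HM2] := apc_uniform_bound (fun ij : 'I_n * 'I_n => Ada ij.1 ij.2).
have [B B0 HB] := apc_uniform_bound Ay.
have aM i j s w : I s -> `|a i j s w| <= M1 by move=> Is; have [+ _] := HM1 (i, j) s Is; apply.
have daM i j s w : I s -> `|da i j s w| <= M2 by move=> Is; have [+ _] := HM2 (i, j) s Is; apply.
have yB i s w : I s -> `|y s w 0 i| <= B by move=> Is; have [+ _] := HB i s Is; apply.
have N0 : 0 <= n%:R :> R by [].
have [G G0 HG] := @gronwall R T n (n%:R * M1) (mulr_ge0 N0 M10).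
pose q := G * (n%:R * B + n%:R * M2 + 1) + 1.
have q0 : 0 < q by rewrite ltr_wpDl // !(mulr_ge0, addr_ge0).
have [e1 e10 Ee] : exists2 e1 : R, 0 < e1 & e = q * e1.
  by exists (e / q); rewrite ?divr_gt0 // mulrC divfK // lt0r_neq0.
have [r1 r10 Hr1] := apc_uniformly_continuous g0 (fun ij : 'I_n * 'I_n => Ada ij.1 ij.2) e10.
have [r2 r20 Hr2] := apc_uniformly_continuous g0 Adb e10.
have [r3 r30 Hr3] := apc_uniformly_continuous g0 Ay e10.
exists (Num.min r1 (Num.min r2 r3)) => [|r]; first by rewrite !lt_min r10 r20.
rewrite !lt_min => /andP[rr1 /andP[rr2 rr3]].
have shift_le s w : `|w| <= `|r| -> `|r| < s -> `|x + w *: edir R l - x| <= s.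
  move=> wr rs; rewrite addrAC subrr add0r; apply: (le_trans (edir_le _ _)).
  exact: le_trans wr (ltW rs).
pose x' := x + r *: edir R l.
have Ea i j s : I s -> `|a i j s x' - a i j s x - da i j s x * r| <= e1 * `|r|.
  move=> Is; apply: line_expansion => [z'|w wr]; first exact: Da.
  by apply: (Hr1 (i, j)) => //; exact: shift_le rr1.
have Eb i s : I s -> `|b i s x' - b i s x - db i s x * r| <= e1 * `|r|.
  move=> Is; apply: line_expansion => [z'|w wr]; first exact: Db.
  by apply: Hr2 => //; exact: shift_le rr2.
have Ey i s : I s -> `|y s x' 0 i - y s x 0 i| <= e1.
  by move=> Is; apply: Hr3 => //; exact: shift_le rr3.
have y0 := sy.1; have z0 := sz.1.
have d1 : vddt T (fun t => y t x' - y t x - r *: z t x)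
   (fun t => \row_i (linrhs a b y i t x' - linrhs a b y i t x -
      r * linrhs a (linrhs da db y) z i t x)).
  move=> i; apply: ddt_ext (ddtB (ddtB (linsol_ddt i x' sy) (linsol_ddt i x sy))
    (ddtZ r (linsol_ddt i x sz))) => s _; last by rewrite mxE.
  by rewrite !mxE.
pose eta := (n%:R * B + n%:R * M2 + 1) * e1 * `|r|.
have eta0 : 0 <= eta by rewrite !(mulr_ge0, addr_ge0) // ltW.
have := HG _ _ _ d1 eta0; rewrite !y0 z0 subrr scaler0 subrr normr0 add0r.
move=> /(_ _ t0 It0)/wrap[s /andP[s0 sT]|h].
  have Is : I s by rewrite /inI !ltW.
  apply: le_rV => [|i]; first by rewrite addr_ge0 // !mulr_ge0.
  rewrite mxE.
  (* The source of the remainder equation consists of the Taylor error of [a] times [y x'], of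
     [r da] times the increment of [y], and of the Taylor error of [b]; these are the three terms of
     [eta]. *)
  rewrite (_ : linrhs a b y i s x' - _ - _ =
     \sum_j a i j s x * (y s x' - y s x - r *: z s x) 0 j +
     (\sum_j (a i j s x' - a i j s x - da i j s x * r) * y s x' 0 j +
      (\sum_j r * da i j s x * (y s x' 0 j - y s x 0 j) + (b i s x' - b i s x - db i s x * r)))).
    apply: (le_trans (ler_normD _ _)); apply: lerD; first by apply: linsum_le => j; exact: aM.
    apply: (le_trans (ler_normD _ _)).
    rewrite (_ : eta = n%:R * B * e1 * `|r| + (n%:R * M2 * e1 * `|r| + e1 * `|r|)); last by rewrite /eta; ring.
    apply: lerD.
      rewrite -!mulrA; apply: norm_sum_ord => j; rewrite normrM mulrC.
      by apply: ler_pM => //; [exact: yB|exact: Ea].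
    apply: (le_trans (ler_normD _ _)); apply: lerD; last exact: Eb.
    rewrite -!mulrA; apply: norm_sum_ord => j; rewrite !normrM -!mulrA mulrCA.
    apply: ler_pM; rewrite ?mulr_ge0 //; first exact: daM.
    by rewrite mulrC ler_wpM2r //; exact: Ey.
  rewrite /linrhs.
  set S1 := \sum_j a i j s x' * _; set S2 := \sum_j a i j s x * y s x 0 j.
  set S3 := \sum_j a i j s x * z s x 0 j; set S4 := \sum_j da i j s x * _.
  set U1 := \sum_j a i j s x * (y s x' - y s x - r *: z s x) 0 j.
  set U2 := \sum_j (a i j s x' - a i j s x - da i j s x * r) * y s x' 0 j.
  set U3 := \sum_j r * da i j s x * (y s x' 0 j - y s x 0 j).
  suff E : U1 + (U2 + U3) = S1 - S2 - r * (S3 + S4).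
    rewrite [U2 + _]addrA [U1 + _]addrA E; ring.
  rewrite /U1 /U2 /U3 /S1 /S2 /S3 /S4 mulrDr !mulr_sumr -!sumrB -!big_split -sumrB /=.
  apply: eq_bigr => j _.
  rewrite !rVBE mxE; ring.
rewrite (_ : y t0 x' 0 i0 - y t0 x 0 i0 - r * z t0 x 0 i0 = (y t0 x' - y t0 x - r *: z t0 x) 0 i0).
  apply: (le_trans (le_coord _ _)); apply: (le_trans h).
  by rewrite Ee /eta !mulrA ler_wpM2r // ler_wpM2r ?(ltW e10) // /q lerDl.
by rewrite !mxE.
Qed.

(** The induction hypothesis is used twice: for [y] itself, which makes the source [da y + db] of
    the differentiated equation of order [k], and then for the solution [z] of that equation. The
    coefficients [a] stay the same. *)
Lemma C1apCk_linsol k a b y : (forall i j, apCk k (a i j)) -> (forall i, apCk k (b i)) ->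
  linsol a b y -> forall i, C1apCk k (fun t x => y t x 0 i) (linrhs a b y i).
Proof.
elim: k a b y => [|k IH] a b y Ca Cb sy i.
  have Aa i' j := apCk_apc (Ca i' j); have Ab i' := apCk_apc (Cb i').
  split=> //; first by move=> x; exact: linsol_ddt.
    exact: apc_linsol Aa Ab sy _.
  by apply: apc_linrhs => // i'; exact: apc_linsol Aa Ab sy _.
have Ca' i' j := apCk_pred (Ca i' j); have Cb' i' := apCk_pred (Cb i').
have Cy i' : apCk k (fun t x => y t x 0 i') by have [] := C1apCk_apCk (IH a b y Ca' Cb' sy i').
have Aa i' j := apCk_apc (Ca i' j); have Ab i' := apCk_apc (Cb i').
split.
- by move=> x; exact: linsol_ddt.
- exact: apCk_apc (Cy i).
- by apply: apc_linrhs => // i'; exact: apCk_apc (Cy i').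
move=> l; pose da i j t x := 'D_(edir R l) (a i j t) x; pose db i t x := 'D_(edir R l) (b i t) x.
have Cda i' j : apCk k (da i' j) by case: (apCk_derive l (Ca i' j)).
have Cdb i' : apCk k (db i') by case: (apCk_derive l (Cb i')).
have Da i' j t x : I t -> is_derive x (edir R l) (a i' j t) (da i' j t x).
  by case: (apCk_derive l (Ca i' j)) => _; apply.
have Db i' t x : I t -> is_derive x (edir R l) (b i' t) (db i' t x).
  by case: (apCk_derive l (Cb i')) => _; apply.
have Cb2 i' : apCk k (linrhs da db y i').
  by apply: apCkD => //; apply: apCk_sum => // j; apply: apCkM.
have [z sz] := linsol_exists T0 Aa (fun i' => apCk_apc (Cb2 i')).
have Dy i' t x : I t -> is_derive x (edir R l) (fun w => y t w 0 i') (z t x 0 i').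
  by apply: (@linsol_derive a b y da db z l) => // i1; try move=> j; exact: apCk_apc.
exists (fun t x => z t x 0 i), (linrhs a (linrhs da db y) z i); split; first exact: IH.
move=> t x It; split; first exact: Dy.
have h : is_derive x (edir R l) (linrhs a b y i t)
    (\sum_j (a i j t x * z t x 0 j + y t x 0 j * da i j t x) + db i t x).
  apply: is_deriveD; last exact: Db.
  by apply: is_derive_sum_fun => j; apply: is_deriveM; [exact: Da|exact: Dy].
apply: is_derive_eq h _; rewrite /linrhs addrA -big_split /=; congr (_ + _).
by apply: eq_bigr => j _; rewrite [y t x 0 j * _]mulrC.
Qed.

End CkLinear.

(** * The flow *)

Section Determinant.
Variables (R : realType) (n : nat) (T : R).
Local Notation I := (inI T).

Lemma contI_cst (c : R) : contI T (fun=> c).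
Proof. by case: (ddt_cst T c). Qed.

Lemma contID (v w : R -> R) : contI T v -> contI T w -> contI T (fun t => v t + w t).
Proof. by move=> cv cw x; apply: cvgD; [exact: cv|exact: cw]. Qed.

Lemma contIM (v w : R -> R) : contI T v -> contI T w -> contI T (fun t => v t * w t).
Proof. by move=> cv cw x; apply: cvgM; [exact: cv|exact: cw]. Qed.

Lemma contI_sum (J : Type) (r : seq J) (F : J -> R -> R) : (forall j, contI T (F j)) ->
  contI T (fun t => \sum_(j <- r) F j t).
Proof.
move=> H; elim: r => [|j r IH].
  by rewrite (_ : (fun t => _) = (fun=> 0)); [exact: contI_cst|apply/funext => t; rewrite big_nil].
by rewrite (_ : (fun t => _) = (fun t => F j t + \sum_(j <- r) F j t));
  [exact: contID|apply/funext => t; rewrite big_cons].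
Qed.

Lemma contI_prod (J : Type) (r : seq J) (F : J -> R -> R) : (forall j, contI T (F j)) ->
  contI T (fun t => \prod_(j <- r) F j t).
Proof.
move=> H; elim: r => [|j r IH].
  by rewrite (_ : (fun t => _) = (fun=> 1)); [exact: contI_cst|apply/funext => t; rewrite big_nil].
by rewrite (_ : (fun t => _) = (fun t => F j t * \prod_(j <- r) F j t));
  [exact: contIM|apply/funext => t; rewrite big_cons].
Qed.

Lemma contI_det (A : R -> 'M[R]_n) : (forall i j, contI T (fun t => A t i j)) ->
  contI T (fun t => \det (A t)).
Proof.
move=> H; rewrite /determinant; apply: contI_sum => s; apply: contIM; first exact: contI_cst.
exact: contI_prod.
Qed.

Lemma det_bound (A : 'M[R]_n) (B : R) : 0 <= B -> (forall i j, `|A i j| <= B) ->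
  `|\det A| <= \sum_(s : 'S_n) B ^+ n.
Proof.
move=> B0 H; rewrite /determinant; apply: (le_trans (ler_norm_sum _ _ _)).
apply: ler_sum => s _; rewrite normrM normrX normrN1 expr1n mul1r normr_prod.
apply: (@le_trans _ _ (\prod_(i < n) B)); last by rewrite prodr_const card_ord.
by apply: ler_prod => i _; rewrite normr_ge0 H.
Qed.

End Determinant.

Section Flow.
Variables (R : realType) (n : nat) (g T : R).
Hypotheses (g0 : 0 <= g) (g1 : g < 1) (T0 : 0 < T).
Local Notation V := 'rV[R]_n.
Local Notation I := (inI T).
Local Notation apc := (@apc R n g T).
Local Notation apCk := (@apCk R n g T).
Local Notation C1apCk := (@C1apCk R n g T).
Local Notation linsol := (@linsol R n T).
Local Notation np := (@near_labels R n T).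

Lemma sum_delta (c v : 'I_n -> R) (l : 'I_n) :
  \sum_k c k * ((k == l)%:R + v k) = \sum_k c k * v k + c l.
Proof.
under eq_bigr => k _ do rewrite mulrDr.
rewrite big_split /= addrC; congr (_ + _).
rewrite (bigD1 l) //= eqxx mulr1 big1 ?addr0 // => k /negbTE ->.
by rewrite mulr0.
Qed.

(* The matrix with rows [delta_m + q m] solves [Q' = - Q a] and hence is a bounded
   inverse of the fundamental matrix; the sign of the determinant follows by
   continuity from [t = 0]. *)
Lemma fundamental_det (a : 'I_n -> 'I_n -> R -> V -> R) (w : 'I_n -> R -> V -> V) :
  (forall i j, apc (a i j)) -> (forall l, linsol a (fun i => a i l) (w l)) ->
  exists2 e : R, 0 < e &
    forall t x, I t -> e < \det (\matrix_(i, l) ((i == l)%:R + w l t x 0 i)).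
Proof.
move=> Aa sw.
pose a' j k t x := (-1) * a k j t x.
have Aa' j k : apc (a' j k) by apply: apcM => //; exact: apc_cst.
have /choice[q sq] : forall m, exists q, linsol a' (fun j => a' j m) q.
  by move=> m; apply: (@linsol_exists _ _ g).
have [B B0 HB] := apc_uniform_bound (fun mj : 'I_n * 'I_n =>
  apc_linsol T0 Aa' (fun j => Aa' j mj.1) (sq mj.1) mj.2).
pose Q t x := \matrix_(m, j) ((m == j)%:R + q m t x 0 j).
pose Z t x := \matrix_(i, l) ((i == l)%:R + w l t x 0 i).
have QZ t x : I t -> Q t x *m Z t x = 1%:M.
  move=> It; apply/matrixP => m l; rewrite !mxE.
  (* The entry [(m, l)] of the product of the two matrices at time [s]; the opposite signs in the
     two equations make its derivative vanish. *)
  pose p s := \sum_j ((j == m)%:R + q m s x 0 j) * ((j == l)%:R + w l s x 0 j).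
  have dp : ddt T p (fun s => 0).
    have dj j := ddtM (ddtD (ddt_cst T (j == m)%:R) (linsol_ddt j x (sq m)))
      (ddtD (ddt_cst T (j == l)%:R) (linsol_ddt j x (sw l))).
    apply: ddt_ext (ddt_sum (index_enum _) dj) => // s _.
    rewrite big_split /=.
    under eq_bigr => j _ do rewrite add0r /linrhs -sum_delta mulr_sumr.
    under [X in _ + X]eq_bigr => j _ do rewrite add0r /linrhs -sum_delta mulr_sumr.
    rewrite exchange_big /= -big_split /= big1 // => j _.
    rewrite -big_split /= big1 // => k _; rewrite /a'; ring.
  have [t0 tT] := andP It.
  have := ddt_bound dp (lexx 0) t0 tT.
  move=> /(_ 0 _)/wrap[s _|]; first by rewrite normr0.
  rewrite mul0r normr_le0 subr_eq0 => /eqP pt.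
  transitivity (p t).
    by apply: eq_bigr => j _; rewrite !mxE [m == j]eq_sym.
  rewrite pt /p (eq_bigr (fun j => (j == m)%:R * ((j == l)%:R + 0))); last first.
    by move=> j _; rewrite (sq m).1 (sw l).1 !mxE !addr0.
  by rewrite sum_delta big1 ?add0r 1?eq_sym // => j _; rewrite mulr0.
pose D : R := \sum_(s : 'S_n) (1 + B) ^+ n.
have D0 : 0 <= D by apply: sumr_ge0 => s _; rewrite exprn_ge0 ?addr_ge0.
have QD t x : I t -> `|\det (Q t x)| <= D.
  move=> It; apply: det_bound => [|m j]; first by rewrite addr_ge0.
  rewrite mxE; apply: (le_trans (ler_normD _ _)); apply: lerD.
    by case: (_ == _); rewrite ?normr1 ?normr0.
  by have [+ _] := HB (m, j) t It; apply.
have detQZ t x : I t -> \det (Q t x) * \det (Z t x) = 1.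
  by move=> It; rewrite -det_mulmx QZ // det1.
have Zpos t x : I t -> 0 < \det (Z t x).
  (* A nonpositive determinant at time [t] would force a zero in [[0, t]], the value at time [0]
     being [1]; but the product with [\det Q] is always [1]. *)
  move=> It; have [t0 tT] := andP It; rewrite ltNge; apply/negP => Z0.
  have cZ : contI T (fun s => \det (Z s x)).
    apply: contI_det => i l; rewrite (_ : (fun t => _) = (fun t => (i == l)%:R + w l t x 0 i)).
      by apply: contID; [exact: contI_cst|case: (linsol_ddt i x (sw l))].
    by apply/funext => s; rewrite mxE.
  have Z00 : \det (Z 0 x) = 1.
    rewrite (_ : Z 0 x = 1%:M) ?det1 //; apply/matrixP => i l.
    by rewrite !mxE (sw l).1 mxE addr0.
  have [||c] := @IVT R (fun s => \det (Z s x)) 0 t 0 t0.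
  - by apply: continuous_subspaceW cZ; apply: subset_itv; rewrite bnd_simp.
  - by rewrite Z00 ge_min le_max ler01 Z0 orbT.
  rewrite in_itv /= => /andP[c0 ct] Zc.
  have Ic : I c by rewrite /inI c0 (le_trans ct).
  by have := detQZ c x Ic; rewrite Zc mulr0 => /eqP; rewrite eq_sym oner_eq0.
(* From [\det Q * \det Z = 1] and [|\det Q| <= D]; the added [1] makes the lower bound strict. *)
exists (D + 1)^-1 => [|t x It]; first by rewrite invr_gt0; lra.
have D1 : 0 < D + 1 by lra.
rewrite -/(Z t x) -[_^-1]mul1r ltr_pdivrMr //.
have z0 := Zpos t x It; have E := detQZ t x It.
have : \det (Q t x) * \det (Z t x) <= D * \det (Z t x).
  by apply: ler_wpM2r; [exact: ltW|apply: le_trans (QD t x It); exact: ler_norm].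
lra.
Qed.

Variable U : R -> V -> V.
Local Notation u i := (fun t x => U t x 0 i).

Definition is_flow (P : R -> V -> V) := (forall x, P 0 x = x) /\
  forall x, vddt T (P^~ x) (fun t => U t (P t x)).

Hypothesis CU : forall i, apCk 1 (u i).
Local Notation du i j := (fun t x => 'D_(edir R j) (u i t) x).

Lemma apc_du i j : apc (du i j).
Proof. by have [/apCk_apc] := apCk_derive j (CU i). Qed.

Lemma is_derive_u i j t x : I t -> is_derive x (edir R j) (u i t) (du i j t x).
Proof. by have [_] := apCk_derive j (CU i); apply. Qed.

Lemma field_lipschitz : exists2 K : R, 0 <= K &
  (forall i t x y, I t -> `|U t x 0 i - U t y 0 i| <= K * `|x - y|) /\
  (forall i t x, I t -> `|U t x 0 i| <= K).
Proof.
have [M1 M10 HM1] := apc_uniform_bound (fun ij : 'I_n * 'I_n => apc_du ij.1 ij.2).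
have [M2 M20 HM2] := apc_uniform_bound (fun i => apCk_apc (CU i)).
exists (n%:R * M1 + M2); first by rewrite addr_ge0 ?mulr_ge0.
split=> [i t x y It|i t x It].
  have := @C1_lipschitz R n (u i t) (fun j => du i j t) M1.
  move=> /(_ _ _ x y)/wrap[||h].
  - by move=> j z; exact: is_derive_u.
  - by move=> j z; have [+ _] := HM1 (i, j) t It; apply.
  by apply: (le_trans h); rewrite mulrA ler_wpM2r // lerDl.
by have [+ _] := HM2 i t It => /(_ x) h; apply: (le_trans h); rewrite lerDr mulr_ge0.
Qed.

Lemma flow_exists : exists P, is_flow P.
Proof.
have [K K0 [lipU _]] := field_lipschitz.
have /choice[P HP] : forall x, exists P : R -> V, P 0 = x /\ vddt T P (fun t => U t (P t)).
  move=> x; apply: (@picard R T n U K T0 K0) => [y i|t y z It].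
    exact: apc_contI (apCk_apc (CU i)).
  by apply: le_rV => [|i]; [rewrite mulr_ge0|rewrite rVBE; exact: lipU].
by exists (fun t x => P x t); split=> x; case: (HP x).
Qed.

Lemma flow_unique P P' : is_flow P -> is_flow P' -> forall t x, I t -> P t x = P' t x.
Proof.
move=> HP HP' t x It; have [K K0 [lipU _]] := field_lipschitz.
have [G G0 HG] := @gronwall R T n K K0.
have d1 : vddt T (fun t => P t x - P' t x) (fun t => U t (P t x) - U t (P' t x)).
  by move=> i; apply: ddt_ext (ddtB (HP.2 x i) (HP'.2 x i)) => s _; rewrite rVBE.
have := HG _ _ 0 d1 (lexx 0); rewrite HP.1 HP'.1 subrr normr0 addr0 mulr0.
move=> /(_ _ t It)/wrap[s /andP[s0 sT]|]; last by rewrite normr_le0 subr_eq0 => /eqP.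
rewrite addr0; apply: le_rV => [|i]; first by rewrite mulr_ge0.
by rewrite rVBE; apply: lipU; rewrite /inI !ltW.
Qed.

(** * Regularity of the flow *)

Section FlowProperties.
Variable P : R -> V -> V.
Hypothesis flowP : is_flow P.

Lemma flow_lipschitz : exists2 L : R, 1 <= L &
  forall t x y, I t -> `|P t x - P t y| <= L * `|x - y|.
Proof.
have [K K0 [lipU _]] := field_lipschitz.
have [G G0 HG] := @gronwall R T n K K0.
exists (G + 1) => [|t x y It]; first by lra.
have d1 : vddt T (fun t => P t x - P t y) (fun t => U t (P t x) - U t (P t y)).
  by move=> i; apply: ddt_ext (ddtB (flowP.2 x i) (flowP.2 y i)) => s _; rewrite rVBE.
have := HG _ _ 0 d1 (lexx 0); rewrite !flowP.1 addr0 => h.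
apply: (@le_trans _ _ (G * `|x - y|)); last by rewrite ler_wpM2r // lerDl.
apply: h It => s /andP[s0 sT]; have Is : I s by rewrite /inI !ltW.
rewrite addr0; apply: le_rV => [|i]; first by rewrite mulr_ge0.
by rewrite rVBE; exact: lipU.
Qed.

Lemma flow_displacement_bound : exists2 M : R, 0 <= M &
  forall i t x, I t -> `|P t x 0 i - x 0 i| <= M.
Proof.
have [K K0 [_ bU]] := field_lipschitz; have N0 : 0 <= K * T by rewrite mulr_ge0 // ltW.
exists (K * T) => // i t x /[dup] It /andP[t0 tT].
have := ddt_bound (flowP.2 x i) (lexx 0) t0 tT; rewrite flowP.1 subr0 => h.
apply: (@le_trans _ _ (K * t)); last by rewrite ler_wpM2l.
apply: h => s /andP[s0 st]; apply: bU; rewrite /inI !ltW //; exact: lt_le_trans tT.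
Qed.

Lemma flow_close (e : R) : 0 < e ->
  np (fun s c t c' => forall x, `|(P s (x + c) - c) - (P t (x + c') - c')| <= e).
Proof.
move=> e0; have [K K0 [lipU bU]] := field_lipschitz.
have [G G0 HG] := @gronwall R T n K K0.
have [e1 e10 Ee] : exists2 e1 : R, 0 < e1 & e / 2 = (G + 1) * e1.
  have G1 : 0 < G + 1 by lra.
  by exists (e / 2 / (G + 1)); [rewrite !divr_gt0|rewrite [RHS]mulrC divfK // lt0r_neq0].
have nU : np (fun s c t c' => forall i, holder_close g e1 (u i) s c t c').
  by apply: near_labels_fin => i; have [_ + _] := apCk_apc (CU i); apply.
have [d [C [L [d0 Hd]]]] := nU.
exists (e / 2 / (K + 1)), C, L; split; first by rewrite !divr_gt0 //; lra.
move=> s t c c' Is It st Lc x.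
have h1 : `|P s (x + c) - P t (x + c)| <= e / 2.
  apply: (@le_trans _ _ (K * `|s - t|)); last first.
    move: st; rewrite ltr_pdivlMr; last by lra.
    by have := normr_ge0 (s - t); lra.
  clear -Is It bU K0 flowP.
  wlog ts : s t Is It / t <= s => [H|].
    have [ts|/ltW st] := leP t s; first exact: H.
    by rewrite distrC [`|s - t|]distrC; exact: H.
  apply: le_rV => [|i]; first by rewrite mulr_ge0.
  have [s0 sT] := andP Is; have [t0 tT] := andP It.
  rewrite rVBE [`|s - t|]ger0_norm ?subr_ge0 //; apply: (ddt_bound (flowP.2 (x + c) i) t0 ts sT) => r /andP[tr rs].
  by apply: bU; rewrite /inI (ltW (le_lt_trans t0 tr)) (ltW (lt_le_trans rs sT)).
have h2 : `|P t (x + c) - c - (P t (x + c') - c')| <= e / 2.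
  have d1 : vddt T (fun t => P t (x + c) - c - (P t (x + c') - c'))
      (fun t => U t (P t (x + c)) - U t (P t (x + c'))).
    move=> i; apply: ddt_ext (ddtB (ddtB (flowP.2 (x + c) i) (ddt_cst T (c 0 i)))
      (ddtB (flowP.2 (x + c') i) (ddt_cst T (c' 0 i)))) => r _; first by rewrite !rVBE.
    by rewrite rVBE !subr0.
  have := HG _ _ _ d1 (ltW e10).
  rewrite !flowP.1 !addrK subrr normr0 add0r => h.
  apply: (@le_trans _ _ (G * e1)); last first.
    by rewrite Ee ler_wpM2r ?(ltW e10) // lerDl.
  apply: h It => r /andP[r0 rT]; have Ir : I r by rewrite /inI !ltW.
  apply: le_rV => [|i]; first by rewrite addr_ge0 ?mulr_ge0 ?(ltW e10).
  set p := P r (x + c) - c; set q := P r (x + c') - c'.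
  have -> : P r (x + c) = p + c by rewrite subrK.
  have -> : P r (x + c') = q + c' by rewrite subrK.
  (* The first difference compares two points under one translated field and is absorbed by
     Gronwall; the second compares the two translated fields at the same point [p], where equal
     labels make it at most [e1]. *)
  rewrite rVBE (_ : _ - _ = (U r (p + c') 0 i - U r (q + c') 0 i) + (U r (p + c) 0 i - U r (p + c') 0 i)); last by ring.
  apply: (le_trans (ler_normD _ _)); apply: lerD.
    by apply: (le_trans (lipU _ _ _ _ Ir)); rewrite opprD addrACA subrr addr0.
  have := Hd r r c c' Ir Ir; rewrite subrr normr0 => /(_ d0 Lc i)[+ _].
  exact.
rewrite (_ : _ - _ = (P s (x + c) - P t (x + c)) + (P t (x + c) - c - (P t (x + c') - c'))).
  by apply: (le_trans (ler_normD _ _)); lra.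
by rewrite [in RHS]addrA [in RHS]addrA subrK.
Qed.

Local Notation a i j := (fun t x => 'D_(edir R j) (u i t) (P t x)).

Lemma apc_a i j : apc (a i j).
Proof.
have [L L1 lipP] := flow_lipschitz.
exact: (apc_comp g0 g1 L1 lipP flow_close (apc_du i j)).
Qed.

(** The candidate for the derivative of [P] along [l] is [edir R l + w]. The remainder starts at [0]
    and satisfies the linearized equation up to the Taylor error of [U] between [P x] and [P x'],
    which is [o(r)] because [P] is Lipschitz. *)
Lemma flow_derive (w : R -> V -> V) l : linsol (fun i j => a i j) (fun i => a i l) w ->
  forall i t x, I t ->
  is_derive x (edir R l) (fun y => P t y 0 i - y 0 i) (w t x 0 i).
Proof.
move=> sw i0 t0 x It0; apply/is_derive_epsP => e e0.
have [M M0 HM] := apc_uniform_bound (fun ij : 'I_n * 'I_n => apc_a ij.1 ij.2).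
have aM i j s z : I s -> `|a i j s z| <= M by move=> Is; have [+ _] := HM (i, j) s Is; apply.
have N0 : 0 <= n%:R :> R by [].
have [G G0 HG] := @gronwall R T n (n%:R * M) (mulr_ge0 N0 M0).
have [L L1 lipP] := flow_lipschitz; have L0 := le_trans ler01 L1.
pose q := G * n%:R * L + 1.
have q0 : 0 < q by rewrite ltr_wpDl // !mulr_ge0.
have [e1 e10 Ee] : exists2 e1 : R, 0 < e1 & e = q * e1.
  by exists (e / q); rewrite ?divr_gt0 // mulrC divfK // lt0r_neq0.
have [r1 r10 Hr1] := apc_uniformly_continuous g0 (fun ij : 'I_n * 'I_n => apc_du ij.1 ij.2) e10.
exists (r1 / (L + 1)) => [|r rr1]; first by rewrite divr_gt0 //; lra.
pose x' := x + r *: edir R l.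
have xx' : `|x' - x| <= `|r| by rewrite /x' addrAC subrr add0r edir_le.
have PP s : I s -> `|P s x' - P s x| <= L * `|r|.
  by move=> Is; apply: (le_trans (lipP _ _ _ Is)); rewrite ler_wpM2l.
have d1 : vddt T (fun t => P t x' - P t x - r *: (edir R l + w t x))
   (fun t => \row_i (U t (P t x') 0 i - U t (P t x) 0 i -
      r * (0 + linrhs (fun i j => a i j) (fun i => a i l) w i t x))).
  move=> i; apply: ddt_ext (ddtB (ddtB (flowP.2 x' i) (flowP.2 x i))
    (ddtZ r (ddtD (ddt_cst T (edir R l 0 i)) (linsol_ddt i x sw)))) => s _.
    by rewrite !rVBE !mxE.
  by rewrite [RHS]mxE.
pose eta := n%:R * (e1 * (L * `|r|)).
have eta0 : 0 <= eta by rewrite !mulr_ge0 // ltW.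
have := HG _ _ _ d1 eta0.
rewrite !flowP.1 sw.1 addr0 {1}/x' [x + _ - x]addrAC subrr add0r subrr normr0 add0r.
move=> /(_ _ t0 It0)/wrap[s /andP[s0 sT]|h].
  have Is : I s by rewrite /inI !ltW.
  apply: le_rV => [|i]; first by rewrite addr_ge0 // !mulr_ge0.
  rewrite mxE.
  set S := \sum_j a i j s x * (P s x' 0 j - P s x 0 j).
  rewrite (_ : _ - _ - _ = \sum_j a i j s x * (P s x' - P s x - r *: (edir R l + w s x)) 0 j +
     (U s (P s x') 0 i - U s (P s x) 0 i - S)); last first.
    rewrite (eq_bigr (fun j => a i j s x * (P s x' 0 j - P s x 0 j) -
        r * (a i j s x * ((j == l)%:R + w s x 0 j)))); last first.
      by move=> j _; rewrite !rVBE !mxE eqxx /=; ring.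
    by rewrite sumrB -mulr_sumr sum_delta -/S /linrhs; ring.
  apply: (le_trans (ler_normD _ _)); apply: lerD; first by apply: linsum_le => j; exact: aM.
  have hr : L * `|r| <= r1.
    move: rr1; rewrite ltr_pdivlMr; last by lra.
    by have := normr_ge0 r; lra.
  apply: (@le_trans _ _ (n%:R * (e1 * `|P s x' - P s x|))).
    apply: (@C1_expansion R n (u i s) (fun j => du i j s)) => [j z|z hz j].
      exact: is_derive_u.
    by apply: (Hr1 (i, j)) => //; apply: (le_trans hz); apply: le_trans hr; exact: PP.
  by rewrite ler_wpM2l // ler_wpM2l ?(ltW e10) //; exact: PP.
rewrite -/x'.
rewrite (_ : _ - _ - _ = (P t0 x' - P t0 x - r *: (edir R l + w t0 x)) 0 i0).
  apply: (le_trans (le_coord _ _)); apply: (le_trans h).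
  rewrite (_ : G * eta = G * n%:R * L * e1 * `|r|); last by rewrite /eta; ring.
  by rewrite Ee ler_wpM2r // ler_wpM2r ?(ltW e10) // lerDl.
by rewrite !rVBE !mxE; ring.
Qed.

(** The derivatives [w l] are already known to be in [apc], as solutions of linear equations with
    coefficients [Du o P]; with the sup-norm closeness of the translates, [apc_of_C1] applies. *)
Lemma apc_displacement i : apc (fun t x => P t x 0 i - x 0 i).
Proof.
have /choice[w sw] : forall l, exists w, linsol (fun i j => a i j) (fun i => a i l) w.
  by move=> l; apply: (@linsol_exists _ _ g) => // *; exact: apc_a.
have [M M0 HM] := flow_displacement_bound.
apply: (@apc_of_C1 _ _ _ _ g0 g1 _ (fun l t x => w l t x 0 i) M) => //.
- by move=> t x; exact: HM.
- move=> e e0; apply: near_labels_imp (flow_close e0) => s c t c' _ _ h x.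
  apply: le_trans (h x); apply: le_trans (le_coord _ i).
  by rewrite le_eqVlt; apply/orP; left; apply/eqP; congr (`|_|); rewrite !mxE; ring.
- by move=> l; apply: (apc_linsol T0 _ _ (sw l)) => *; exact: apc_a.
- by move=> l t x It; exact: flow_derive.
Qed.

(* The bootstrap: coefficients of order [k] give [DP] of order [k], so [P] and then [Du o P] are
   of order [k + 1]. *)
Lemma apCk_a k : (forall i, apCk k.+1 (u i)) -> forall i j, apCk k (a i j).
Proof.
have [L L1 lipP] := flow_lipschitz.
elim: k => [|k IH] Ck i j; first by split=> //; exact: apc_a.
have Ca := IH (fun i => apCk_pred (Ck i)).
have Cdu : apCk k.+1 (du i j) by case: (apCk_derive j (Ck i)).
apply: (apCk_comp g0 g1 L1 lipP flow_close Cdu) => m _; split; first exact: apc_displacement.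
move=> l; have [w sw] : exists w, linsol (fun i j => a i j) (fun i => a i l) w.
  by apply: (@linsol_exists _ _ g) => // *; exact: apc_a.
exists (fun t x => w t x 0 m); last by move=> t x; exact: flow_derive.
by have [] := C1apCk_apCk (C1apCk_linsol g0 T0 Ca (fun i => Ca i l) sw m).
Qed.

(** At the top order the derivatives of [U o P] are read off as the right-hand sides of the linear
    equations for the derivatives of [P]: the mixed derivatives in time and space agree. *)
Lemma C1apCk_flow k : (forall i, apCk k.+1 (u i)) ->
  forall i, C1apCk k.+1 (fun t x => P t x 0 i - x 0 i) (fun t x => U t (P t x) 0 i).
Proof.
move=> Ck i; have [L L1 lipP] := flow_lipschitz; split.
- move=> x; apply: ddt_ext (ddtB (flowP.2 x i) (ddt_cst T (x 0 i))) => // t _.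
  by rewrite subr0.
- exact: apc_displacement.
- exact: (apc_comp g0 g1 L1 lipP flow_close (apCk_apc (CU i))).
move=> l; have [w sw] : exists w, linsol (fun i j => a i j) (fun i => a i l) w.
  by apply: (@linsol_exists _ _ g) => // *; exact: apc_a.
have Ca := apCk_a Ck.
exists (fun t x => w t x 0 i), (linrhs (fun i j => a i j) (fun i => a i l) w i).
split; first exact: C1apCk_linsol.
move=> t x It; split; first exact: flow_derive.
have DP j : is_derive x (edir R l) (fun y => P t y 0 j) ((\row_j ((j == l)%:R + w t x 0 j)) 0 j).
  rewrite mxE; have := is_deriveD (is_derive_coord j l x) (flow_derive sw j x It).
  by congr is_derive; apply/funext => y; rewrite fctE /= addrC subrK.
have := derive_comp g0 L1 lipP It (apc_du i) (fun j t x => @is_derive_u i j t x) DP.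
move=> h; apply: is_derive_eq h _; rewrite /linrhs -sum_delta.
by apply: eq_bigr => j _; rewrite mxE.
Qed.

Lemma flow_jacobian : exists2 e : R, 0 < e & forall t x, I t ->
  e < \det (1%:M + jac (fun y => P t y - y) x).
Proof.
have /choice[w sw] : forall l, exists w, linsol (fun i j => a i j) (fun i => a i l) w.
  by move=> l; apply: (@linsol_exists _ _ g) => // *; exact: apc_a.
have [e e0 He] := fundamental_det (fun i j => apc_a i j) sw.
exists e => // t x It; rewrite (_ : _ + _ = \matrix_(i, l) ((i == l)%:R + w l t x 0 i)).
  exact: He.
apply/matrixP => i l; rewrite !mxE; congr (_ + _).
have [_ <-] := flow_derive (sw l) i x It.
by congr ('D_ _ _ _); apply/funext => y; rewrite /Defs.comp rVBE.
Qed.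

End FlowProperties.
End Flow.

(** * Bridge to the Hoelder norm *)

Section Continuity.
Variables (R : realType) (U : normedModType R).
Implicit Types F G : U -> R.

Lemma continuous_epsP F : continuous F <-> forall (x : U) (e : R), 0 < e ->
  exists2 r : R, 0 < r & forall y, `|y - x| < r -> `|F y - F x| <= e.
Proof.
split=> [cF x e e0|H x].
  have /cvgrPdist_le/(_ e e0)/nbhs_ballP[r /= r0 Hr] : F @ x --> F x by exact: cF.
  exists r => // y yx; rewrite distrC; apply: Hr.
  by rewrite -ball_normE /= distrC.
apply/cvgrPdist_le => e e0; have [r r0 Hr] := H x e e0.
apply/nbhs_ballP; exists r => //= y; rewrite -ball_normE /= distrC => yx.
by rewrite distrC; exact: Hr.
Qed.

Lemma continuous_addf F G : continuous F -> continuous G -> continuous (fun x => F x + G x).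
Proof. by move=> cF cG x; apply: cvgD; [exact: cF|exact: cG]. Qed.

Lemma continuous_scalef (c : R) F : continuous F -> continuous (fun x => c * F x).
Proof. by move=> cF x; apply: cvgM; [exact: cvg_cst|exact: cF]. Qed.

Lemma continuous_subf F G : continuous F -> continuous G -> continuous (fun x => F x - G x).
Proof. by move=> cF cG x; apply: cvgB; [exact: cF|exact: cG]. Qed.

Lemma continuous_shiftf (c : U) F : continuous F -> continuous (fun x => F (x + c)).
Proof.
move=> /continuous_epsP cF; apply/continuous_epsP => x e e0.
have [r r0 Hr] := cF (x + c) e e0; exists r => // y yx; apply: Hr.
by rewrite opprD addrACA subrr addr0.
Qed.

End Continuity.

Section HolderBounds.
Variables (R : realType) (n : nat) (g T : R).
Hypotheses (g0 : 0 <= g) (g1 : g < 1).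
Local Notation V := 'rV[R]_n.
Local Notation I := (inI T).
Local Notation pw h := (h `^ g).
Local Notation holder_le := (@holder_le R n g).
Local Notation holder_small := (@holder_small R n g).
Local Notation apc := (@apc R n g T).
Local Notation apCk := (@apCk R n g T).
Local Notation C1apCk := (@C1apCk R n g T).
Local Notation np := (@near_labels R n T).
Implicit Types (F G : V -> R) (f h : R -> V -> R).

(** Continuity is listed separately, since for [g = 0] the Hoelder bound says nothing about it. *)
Fixpoint ck_le k (e : R) F : Prop := [/\ continuous F, holder_le e F &
  if k is k'.+1 then forall i, exists2 G, ck_le k' e G & forall x, is_derive x (edir R i) F (G x)
  else True].

Lemma ck_le_holder_le k e F : ck_le k e F -> holder_le e F.
Proof. by case: k => [|k] []. Qed.

Lemma ck_le_mono k e e' F : e <= e' -> ck_le k e F -> ck_le k e' F.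
Proof.
move=> ee; elim: k F => [|k IH] F [cF hF H]; split=> //; try exact: holder_leW hF.
by move=> i; have [G /IH CG DG] := H i; exists G.
Qed.

Lemma ck_le_ext k e F G : F =1 G -> ck_le k e F -> ck_le k e G.
Proof. by move=> /funext ->. Qed.

Lemma ck_leD k a b F G : ck_le k a F -> ck_le k b G -> ck_le k (a + b) (fun x => F x + G x).
Proof.
elim: k F G => [|k IH] F G [cF hF HF] [cG hG HG]; (split; [exact: continuous_addf|exact: holder_leD|]) => //.
move=> i; have [F' CF DF] := HF i; have [G' CG DG] := HG i.
by exists (fun x => F' x + G' x); [exact: IH|move=> x; apply: is_deriveD].
Qed.

Lemma ck_leZ k a c F : ck_le k a F -> ck_le k (`|c| * a) (fun x => c * F x).
Proof.
elim: k F => [|k IH] F [cF hF HF]; (split; [exact: continuous_scalef|exact: holder_leZ|]) => //.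
move=> i; have [F' CF DF] := HF i.
exists (fun x => c * F' x); first exact: IH.
by move=> x; apply: is_deriveZ.
Qed.

Lemma ck_leB k a b F G : ck_le k a F -> ck_le k b G -> ck_le k (a + b) (fun x => F x - G x).
Proof.
move=> hF /(ck_leZ (-1)); rewrite normrN1 mul1r => hG.
by apply: ck_le_ext (ck_leD hF hG) => x /=; rewrite mulN1r.
Qed.

Lemma ck_le_shift k a c F : ck_le k a F -> ck_le k a (fun x => F (x + c)).
Proof.
elim: k F => [|k IH] F [cF hF HF]; (split; [exact: continuous_shiftf|exact: holder_le_shift|]) => //.
move=> i; have [F' CF DF] := HF i.
by exists (fun x => F' (x + c)); [exact: IH|move=> x; apply: is_derive_shift_arg].
Qed.

Lemma apc_continuous f t : apc f -> I t -> continuous (f t).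
Proof.
move=> Af It; apply/continuous_epsP => x e e0.
have [r r0 Hr] := apc_uniformly_continuous g0 (fun _ : unit => Af) e0.
by exists r => // y yx; apply: (Hr tt) => //; exact: ltW.
Qed.

Lemma apCk_bound k f : apCk k f -> exists2 M, 0 <= M & forall t, I t -> ck_le k M (f t).
Proof.
elim: k f => [|k IH] f [Af H]; have [[M M0 HM] _ _] := Af.
  by exists M => // t It; split=> //; [exact: apc_continuous|exact: HM].
have [N N0 HN] : exists2 N : R, 0 <= N & forall i, exists2 h, forall t, I t -> ck_le k N (h t) &
    forall t x, I t -> is_derive x (edir R i) (f t) (h t x).
  apply: fin_unif_le => [i a b ab [h Hh Dh]|i].
    by exists h => // t It; apply: ck_le_mono ab _; exact: Hh.
  have [h /IH[N N0 HN] Dh] := H i; exists N => //; by exists h.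
exists (M + N); first by rewrite addr_ge0.
move=> t It; split; first exact: apc_continuous.
  by apply: holder_leW (HM t It); rewrite lerDl.
move=> i; have [h Hh Dh] := HN i; exists (h t); last by move=> x; exact: Dh.
by apply: ck_le_mono (Hh t It); rewrite lerDr.
Qed.

Definition ck_close k (e : R) f s (c : V) t (c' : V) := ck_le k e (fun x => f s (x + c) - f t (x + c')).

Lemma apCk_close k f (e : R) : 0 < e -> apCk k f -> np (ck_close k e f).
Proof.
move=> e0; elim: k f => [|k IH] f [Af H]; have [_ /(_ e e0) H2 _] := Af.
  apply: near_labels_imp H2 => s c t c' Is It hc; split=> //.
  have [M M0 HM] := apCk_bound (k := 0) (conj Af Logic.I).
  by have [+ _ _] := ck_leB (ck_le_shift c (HM s Is)) (ck_le_shift c' (HM t It)).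
have /choice[h Hh] : forall i, exists h, apCk k h /\ forall t x, I t -> is_derive x (edir R i) (f t) (h t x).
  by move=> i; have [h Ch Dh] := H i; exists h.
have Nh := near_labels_fin (fun i => IH (h i) (Hh i).1).
apply: near_labels_imp (near_labels_and H2 Nh) => s c t c' Is It [hc hh]; split=> //.
  have [M M0 HM] := apCk_bound (k := 0) (conj Af Logic.I).
  by have [+ _ _] := ck_leB (ck_le_shift c (HM s Is)) (ck_le_shift c' (HM t It)).
move=> i; exists (fun x => h i s (x + c) - h i t (x + c')); first exact: hh.
by move=> x; apply: is_deriveB; apply: is_derive_shift_arg; apply: (Hh i).2.
Qed.

(** The mean value bound is applied to [w - v t * id], whose derivative is the oscillation of [v]
    around time [t]. *)
Lemma ddt_diffquot (w v : R -> R) s t (e : R) : ddt T w v -> I s -> I t -> 0 < `|s - t| ->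
  (forall r, I r -> `|r - t| <= `|s - t| -> `|v r - v t| <= e) ->
  `|(s - t)^-1 * (w s - w t) - v t| <= e.
Proof.
move=> dw Is It st0 H; have st : s - t != 0 by rewrite -normr_gt0.
rewrite -(ler_pM2r st0) -normrM mulrBl mulrAC mulVf // mul1r.
have d1 := ddtB dw (ddtZ (v t) (ddt_id T)).
have [s0 sT] := andP Is; have [t0 tT] := andP It.
rewrite (_ : _ - _ = w s - v t * s - (w t - v t * t)); last by ring.
have [ts|/ltW ts] := leP t s.
  rewrite [`|s - t|]ger0_norm ?subr_ge0 //; apply: (ddt_bound d1) => // r /andP[tr rs].
  rewrite mulr1; apply: H; first by rewrite /inI (ltW (le_lt_trans t0 tr)) (ltW (lt_le_trans rs sT)).
  by rewrite !ger0_norm ?subr_ge0 ?lerD2r // ltW.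
rewrite distrC [`|s - t|]distrC [`|t - s|]ger0_norm ?subr_ge0 //; apply: (ddt_bound d1) => // r /andP[sr rt].
rewrite mulr1; apply: H; first by rewrite /inI (ltW (le_lt_trans s0 sr)) (ltW (lt_le_trans rt tT)).
by rewrite ![`|_ - t|]distrC !ger0_norm ?subr_ge0 // ?lerD2l ?lerN2 ltW.
Qed.

(** A time derivative known only pointwise in [x] is a derivative in norm once it is continuous in
    time in that norm. The seminorm is reached by applying [ddt_diffquot] to the difference of the
    values at two points. *)
Lemma C1apCk_diffquot k f f' (e : R) : 0 < e -> C1apCk k f f' ->
  exists2 d : R, 0 < d & forall s t, I s -> I t -> 0 < `|s - t| -> `|s - t| < d ->
    ck_le k e (fun x => (s - t)^-1 * (f s x - f t x) - f' t x).
Proof.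
move=> e0; elim: k f f' => [|k IH] f f' [df Af Af' H].
all: have [_ /(_ e e0)[d1 [K [L [d10 Hd1]]]] _] := Af'.
all: have hbq s t : I s -> I t -> 0 < `|s - t| -> `|s - t| < d1 ->
    holder_le e (fun x => (s - t)^-1 * (f s x - f t x) - f' t x).
1,3: move=> Is It st0 st; have close r : I r -> `|r - t| <= `|s - t| -> holder_le e (fun x => f' r x - f' t x).
1,3: by move=> Ir rt; have := Hd1 r t 0 0 Ir It (le_lt_trans rt st) erefl;
   apply: holder_le_ext => x; rewrite !addr0.
1,2: split=> [x|x y].
1,3: by apply: (ddt_diffquot (df x)) => // r Ir rt; have [+ _] := close r Ir rt; apply.
1,2: rewrite (_ : _ - _ - _ = (s - t)^-1 * ((f s x - f s y) - (f t x - f t y)) - (f' t x - f' t y)); last by ring.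
1,2: apply: (ddt_diffquot (ddtB (df x) (df y))) => // r Ir rt; have [_ cl] := close r Ir rt.
1,2: by rewrite (_ : _ - _ - _ = f' r x - f' t x - (f' r y - f' t y)); [exact: cl|ring].
all: have cq s t : I s -> I t -> continuous (fun x => (s - t)^-1 * (f s x - f t x) - f' t x).
1,3: by move=> Is It; apply: continuous_subf; [apply: continuous_scalef; apply: continuous_subf|];
  exact: apc_continuous.
  by exists d1 => // s t Is It st0 st; split=> //; [exact: cq|exact: hbq].
have /choice[h Hh] : forall i, exists h, exists h', C1apCk k h h' /\
    forall t x, I t -> is_derive x (edir R i) (f t) (h t x) /\ is_derive x (edir R i) (f' t) (h' t x).
  exact: H.
have {Hh}/choice[h' Hh] := Hh.
have [d2 d20 Hd2] : exists2 d : R, 0 < d & forall i s t, I s -> I t -> 0 < `|s - t| -> `|s - t| < d ->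
    ck_le k e (fun x => (s - t)^-1 * (h i s x - h i t x) - h' i t x).
  apply: fin_unif_ge => [i a b ab Hb s t Is It st0 st|i].
    by apply: Hb => //; exact: lt_le_trans ab.
  by apply: IH; have [] := Hh i.
exists (Num.min d1 d2) => [|s t Is It st0]; first by rewrite lt_min d10.
rewrite lt_min => /andP[st1 st2]; split; [exact: cq|exact: hbq|move=> i].
exists (fun x => (s - t)^-1 * (h i s x - h i t x) - h' i t x); first exact: Hd2.
move=> x; have [_ D] := Hh i; have [D1 _] := D s x Is; have [D2 D3] := D t x It.
by apply: is_deriveB => //.
Qed.

Section SmallScale.
Variable f : R -> V -> R.
Hypotheses (fb : exists2 M : R, 0 <= M & forall t, I t -> holder_le M (f t))
  (fc : forall t, I t -> continuous (f t))
  (fn : forall e : R, 0 < e -> np (holder_close g e f)).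

(* Total boundedness of the translates makes translation continuous: a small vector [c]
   has a label shared by arbitrarily small vectors [c'], and [c' -> 0] pointwise. *)
Lemma translation_continuous (e : R) : 0 < e -> exists2 d : R, 0 < d &
  forall c t, `|c| < d -> I t -> holder_le e (fun x => f t (x + c) - f t x).
Proof.
move=> e0; have [d0 [K [L [d00 Hd0]]]] := fn e0.
pose adh l := forall d : R, 0 < d -> exists2 c, `|c| < d & L c = l.
have [d dp Hd] : exists2 d : R, 0 < d & forall l, ~ adh l -> forall c, `|c| < d -> L c <> l.
  apply: fin_unif_ge => [l a b ab H nl c ca|l].
    by apply: H => //; exact: lt_le_trans ab.
  have [al|nl] := pselect (adh l); first by exists 1.
  move/existsNP: (nl) => [d /not_implyP[dp H]]; exists d => // _ c cd Lc.
  by apply: H; exists c.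
exists d => // c t cd It.
have al : adh (L c) by apply: contrapT => nl; exact: (Hd _ nl c cd erefl).
have approx (eta : R) x y : 0 < eta -> exists2 c', L c' = L c & `|f t (x + c') - f t x| <= eta /\ `|f t (y + c') - f t y| <= eta.
  move=> eta0.
  have cont z : exists2 r : R, 0 < r & forall c', `|c'| < r -> `|f t (z + c') - f t z| <= eta.
    have /continuous_epsP/(_ z eta eta0)[r r0 Hr] : continuous (f t) by exact: fc.
    by exists r => // c' c'r; apply: Hr; rewrite addrAC subrr add0r.
  have [r1 r10 H1] := cont x; have [r2 r20 H2] := cont y.
  have [|c' + Lc] := al (Num.min r1 r2); first by rewrite lt_min r10.
  by rewrite lt_min => /andP[c1 c2]; exists c' => //; split; [exact: H1|exact: H2].
have close c' : L c' = L c -> holder_le e (fun x => f t (x + c) - f t (x + c')).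
  by move=> Lc; apply: Hd0 => //; rewrite ?subrr ?normr0.
split=> [x|x y]; apply/ler_addgt0Pr => eta eta0.
  have [c' /close[h _] [h1 _]] := approx eta x x eta0.
  rewrite (_ : _ - _ = (f t (x + c) - f t (x + c')) + (f t (x + c') - f t x)); last by ring.
  by apply: (le_trans (ler_normD _ _)); apply: lerD.
have eta2 : 0 < eta / 2 by rewrite divr_gt0.
have [c' /close[_ h] [h1 h2]] := approx _ x y eta2.
rewrite (_ : _ - _ - _ = (f t (x + c) - f t (x + c') - (f t (y + c) - f t (y + c'))) +
  ((f t (x + c') - f t x) - (f t (y + c') - f t y))); last by ring.
apply: (le_trans (ler_normD _ _)); apply: lerD; first exact: h.
by apply: (le_trans (ler_normB _ _)); lra.
Qed.

(* Telescoping along [x, x + v, ..., x + N v]: every step almost equals the first one,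
   so [N |f (x + v) - f x|] is at most [2 M] up to a small Hoelder error. *)
Lemma small_scale (e : R) : 0 < e -> exists2 r : R, 0 < r <= 1 & forall t, I t -> holder_small r e (f t).
Proof.
move=> e0; have [M M0 HM] := fb; have e2 : 0 < e / 2 by rewrite divr_gt0.
have [d d0 Hd] := translation_continuous e2.
(* With at least [d / (4 h)] steps, the requirement [2 M <= N (e / 2) h^g] follows from
   [(8 M / d) h <= (e / 2) h^g]. *)
have K0 : 0 <= 8 * M / d by rewrite divr_ge0 ?mulr_ge0 // ltW.
have [r /andP[r0 r1] Hr] := pw_small g1 e2 K0.
exists (Num.min r (d / 4)) => [|t It x y].
  by rewrite lt_min r0 divr_gt0 //= ge_min r1.
rewrite le_min => /andP[xyr xyd]; pose v := x - y; pose h := `|v|.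
have [v0|vn] := eqVneq v 0.
  have -> : x = y by apply/eqP; rewrite -subr_eq0 -/v v0.
  by rewrite !subrr !normr0 mulr_ge0 ?powR_ge0 // ltW.
have h0 : 0 < h by rewrite normr_gt0.
(* All multiples of [v] used then have norm at most [d / 2], within reach of translation continuity,
   and [h <= d / 4] ensures [N >= 1]. *)
pose N := Num.truncn (d / (2 * h)).
have q0 : 0 <= d / (2 * h) by rewrite divr_ge0 ?mulr_ge0 // ltW.
have [N1 N2] : N%:R <= d / (2 * h) /\ d / (2 * h) < N.+1%:R.
  by have /andP := truncn_itv q0.
have Nh : N%:R * h <= d / 2.
  have : N%:R * (2 * h) <= d by rewrite -ler_pdivlMr // mulr_gt0.
  lra.
have N3 : 1 <= N%:R :> R.
  rewrite ler1n lt0n; apply: contraTN N2 => /eqP ->; rewrite -leNgt ler_pdivlMr ?mulr_gt0 //.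
  by rewrite /h; lra.
have N4 : d <= 4 * h * N%:R.
  move: N2; rewrite ltr_pdivrMr ?mulr_gt0 // -natr1; have := ler_wpM2l (ltW h0) N3; lra.
have N0 : 0 < N%:R :> R by lra.
have tel : \sum_(j < N) (f t (y + v *+ j.+1) - f t (y + v *+ j)) = f t (y + v *+ N) - f t y.
  rewrite -(big_mkord xpredT (fun j => f t (y + v *+ j.+1) - f t (y + v *+ j))).
  by rewrite (telescope_sumr (fun j => f t (y + v *+ j))) // mulr0n addr0.
have step (j : 'I_N) : `|f t x - f t y - (f t (y + v *+ j.+1) - f t (y + v *+ j))| <= e / 2 * pw h.
  have jd : `|v *+ j| < d.
    rewrite normrMn -mulr_natl; apply: (@le_lt_trans _ _ (N%:R * h)).
      by rewrite ler_wpM2r // ?(ltW h0) // ler_nat ltnW.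
    by apply: (le_lt_trans Nh); lra.
  have [_ /(_ x y)] := Hd (v *+ j) t jd It.
  rewrite distrC; congr (_ <= _); congr (`|_|).
  have -> : y + v *+ j.+1 = x + v *+ j by rewrite mulrS addrA /v [y + _]addrC subrK.
  ring.
have S : `|N%:R * (f t x - f t y)| <= 2 * M + N%:R * (e / 2 * pw h).
  have -> : N%:R * (f t x - f t y) = (f t (y + v *+ N) - f t y) +
     \sum_(j < N) (f t x - f t y - (f t (y + v *+ j.+1) - f t (y + v *+ j))).
    by rewrite sumrB sumr_const card_ord tel -[in RHS]mulr_natl; ring.
  apply: (le_trans (ler_normD _ _)); apply: lerD.
    have [b _] := HM t It; apply: (le_trans (ler_normB _ _)).
    by have := b (y + v *+ N); have := b y; lra.
  apply: (le_trans (ler_norm_sum _ _ _)); apply: (le_trans (ler_sum _ (fun j _ => step j))).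
  by rewrite sumr_const card_ord mulr_natl.
rewrite -(ler_pM2l N0) -{1}[N%:R]ger0_norm // -normrM; apply: (le_trans S).
have := Hr h (ltW h0) xyr; rewrite -/v -/h => h1.
have h2 : 8 * M * h <= d * (e / 2 * pw h).
  by move: h1; rewrite mulrAC ler_pdivrMr // [_ * d]mulrC.
have p0 : 0 <= e / 2 * pw h by rewrite mulr_ge0 ?powR_ge0 // ltW.
have h3 : d * (e / 2 * pw h) <= 4 * h * N%:R * (e / 2 * pw h) by rewrite ler_wpM2r.
have h4 : 2 * M <= N%:R * (e / 2 * pw h).
  have : h * (8 * M) <= h * (4 * (N%:R * (e / 2 * pw h))) by lra.
  by rewrite ler_pM2l //; lra.
lra.
Qed.

End SmallScale.

(** The small-scale clause is not visible in bounds and closeness; [small_scale] supplies it at each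
    order of differentiation. *)
Lemma apCk_of_ck_le k f : (exists2 M : R, 0 <= M & forall t, I t -> ck_le k M (f t)) ->
  (forall e : R, 0 < e -> np (ck_close k e f)) -> apCk k f.
Proof.
elim: k f => [|k IH] f [M M0 HM] Hc.
all: have A : apc f.
1,3: have fb : exists2 M : R, 0 <= M & forall t, I t -> holder_le M (f t) by exists M => // t It; exact: ck_le_holder_le (HM t It).
1,2: have fn : forall e : R, 0 < e -> np (holder_close g e f) by
  move=> e e0; apply: near_labels_imp (Hc e e0) => s c t c' _ _; exact: ck_le_holder_le.
1,2: by split=> //; apply: small_scale => // t It; case: (HM t It).
  by split.
split=> // i; pose h t x := 'D_(edir R i) (f t) x.
have Dh t x : I t -> is_derive x (edir R i) (f t) (h t x).
  move=> It; have [_ _ /(_ i)[G _ DG]] := HM t It.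
  by rewrite /h; have [_ ->] := DG x; exact: DG.
exists h => //; apply: IH.
  exists M => // t It; have [_ _ /(_ i)[G CG DG]] := HM t It.
  apply: ck_le_ext CG => x; have [_ <-] := DG x; exact: erefl.
move=> e e0; apply: near_labels_imp (Hc e e0) => s c t c' Is It [_ _ /(_ i)[G CG DG]].
apply: ck_le_ext CG => x.
have [_ <-] := DG x.
have D : is_derive x (edir R i) (fun x => f s (x + c) - f t (x + c')) (h s (x + c) - h t (x + c')).
  by apply: is_deriveB; apply: is_derive_shift_arg; exact: Dh.
by have [_ ->] := D.
Qed.

End HolderBounds.

(** * Passage between the Hoelder norm of the statement and the recursive classes *)

Section HolderNorm.
Variables (R : realType) (n : nat) (m T : R).
Hypotheses (m0 : 0 <= m).
Local Notation V := 'rV[R]_n.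
Local Notation I := (inI T).
Local Notation k := (ipart m).
Local Notation g := (fpart m).
Local Notation pw h := (h `^ g).
Local Notation holder_le := (@holder_le R n g).
Local Notation ck_le := (@ck_le R n g).
Local Notation apc := (@apc R n g T).
Local Notation apCk := (@apCk R n g T).
Local Notation np := (@near_labels R n T).
Implicit Types (F G : V -> R) (f h : R -> V -> R).

Lemma fpart_ge0 : 0 <= g.
Proof. by rewrite subr_ge0; have /andP[] := truncn_itv m0. Qed.

Lemma fpart_lt1 : g < 1.
Proof.
have /andP[_] := truncn_itv m0; rewrite /fpart /ipart -natr1; lra.
Qed.

(** In [pd] the last index is the first derivative taken, whereas the recursive classes peel off
    that first derivative; inductions on [s] therefore run from its right end. *)
Lemma pd_rcons s i F : pd (rcons s i) F = pd s ('D_(edir R i) F).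
Proof. by rewrite /pd foldr_rcons. Qed.

Lemma ck_le_pd j e F : ck_le j e F -> forall s, (size s <= j)%N ->
  [/\ continuous (pd s F), holder_le e (pd s F) &
    (size s < j)%N -> forall i x, derivable (pd s F) x (edir R i)].
Proof.
elim: j F => [|j IH] F CF s.
  by rewrite leqn0 size_eq0 => /eqP ->; case: CF.
case: CF => cF hF H; case/lastP: s => [_|s i].
  by split=> // _ i x; have [G _ DG] := H i; have [] := DG x.
rewrite size_rcons ltnS pd_rcons => sj; have [G CG DG] := H i.
have -> : 'D_(edir R i) F = G by apply/funext => x; have [_ ->] := DG x.
by have [cG hG dG] := IH G CG s sj; split=> // sj'; apply: dG.
Qed.

Lemma pd_ck_le j (e : R) F :
  (forall s, (size s < j)%N -> forall i x, derivable (pd s F) x (edir R i)) ->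
  (forall s, (size s <= j)%N -> continuous (pd s F)) ->
  (forall s, (size s <= j)%N -> forall x, `|pd s F x| <= e) ->
  (forall s, size s = j -> g != 0 -> forall x y, `|pd s F x - pd s F y| <= e * pw `|x - y|) ->
  ck_le j ((n%:R + 2) * e) F.
Proof.
elim: j F => [|j IH] F dF cF bF hF.
all: have e0 : 0 <= e by have := bF [::] isT 0; apply: le_trans.
all: have n0 : 0 <= n%:R :> R by [].
all: split; first exact: (cF [::]).
- have b0 := bF [::] isT.
  split=> [x|x y].
    by apply: (le_trans (b0 x)); rewrite ler_peMl //; lra.
  have [g0|gn] := eqVneq g 0.
    rewrite g0 powRr0 mulr1; apply: (le_trans (ler_normB _ _)).
    have := b0 x; have := b0 y; rewrite /= => h1 h2.
    have : 0 <= n%:R * e by rewrite mulr_ge0.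
    lra.
  apply: (le_trans (hF [::] erefl gn x y)); rewrite ler_wpM2r ?powR_ge0 //.
  by rewrite ler_peMl //; lra.
- by [].
- apply: holder_le_of_lip; rewrite ?fpart_ge0 ?fpart_lt1 //; first exact: (bF [::]).
  apply: (@C1_lipschitz _ _ F (fun i => 'D_(edir R i) F)) => [i z|i z].
    by apply: DeriveDef => //; exact: (dF [::]).
  exact: (bF [:: i]).
- move=> i; exists ('D_(edir R i) F) => [|x]; last by apply: DeriveDef => //; exact: (dF [::]).
  apply: IH => s; rewrite -pd_rcons => sj.
  + by apply: dF; rewrite size_rcons.
  + by apply: cF; rewrite size_rcons.
  + by apply: bF; rewrite size_rcons.
  + by apply: hF; rewrite size_rcons sj.
Qed.

Lemma unif_bound_seq j (Q : seq 'I_n -> R -> Prop) :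
  (forall s x y, x <= y -> Q s x -> Q s y) ->
  (forall s, (size s <= j)%N -> exists2 M, 0 <= M & Q s M) ->
  exists2 M, 0 <= M & forall s, (size s <= j)%N -> Q s M.
Proof.
elim: j Q => [|j IH] Q mono H.
  have [M M0 QM] := H [::] isT; exists M => // s.
  by rewrite leqn0 size_eq0 => /eqP ->.
have [M M0 QM] := H [::] isT.
have [N N0 QN] : exists2 N, 0 <= N & forall i s, (size s <= j)%N -> Q (i :: s) N.
  apply: fin_unif_le => [i x y xy Hx s sj|i]; first by apply: mono xy _; exact: Hx.
  by apply: IH => [s x y|s sj]; [exact: mono|exact: H].
exists (M + N); first by rewrite addr_ge0.
case=> [_|i s sj]; first by apply: mono QM; rewrite lerDl.
by apply: mono (QN i s sj); rewrite lerDr.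
Qed.

Definition pd_values F : set R :=
  [set r | exists s : seq 'I_n, exists x, (size s <= k)%N /\ r = `|pd s F x|].

Definition pd_quotients F : set R :=
  [set r | exists s : seq 'I_n, exists x y, size s = k /\ x != y /\
     r = `|pd s F x - pd s F y| / pw `|x - y|].

Lemma hnormE F : hnorm m F = sup (pd_values F) + (if g == 0 then 0 else sup (pd_quotients F)).
Proof. by []. Qed.

(** A set that is empty or unbounded above has [sup] equal to [0] by convention, so nonnegativity
    needs no regularity. *)
Lemma sup_ge0 (A : set R) : (forall x, A x -> 0 <= x) -> 0 <= sup A.
Proof.
move=> A0; have [[[a Aa] ub]|nA] := pselect (has_sup A).
  by apply: le_trans (A0 a Aa) _; apply: ub_le_sup.
by rewrite sup_out.
Qed.

Lemma sup_pd_values_ge0 F : 0 <= sup (pd_values F).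
Proof. by apply: sup_ge0 => _ [s [x [_ ->]]]. Qed.

Lemma sup_pd_quotients_ge0 F : 0 <= sup (pd_quotients F).
Proof. by apply: sup_ge0 => _ [s [x [y [_ [_ ->]]]]]; rewrite divr_ge0 ?powR_ge0. Qed.

Lemma hnorm_ge0 F : 0 <= hnorm m F.
Proof.
rewrite hnormE addr_ge0 ?sup_pd_values_ge0 //; case: ifP => // _; exact: sup_pd_quotients_ge0.
Qed.

Lemma ck_le_Cmb e F : ck_le k e F -> Cmb m F.
Proof.
move=> /ck_le_pd H; split.
  split=> s sk; first by have [|_ _] := H s; [exact: ltnW|exact].
  have [cs [bs _] _] := H s sk; split=> //; by exists e.
by move=> _ s sk; have [|_ [_ hs] _] := H s; [rewrite sk|exists e].
Qed.

Lemma ck_le_hnorm e F : ck_le k e F -> hnorm m F <= 2 * e.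
Proof.
move=> CF; have e0 := holder_le_ge0 (ck_le_holder_le CF).
have H := ck_le_pd CF; rewrite hnormE.
have h1 : sup (pd_values F) <= e.
  apply: ge_sup; first by exists `|pd [::] F 0|, [::], 0.
  by move=> _ [s [x [sk ->]]]; have [_ [b _] _] := H s sk.
have h2 : sup (pd_quotients F) <= e.
  (* There are no quotients when [n = 0], the space then being a single point. *)
  have [->|/set0P ne] := eqVneq (pd_quotients F) set0; first by rewrite sup0.
  apply: ge_sup => // _ [s [x [y [sk [xy ->]]]]].
  have [|_ [_ hs] _] := H s; first by rewrite sk.
  by rewrite ler_pdivrMr // powR_gt0 // normr_gt0 subr_eq0.
case: ifP => _; lra.
Qed.

Lemma Cmb_bounds F : Cmb m F -> exists2 M, 0 <= M & forall s, (size s <= k)%N ->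
  (forall x, `|pd s F x| <= M) /\
  (size s = k -> g != 0 -> forall x y, `|pd s F x - pd s F y| <= M * pw `|x - y|).
Proof.
move=> [[dF cF] hF].
apply: unif_bound_seq => [s x y xy [h1 h2]|s sk].
  split=> [z|sk gn z w]; first exact: le_trans xy.
  by apply: (le_trans (h2 sk gn z w)); rewrite ler_wpM2r ?powR_ge0.
have [_ [M HM]] := cF s sk.
have [C HC] : exists C, size s = k -> g != 0 -> forall x y, `|pd s F x - pd s F y| <= C * pw `|x - y|.
  have [sk'|/eqP sn] := eqVneq (size s) k; last by exists 0.
  have [g0|gn] := eqVneq g 0; first by exists 0.
  by have [C HC] := hF gn s sk'; exists C.
exists (`|M| + `|C|); first by rewrite addr_ge0.
split=> [x|sk' gn x y].
  by apply: (le_trans (HM x)); apply: (le_trans (ler_norm _)); rewrite lerDl.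
apply: (le_trans (HC sk' gn x y)); rewrite ler_wpM2r ?powR_ge0 //.
by apply: (le_trans (ler_norm _)); rewrite lerDr.
Qed.

(** Membership in [Cmb] makes the sets of values and quotients bounded; without it a small [hnorm]
    could be the default value of [sup]. *)
Lemma hnorm_ck_le (e : R) F : Cmb m F -> hnorm m F <= e -> ck_le k ((n%:R + 2) * e) F.
Proof.
move=> CF he; have [M M0 HM] := Cmb_bounds CF; have [[dF cF] _] := CF.
move: he; rewrite hnormE => he.
have v0 := sup_pd_values_ge0 F; have q0 := sup_pd_quotients_ge0 F.
apply: pd_ck_le => // [s sk|s sk x|s sk gn x y].
- by have [] := cF s sk.
- apply: (@le_trans _ _ (sup (pd_values F))); last by move: he; case: ifP => _; lra.
  apply: ub_le_sup; last by exists s, x.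
  by exists M => _ [s' [x' [sk' ->]]]; have [+ _] := HM s' sk'; apply.
- move: he; rewrite (negbTE gn) => he.
  have [->|xy] := eqVneq x y; first by rewrite !subrr normr0 mulr_ge0 ?powR_ge0 //; lra.
  have p0 : 0 < pw `|x - y| by rewrite powR_gt0 // normr_gt0 subr_eq0.
  rewrite -ler_pdivrMr //; apply: (@le_trans _ _ (sup (pd_quotients F))); last by lra.
  apply: ub_le_sup; last by exists s, x, y.
  exists M => _ [s' [x' [y' [sk' [xy' ->]]]]].
  rewrite ler_pdivrMr; last by rewrite powR_gt0 // normr_gt0 subr_eq0.
  by have [|_] := HM s' _; [rewrite sk'|apply].
Qed.

Lemma Cmb_ck_le F : Cmb m F -> exists2 M, 0 <= M & ck_le k M F.
Proof.
move=> CF; exists ((n%:R + 2) * hnorm m F); last exact: hnorm_ck_le.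
by rewrite mulr_ge0 ?hnorm_ge0 //; have : 0 <= n%:R :> R by []; lra.
Qed.

Lemma vnorm_hnorm (W : V -> V) i : hnorm m (Defs.comp i W) <= vnorm m W.
Proof.
by rewrite /vnorm (bigD1 i) //= lerDl; apply: sumr_ge0 => j _; exact: hnorm_ge0.
Qed.

(** The [2] is the loss of [ck_le_hnorm]; dividing by [n + 1] rather than [n] keeps the inequality
    strict and the divisor positive. *)
Lemma vnorm_lt (W : V -> V) (e : R) : 0 < e ->
  (forall i, ck_le k (e / (2 * (n%:R + 1))) (Defs.comp i W)) -> vnorm m W < e.
Proof.
move=> e0 H; have n0 : 0 <= n%:R :> R by [].
apply: (@le_lt_trans _ _ (n%:R * (2 * (e / (2 * (n%:R + 1)))))).
  by apply: le_sum_ord => i; exact: ck_le_hnorm.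
rewrite (_ : _ * _ = n%:R * e / (n%:R + 1)).
  rewrite ltr_pdivrMr; lra.
by field; rewrite lt0r_neq0 //; lra.
Qed.

(** One representative translation for each label that occurs forms a finite net; labels that do not
    occur receive [0]. *)
Lemma apCk_Cmap f t : apCk k f -> I t -> Cmap m (f t).
Proof.
move=> Cf It; have [M M0 HM] := apCk_bound fpart_ge0 Cf.
split; first exact: ck_le_Cmb (HM t It).
move=> e e0; have e3 : 0 < e / 3 by rewrite divr_gt0.
have [d [K [L [d0 Hd]]]] := apCk_close fpart_ge0 e3 Cf.
have /choice[rep Hrep] : forall l : K, exists c, (exists c', L c' = l) -> L c = l.
  by move=> l; have [[c Lc]|nc] := pselect (exists c', L c' = l); [exists c|exists 0].
exists [seq rep l | l <- enum K] => c; exists (rep (L c)).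
  by apply/map_f; rewrite mem_enum.
have := Hd t t c (rep (L c)) It It; rewrite subrr normr0 => /(_ d0 _)/wrap[|/ck_le_hnorm].
  by rewrite Hrep //; exists c.
move=> h; apply: (le_lt_trans h); lra.
Qed.

Lemma apCk_Cm_curve (v : R -> V -> V) : (forall i, apCk k (fun t x => v t x 0 i)) -> Cm_curve m T v.
Proof.
move=> Cv; split=> [t It i|t It e e0]; first exact: (apCk_Cmap (Cv i) It).
have n0 : 0 <= n%:R :> R by [].
have e1 : 0 < e / (2 * (n%:R + 1)) by rewrite divr_gt0 // mulr_gt0 //; lra.
have [d [K [L [d0 Hd]]]] := near_labels_fin (fun i => apCk_close fpart_ge0 e1 (Cv i)).
exists d => // s Is st; apply: vnorm_lt => // i.
apply: ck_le_ext (Hd s t 0 0 Is It st erefl i) => x.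
by rewrite !addr0 /Defs.comp rVBE.
Qed.

(** A Lebesgue number argument: half radii leave room for a further step in time inside the original
    ball. *)
Lemma compact_cover_balls (r : R -> R) : (forall t, I t -> 0 < r t) ->
  exists2 ts : seq R, (forall t, t \in ts -> I t) &
    forall t, I t -> exists2 t', t' \in ts & `|t - t'| < r t' / 2.
Proof.
move=> r0; have := @segment_compact R 0 T; rewrite compact_cover => cc.
have [t It|t|D DI HD] := cc R [set t | I t] (fun t => ball t (r t / 2)).
- exact: ball_open.
- rewrite /= in_itv /= => It; exists t => //.
  by apply: ballxx; rewrite divr_gt0 // r0.
exists (finmap.enum_fset D) => [t tD|t It].
  by have := DI t tD; rewrite inE.
have [|t' t'D] := HD t; first by rewrite /= in_itv.
by rewrite -ball_normE /= distrC => h; exists t'.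
Qed.

(** Compactness of [[0,T]] reduces everything to finitely many times [t'], and the label of a vector
    collects its labels at these times. Then [f s (x + c) - f t (x + c')] passes through
    [f t' (x + c)] and [f t' (x + c')], each of the three steps costing [e / 3]. *)
Lemma Cm_curve_apCk (v : R -> V -> V) i : 0 < T -> Cm_curve m T v -> apCk k (fun t x => v t x 0 i).
Proof.
move=> T0 [Cv cv]; pose f : R -> V -> R := fun t x => v t x 0 i; rewrite -/f.
have n0 : 0 <= n%:R :> R by [].
have q0 : 0 < n%:R + 2 :> R by lra.
have fM t : I t -> exists2 M, 0 <= M & ck_le k M (f t).
  by move=> It; apply: Cmb_ck_le; have [] := Cv t It i.
have hsmall (e : R) F : Cmb m F -> 0 < e -> hnorm m F < e / (n%:R + 2) -> ck_le k e F.
  move=> CF e0 h; apply: ck_le_mono (hnorm_ck_le CF (ltW h)).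
  by rewrite mulrC divfK // lt0r_neq0.
have ftime t (e : R) : I t -> 0 < e -> exists2 d : R, 0 < d & forall s, I s -> `|s - t| < d ->
    ck_le k e (fun x => f s x - f t x).
  move=> It e0; have e1 : 0 < e / (n%:R + 2) by rewrite divr_gt0.
  have [d d0 Hd] := cv t It _ e1; exists d => // s Is st.
  have [M M0 HM] := fM t It; have [N N0 HN] := fM s Is.
  apply: hsmall => //; first exact: ck_le_Cmb (ck_leB HN HM).
  apply: le_lt_trans (Hd s Is st).
  have := vnorm_hnorm (fun x => v s x - v t x) i; rewrite /Defs.comp.
  by under eq_fun do rewrite rVBE.
have fspace t (e : R) : I t -> 0 < e -> exists (K : finType) (L : V -> K), forall c c', L c = L c' ->
    ck_le k e (fun x => f t (x + c) - f t (x + c')).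
  move=> It e0; have e1 : 0 < e / 2 / (n%:R + 2) by rewrite !divr_gt0.
  have [_ /(_ _ e1)[cs Hcs]] := Cv t It i; have [M M0 HM] := fM t It.
  have /choice[D HD] : forall c, exists d, d \in cs /\
      hnorm m (fun x => f t (x + c) - f t (x + d)) < e / 2 / (n%:R + 2).
    by move=> c; have [d dcs h] := Hcs c; exists d.
  (* The label of [c] is the position of a net element chosen near it; the successor is there for
     [inord]. *)
  exists 'I_(size cs).+1, (fun c => inord (index (D c) cs)) => c c' /(congr1 val) /=.
  have szD b : (index (D b) cs < (size cs).+1)%N by rewrite ltnS index_size.
  have Dcs b : D b \in cs by case: (HD b).
  rewrite !inordK // => /(congr1 (nth 0 cs)); rewrite !nth_index // => E.
  have H b : ck_le k (e / 2) (fun x => f t (x + b) - f t (x + D b)).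
    apply: hsmall; rewrite ?divr_gt0 //; last by case: (HD b).
    exact: ck_le_Cmb (ck_leB (ck_le_shift b HM) (ck_le_shift (D b) HM)).
  apply: (@ck_le_mono _ _ _ _ (e / 2 + e / 2)); first by lra.
  by apply: ck_le_ext (ck_leB (H c) (H c')) => x /=; rewrite E; ring.
have cover (e : R) : 0 < e -> exists2 d : R, 0 < d & exists2 ts : seq R, (forall t, t \in ts -> I t) &
    forall t, I t -> exists2 t', t' \in ts & forall s, I s -> `|s - t| < d ->
      ck_le k e (fun x => f s x - f t' x).
  move=> e0; have /choice[r Hr] : forall t, exists r : R, I t -> 0 < r /\ forall s, I s -> `|s - t| < r ->
      ck_le k e (fun x => f s x - f t x).
    move=> t; have [It|nI] := boolP (I t); last by exists 0.
    by have [d d0 Hd] := ftime t e It e0; exists d.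
  have [|ts tsI Hts] := @compact_cover_balls r; first by move=> t /Hr[].
  have [d d0 Hd] : exists2 d : R, 0 < d & forall t, t \in ts -> d <= r t / 2.
    elim: ts tsI {Hts} => [|t ts IH] tsI; first by exists 1.
    have [s st|d d0 Hd] := IH; first by apply: tsI; rewrite inE st orbT.
    have [rt _] := Hr t (tsI t (mem_head _ _)).
    exists (Num.min d (r t / 2)); first by rewrite lt_min d0 divr_gt0.
    by move=> s; rewrite inE => /predU1P[->|/Hd h]; rewrite ge_min ?lexx ?orbT // h.
  exists d => //; exists ts => // t It; have [t' t'ts tt'] := Hts t It; exists t' => // s Is st.
  have [_] := Hr t' (tsI t' t'ts); apply=> //.
  rewrite (_ : s - t' = (s - t) + (t - t')); last by ring.
  by apply: (le_lt_trans (ler_normD _ _)); have := Hd t' t'ts; lra.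
apply: (apCk_of_ck_le fpart_lt1).
- have [d d0 [ts tsI Hts]] := cover 1 ltr01.
  have [M M0 HM] : exists2 M : R, 0 <= M & forall t, t \in ts -> ck_le k M (f t).
    elim: ts tsI {Hts} => [|t ts IH] tsI; first by exists 0.
    have [s st|M M0 HM] := IH; first by apply: tsI; rewrite inE st orbT.
    have [N N0 HN] := fM t (tsI t (mem_head _ _)).
    exists (M + N); first by rewrite addr_ge0.
    move=> s; rewrite inE => /predU1P[->|/HM]; first by apply: ck_le_mono HN; rewrite lerDr.
    by apply: ck_le_mono; rewrite lerDl.
  exists (1 + M) => [|t It]; first by rewrite addr_ge0.
  have [t' t'ts H] := Hts t It; have := H t It; rewrite subrr normr0 => /(_ d0) h.
  by apply: ck_le_ext (ck_leD h (HM t' t'ts)) => x /=; rewrite subrK.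
- move=> e e0; have e3 : 0 < e / 3 by rewrite divr_gt0.
  have [d d0 [ts tsI Hts]] := cover _ e3.
  have [K [L HL]] : exists (K : finType) (L : V -> K), forall t, t \in ts -> forall c c', L c = L c' ->
      ck_le k (e / 3) (fun x => f t (x + c) - f t (x + c')).
    elim: ts tsI {Hts} => [|t ts IH] tsI; first by exists unit, (fun=> tt).
    have [s st|K [L HL]] := IH; first by apply: tsI; rewrite inE st orbT.
    have [K' [L' HL']] := fspace t _ (tsI t (mem_head _ _)) e3.
    exists (K * K')%type, (fun c => (L c, L' c)) => s + c c' [Lc Lc'].
    by rewrite inE => /predU1P[->|/HL]; [exact: HL'|exact].
  exists d, K, L; split=> // s t c c' Is It st Lc.
  have [t' t'ts H] := Hts t It.
  have h1 := ck_le_shift c (H s Is st).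
  have h2 : ck_le k (e / 3) (fun x => f t (x + c') - f t' (x + c')).
    by apply: (ck_le_shift c' (H t It _)); rewrite subrr normr0.
  have h3 := HL t' t'ts c c' Lc.
  apply: (@ck_le_mono _ _ _ _ ((e / 3 + e / 3) + e / 3)); first by lra.
  by apply: ck_le_ext (ck_leB (ck_leD h1 h3) h2) => x /=; ring.
Qed.

Lemma ddt_of_diffquot (w v : R -> R) :
  (forall t, I t -> forall e : R, 0 < e -> exists2 d : R, 0 < d & forall s, I s ->
     0 < `|s - t| < d -> `|(s - t)^-1 * (w s - w t) - v t| <= e) -> ddt T w v.
Proof.
move=> H.
have H' t : I t -> forall e : R, 0 < e -> exists2 d : R, 0 < d & forall s, I s ->
    `|s - t| < d -> `|w s - w t - (s - t) * v t| <= e * `|s - t|.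
  move=> It e e0; have [d d0 Hd] := H t It e e0; exists d => // s Is st.
  have [->|sn] := eqVneq s t; first by rewrite !subrr mul0r subrr normr0 mulr0.
  have st0 : s - t != 0 by rewrite subr_eq0.
  have := Hd s Is; rewrite normr_gt0 st0 st => /(_ isT) h.
  rewrite (_ : _ - _ - _ = ((s - t)^-1 * (w s - w t) - v t) * (s - t)).
    by rewrite normrM ler_wpM2r.
  by field.
split.
  apply/contIP => t It e e0; have [d d0 Hd] := H' t It 1 ltr01.
  have v0 : 0 < 1 + `|v t| by rewrite ltr_wpDr.
  exists (Num.min d (e / (1 + `|v t|))) => [|s Is]; first by rewrite lt_min d0 divr_gt0.
  rewrite lt_min => /andP[/(Hd s Is) h]; rewrite ltr_pdivlMr // => h2.
  rewrite (_ : w s - w t = (w s - w t - (s - t) * v t) + (s - t) * v t); last by ring.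
  apply: (le_trans (ler_normD _ _)); rewrite normrM; lra.
move=> t /andP[t0 tT]; have It : I t by rewrite /inI !ltW.
apply/is_derive_epsP => e e0; have [d d0 Hd] := H' t It e e0.
exists (Num.min d (Num.min t (T - t))) => [|r]; first by rewrite !lt_min d0 t0 subr_gt0.
rewrite !lt_min => /andP[rd /andP[rt rT]].
have r1 : r *: (1 : R) = r by rewrite /GRing.scale /= mulr1.
rewrite r1; have := Hd (t + r); rewrite addrAC subrr add0r; apply=> //.
by move: rt rT; rewrite !ltr_norml /inI; lra.
Qed.

(** The norm dominates the values at each point, so differentiability in norm gives the equation
    pointwise, and uniqueness reduces to that of trajectories. The difference quotient must first be
    placed in [Cmb], so that its norm bounds it. *)
Lemma solution_is_flow (u phi : R -> V -> V) : is_solution m T u phi -> is_flow T u phi.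
Proof.
move=> [Dphi [dphi [dd [[Cd _] [eqn init]]]]]; split=> // x i.
have d1 : ddt T (fun t => phi t x 0 i - x 0 i) (fun t => dphi t x 0 i).
  apply: ddt_of_diffquot => t It e e0; have n0 : 0 <= n%:R :> R by [].
  have e1 : 0 < e / (n%:R + 2) by rewrite divr_gt0 //; lra.
  have [d d0 Hd] := dd t It _ e1; exists d => // s Is st.
  pose F := Defs.comp i (fun x => (s - t)^-1 *: (phi s x - x - (phi t x - x)) - dphi t x).
  have FE y : F y = (s - t)^-1 * ((phi s y 0 i - y 0 i) - (phi t y 0 i - y 0 i)) - dphi t y 0 i.
    by rewrite /F /Defs.comp rVBE mxE !rVBE.
  have CF : Cmb m F.
    have disp r : I r -> exists2 M, 0 <= M & ck_le k M (fun y => phi r y 0 i - y 0 i).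
      move=> Ir; have [/(_ i)[/Cmb_ck_le[M M0 HM] _] _] := Dphi r Ir; exists M => //.
      by apply: ck_le_ext HM => y; rewrite /Defs.comp rVBE.
    have [M1 _ H1] := disp s Is; have [M2 _ H2] := disp t It.
    have [M3 _ H3] : exists2 M, 0 <= M & ck_le k M (fun y => dphi t y 0 i).
      by apply: Cmb_ck_le; have [] := Cd t It i.
    apply: ck_le_Cmb (ck_le_ext _ (ck_leB (ck_leZ (s - t)^-1 (ck_leB H1 H2)) H3)) => y.
    by rewrite FE.
  have hF := le_lt_trans (vnorm_hnorm _ i) (Hd s Is st).
  have [+ _] := ck_le_holder_le (hnorm_ck_le CF (ltW hF)) => /(_ x).
  by rewrite mulrC divfK ?FE // lt0r_neq0 //; lra.
apply: ddt_ext (ddtD d1 (ddt_cst T (x 0 i))) => t It; first by rewrite subrK.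
by rewrite addr0 eqn.
Qed.

Lemma flow_is_solution (u P : R -> V -> V) : (0 < k)%N -> 0 < T ->
  (forall i, apCk k (fun t x => u t x 0 i)) -> is_flow T u P -> is_solution m T u P.
Proof.
move=> k0 T0; have [j kE] : exists j, k = j.+1 by exists k.-1; rewrite prednK.
rewrite kE => Cu fP.
have Cu1 i : apCk 1 (fun t x => u t x 0 i).
  by elim: j {kE} Cu => [|j IH] Cu; [exact: Cu|apply: IH => l; exact: apCk_pred].
have CP := C1apCk_flow fpart_ge0 fpart_lt1 T0 Cu1 fP Cu.
rewrite -kE in CP.
split=> [t It|].
  split=> [i|].
    rewrite (_ : Defs.comp i _ = fun x => P t x 0 i - x 0 i).
      by apply: (apCk_Cmap (f := fun t x => P t x 0 i - x 0 i)) => //; have [] := C1apCk_apCk (CP i).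
    by apply/funext => x; rewrite /Defs.comp rVBE.
  have [e e0 He] := flow_jacobian fpart_ge0 fpart_lt1 T0 Cu1 fP.
  by exists e; split=> // x; exact: He.
exists (fun t x => u t (P t x)); split; last split; last by split=> //; exact: fP.1.
- move=> t It e e0; have n0 : 0 <= n%:R :> R by [].
  have e1 : 0 < e / (2 * (n%:R + 1)) by rewrite divr_gt0 // mulr_gt0 //; lra.
  have [d d0 Hd] : exists2 d : R, 0 < d & forall i s t, I s -> I t -> 0 < `|s - t| -> `|s - t| < d ->
    ck_le k (e / (2 * (n%:R + 1))) (fun x => (s - t)^-1 * ((P s x 0 i - x 0 i) - (P t x 0 i - x 0 i)) - u t (P t x) 0 i).
    apply: fin_unif_ge => [i a b ab H s r Is Ir sr0 sr|i].
      by apply: H => //; exact: lt_le_trans ab.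
    exact: C1apCk_diffquot fpart_ge0 _ _ _ _ e1 (CP i).
  exists d => // s Is /andP[st0 st]; apply: vnorm_lt => // i.
  apply: ck_le_ext (Hd i s t Is It st0 st) => x.
  by rewrite /Defs.comp rVBE mxE !rVBE.
- by apply: apCk_Cm_curve => i; have [] := C1apCk_apCk (CP i).
Qed.

End HolderNorm.

Theorem theorem5p6 (R : realType) (n : nat) (m T : R) :
  2 <= m -> 0 < T ->
  forall u : R -> 'rV[R]_n -> 'rV[R]_n, Cm_curve m T u ->
    (exists phi, is_solution m T u phi) /\
    (forall phi1 phi2, is_solution m T u phi1 -> is_solution m T u phi2 ->
       forall t, 0 <= t <= T -> phi1 t = phi2 t).
Proof.
move=> m2 T0 u Cu; have m0 : 0 <= m by lra.
have k0 : (0 < ipart m)%N.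
  by rewrite /ipart -ltnS -(ltr_nat R); have /andP[_] := truncn_itv m0; lra.
have Ck i := Cm_curve_apCk m0 i T0 Cu.
have C1 i : apCk (fpart m) T 1 (fun t x => u t x 0 i).
  have := Ck i; case: (ipart m) k0 => // j _; elim: j => [//|j IH] /apCk_pred; exact: IH.
split.
  have [P fP] := flow_exists T0 C1.
  by exists P; exact: flow_is_solution fP.
move=> phi1 phi2 /(solution_is_flow m0) f1 /(solution_is_flow m0) f2 t It.
by apply/funext => x; exact: (flow_unique C1 f1 f2).
Qed.
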